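(* Let $n\in\mathbb N$, $q>1$ and $p\in(\tfrac23 q+1,\,q+\tfrac23)$, and let $\gamma\in C^1(\mathbb R/\mathbb Z,\mathbb R^n)$ be an injective curve parametrized by arc-length. Then $\mathrm{intM}^{(p,q)}(\gamma)<\infty$ if and only if $\gamma\in W^{(3p-2)/q-1,\,q}(\mathbb R/\mathbb Z,\mathbb R^n)$. Moreover, one then has, for constants $C,\beta>0$ depending on $p,q$ only, $$\|\gamma\|_{W^{(3p-2)/q-1,q}}\le C\left(\mathrm{intM}^{(p,q)}(\gamma)+\mathrm{intM}^{(p,q)}(\gamma)^\beta\right).$$
   Context: For $a,b\in\mathbb R^n$ put $|a\wedge b|=\sqrt{|a|^2|b|^2-\langle a,b\rangle^2}$. For $x,y,z\in\mathbb R^n$ let $$R^{(p,q)}(x,y,z)=\frac{(|y-z||y-x||z-x|)^p}{|(y-x)\wedge(z-x)|^q}.$$ For an absolutely continuous curve $\gamma:\mathbb R/\mathbb Z\to\mathbb R^n$ and $p,q>0$ the generalized integral Menger curvature is $$\mathrm{intM}^{(p,q)}(\gamma)=\iiint_{(\mathbb R/\mathbb Z)^3}\frac{|\gamma'(u_1)||\gamma'(u_2)||\gamma'(u_3)|}{R^{(p,q)}(\gamma(u_1),\gamma(u_2),\gamma(u_3))}\,du_1\,du_2\,du_3,$$ where $1/R^{(p,q)}(x,y,z)$ is read as $|(y-x)\wedge(z-x)|^q/(|y-z||y-x||z-x|)^p$ (so it is $0$ at distinct collinear points). Parametrized by arc-length means $|\gamma'|=1$. Sobolev–Slobodeckij spaces: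 for $s\in(0,1)$, $\rho\in[1,\infty)$ and $f\in W^{1,1}(\mathbb R/\mathbb Z,\mathbb R^n)$ set $$[f]_{W^{1+s,\rho}}=\left(\int_{\mathbb R/\mathbb Z}\int_{-1/2}^{1/2}\frac{|f'(u+w)-f'(u)|^\rho}{|w|^{1+\rho s}}\,dw\,du\right)^{1/\rho}.$$ For $k\in\mathbb N$, $W^{k+s,\rho}$ is the set of $f\in W^{k,\rho}(\mathbb R/\mathbb Z,\mathbb R^n)$ for which the norm $\|f\|_{W^{k+s,\rho}}=\|f\|_{W^{k,\rho}}+[f^{(k-1)}]_{W^{1+s,\rho}}$ is finite. (For the given $p,q$ one has $(3p-2)/q-1\in(1+\tfrac1q,2)$.)
   Formalization: The norm estimate is stated for γ−γ(u0), for every u0, instead of γ: intM is translation invariant while the norm contains the L^q norm of γ, so for translates of a round circle the literal inequality fails for any constants depending on p, q only. *)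

(* Defs.v *)
From HB Require Import structures.
From mathcomp Require Import all_boot all_order all_algebra.
From mathcomp Require Import all_classical all_reals all_analysis.

Set Implicit Arguments.
Unset Strict Implicit.
Unset Printing Implicit Defensive.

Import Order.TTheory GRing.Theory Num.Theory.
Import numFieldNormedType.Exports.

Local Open Scope classical_set_scope.
Local Open Scope ring_scope.

(* A map on R/Z is a map on R of period 1, and an integral over R/Z is an
   integral over [0, 1].  The norm that the library puts on 'rV[R]_n is the
   sup-norm: it is used only for its topology (derivatives, continuity). *)

Section Euclidean.
Context {R : realType} {n : nat}.
Implicit Types a b x y z : 'rV[R]_n.

Definition dotp a b : R := \sum_i a ord0 i * b ord0 i.

Definition enorm a : R := Num.sqrt (dotp a a).

Definition wedge_norm a b : R :=
  Num.sqrt (enorm a ^+ 2 * enorm b ^+ 2 - dotp a b ^+ 2).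

(* 1 / R^(p,q)(x,y,z); for p, q > 0 it is 0 at distinct collinear points, and
   also (since 0^-1 = 0) at triples that are not pairwise distinct. *)
Definition inv_Rpq (p q : R) x y z : R :=
  (wedge_norm (y - x) (z - x)) `^ q /
  (enorm (y - z) * enorm (y - x) * enorm (z - x)) `^ p.

End Euclidean.

Section Curves.
Context {R : realType} {n : nat}.
Implicit Types f gamma : R -> 'rV[R]_n.

Notation mu := (@lebesgue_measure R).

Definition C1_circle gamma : Prop :=
  [/\ periodic gamma 1,
      (forall u, derivable gamma u 1) &
      continuous (derive1 gamma)].

Definition injective_circle gamma : Prop :=
  forall u v, gamma u = gamma v -> exists k : int, u - v = k%:~R.

Definition arclength_parametrized gamma : Prop :=
  forall u, enorm (derive1 gamma u) = 1.

Definition intM (p q : R) gamma : \bar R :=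
  (\int[mu]_(u1 in `[0%R, 1%R]) \int[mu]_(u2 in `[0%R, 1%R])
     \int[mu]_(u3 in `[0%R, 1%R])
     (enorm (derive1 gamma u1) * enorm (derive1 gamma u2) *
      enorm (derive1 gamma u3) *
      inv_Rpq p q (gamma u1) (gamma u2) (gamma u3))%R%:E)%E.

Definition absolutely_continuous01 f : Prop :=
  forall e : R, 0 < e -> exists2 d : R, 0 < d &
  forall (m : nat) (a b : 'I_m -> R),
    (forall i, 0 <= a i /\ a i <= b i /\ b i <= 1) ->
    (forall i j, i != j -> b i <= a j \/ b j <= a i) ->
    \sum_i (b i - a i) < d ->
    \sum_i enorm (f (b i) - f (a i)) < e.

Definition Lp_norm (rho : R) f : \bar R :=
  ((\int[mu]_(u in `[0%R, 1%R]) ((enorm (f u)) `^ rho)%R%:E) `^ rho^-1)%E.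

Definition W_int_norm (k : nat) (rho : R) f : \bar R :=
  (\sum_(j < k.+1) Lp_norm rho (derive1n j f))%E.

(* W^{k,rho}(R/Z, R^n), each class being identified with its representative
   whose derivatives of order < k are absolutely continuous.  Weak derivatives
   are then the classical ones, the k-th one existing almost everywhere. *)
Definition W_int (k : nat) (rho : R) f : Prop :=
  [/\ periodic f 1,
      (forall j, (j < k)%N -> absolutely_continuous01 (derive1n j f)),
      (forall i, measurable_fun setT (fun u => derive1n k f u ord0 i)) &
      (W_int_norm k rho f < +oo)%E].

(* [f]_{W^{1+s,rho}} *)
Definition slobodeckij (s rho : R) f : \bar R :=
  ((\int[mu]_(u in `[0%R, 1%R]) \int[mu]_(w in `[(- 2^-1)%R, (2^-1)%R])
      ((enorm (derive1 f (u + w) - derive1 f u)) `^ rho /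
       `|w| `^ (1 + rho * s))%R%:E) `^ rho^-1)%E.

(* Non-integral order sigma > 1, written k + s with k = truncn sigma and
   0 < s < 1. *)
Definition W_frac_norm (sigma rho : R) f : \bar R :=
  let k := Num.truncn sigma in
  (W_int_norm k rho f + slobodeckij (sigma - k%:R)%R rho (derive1n k.-1 f))%E.

Definition W_frac (sigma rho : R) f : Prop :=
  W_int (Num.truncn sigma) rho f /\ (W_frac_norm sigma rho f < +oo)%E.

End Curves.

(* Main.v *)
(* Put a = 3p - 2q - 1 and E = the double integral of
   |g'(u+v) - g'(u)|^q / v^a over 0 < v < 1/2, which is the q-th power of the
   Slobodeckij seminorm up to a factor.

   From the curvature to the seminorm.  Let S(d) mean that g' oscillates by at
   most 1/4 over distances d.  On such scales the unit chord directions
   e(v) = (g(u+v) - g(u)) / |g(u+v) - g(u)| satisfy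
   |e(v) - e(w)|^q <= C v^(a+1) / R(g(u), g(u+v), g(u+w)) for v/4 < w < v/2.
   Telescoping along w = t v, t^2 v, ... and averaging over t in (1/4, 1/2)
   bounds the integral of |e(v) - g'(u)|^q / v^a by the curvature integrand at
   the vertex g(u); comparing both ends of a chord bounds E restricted to v < d
   by C intM.  A closed curve cannot satisfy S(1/2), so there is a d with S(d)
   for which g' turns by more than 1/8 over a distance at most d; a Morrey
   estimate then gives d^(-(a-2)/q) <= C intM, which controls the range v >= d
   and yields beta = qa/(a-2).

   From the seminorm to finite curvature.  An injective arc-length C^1 curve is
   bilipschitz.  By symmetry only triangles whose longest side is opposite to
   the first vertex matter; there the integrand at g(u), g(u+v), g(u+w) is at
   most C (vw)^(q-p) (v+w)^(-p) (G(v) + G(w)) with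
   G(v) = |(g(u+v) - g(u))/v - g'(u)|^q.  Integrating out one variable leaves
   the integral of G(v) / v^a, which Hardy's inequality bounds by E. *)
Require Import Defs.
From HB Require Import structures.
From mathcomp Require Import all_boot all_order all_algebra.
From mathcomp Require Import all_classical all_reals all_analysis.
From mathcomp Require Import measurable_realfun ring lra.
Import Order.TTheory GRing.Theory Num.Theory.
Import numFieldNormedType.Exports.
Local Open Scope classical_set_scope.
Local Open Scope ring_scope.

(** The exponents come from scaling: with s = (a - 1) / q the order of the space is 1 + s, and the
    two bounds on p say 2 < a < q + 1. The lower one makes the Morrey exponent (a - 2) / q positive.

    The constants of the norm estimate may not depend on the curve, whereas a bilipschitz constant
    obtained from injectivity by compactness does. The estimate therefore stays below the scale d,
    where arcs and chords are comparable by a universal factor, and the curvature itself has to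
    bound d from below; hence the choice of d, which secures both S(d) and a definite turn within
    distance d. The converse is only about finiteness, so its constants may depend on the curve.

    Nothing is known beforehand about the finiteness of E, so no multiple of E can be absorbed. The
    telescoping relies on the continuity of g' instead: the remainder e(t^N v) - g'(u) tends to 0.
    The ratio t must stay away from 0 and 1 to keep all sides of the triangle comparable to v, and
    it must range over an interval because a single ratio would see a null set of pairs (v, w). *)

Section EuclideanGeometry.
Set Implicit Arguments.
Unset Strict Implicit.
Context {R : realType} {n : nat}.
Implicit Types (a b c x y z : 'rV[R]_n) (k l : R).

Lemma dotpC a b : dotp a b = dotp b a.
Proof. by apply: eq_bigr => i _; rewrite mulrC. Qed.

Lemma dotpDl a b c : dotp (a + b) c = dotp a c + dotp b c.
Proof. by rewrite /dotp -big_split; apply: eq_bigr => i _; rewrite mxE mulrDl. Qed.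

Lemma dotpZl k a b : dotp (k *: a) b = k * dotp a b.
Proof. by rewrite /dotp mulr_sumr; apply: eq_bigr => i _; rewrite mxE mulrA. Qed.

Lemma dotpNl a b : dotp (- a) b = - dotp a b.
Proof. by rewrite -scaleN1r dotpZl mulN1r. Qed.

Lemma dotpBl a b c : dotp (a - b) c = dotp a c - dotp b c.
Proof. by rewrite dotpDl dotpNl. Qed.

Lemma dotpDr a b c : dotp c (a + b) = dotp c a + dotp c b.
Proof. by rewrite dotpC dotpDl !(dotpC c). Qed.

Lemma dotpZr k a b : dotp b (k *: a) = k * dotp b a.
Proof. by rewrite dotpC dotpZl dotpC. Qed.

Lemma dotpNr a b : dotp b (- a) = - dotp b a.
Proof. by rewrite dotpC dotpNl dotpC. Qed.

Lemma dotpBr a b c : dotp c (a - b) = dotp c a - dotp c b.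
Proof. by rewrite dotpDr dotpNr. Qed.

Lemma dotp_ge0 a : 0 <= dotp a a.
Proof. by apply: sumr_ge0 => i _; rewrite -expr2 sqr_ge0. Qed.

Lemma enorm_ge0 a : 0 <= enorm a.
Proof. exact: sqrtr_ge0. Qed.

Lemma enorm_sqr a : enorm a ^+ 2 = dotp a a.
Proof. by rewrite sqr_sqrtr ?dotp_ge0. Qed.

Lemma enorm0 : enorm (0 : 'rV[R]_n) = 0.
Proof.
by rewrite /enorm /dotp big1 ?sqrtr0// => i _; rewrite mxE mulr0.
Qed.

Lemma enormN a : enorm (- a) = enorm a.
Proof. by rewrite /enorm dotpNl dotpNr opprK. Qed.

Lemma enorm_sub a b : enorm (a - b) = enorm (b - a).
Proof. by rewrite -enormN opprB. Qed.

Lemma enormZ k a : enorm (k *: a) = `|k| * enorm a.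
Proof.
by rewrite /enorm dotpZl dotpZr mulrA -expr2 sqrtrM ?sqr_ge0// sqrtr_sqr.
Qed.

Lemma enorm_eq0 a : enorm a = 0 -> a = 0.
Proof.
move=> a0; have := enorm_sqr a; rewrite a0 expr0n /= => /esym/eqP.
rewrite psumr_eq0 => [/allP h|i _]; last by rewrite -expr2 sqr_ge0.
apply/rowP => i; have := h i (mem_index_enum _).
by rewrite -expr2 sqrf_eq0 mxE => /eqP.
Qed.

Lemma cauchy_schwarz a b : `|dotp a b| <= enorm a * enorm b.
Proof.
have [b0|b0] := eqVneq (enorm b) 0.
  by rewrite (enorm_eq0 b0) -(scale0r (0 : 'rV_n)) dotpZr mul0r normr0
     mulr_ge0 ?enorm_ge0.
rewrite -ler_sqr ?nnegrE ?mulr_ge0 ?enorm_ge0// exprMn !enorm_sqr real_normK ?num_real//.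
have := dotp_ge0 (dotp b b *: a - dotp a b *: b).
rewrite !(dotpBl,dotpBr,dotpZl,dotpZr) (dotpC b a).
have bp : 0 < dotp b b by rewrite -enorm_sqr exprn_gt0// lt_def b0 enorm_ge0.
rewrite [X in 0 <= X -> _](_ : _ = dotp b b * (dotp a a * dotp b b - dotp a b ^+ 2)).
  by rewrite pmulr_rge0// subr_ge0.
ring.
Qed.

Lemma dotp_unit_le a b : enorm b = 1 -> `|dotp a b| <= enorm a.
Proof. by move=> b1; rewrite (le_trans (cauchy_schwarz a b))// b1 mulr1. Qed.

Lemma dotp_le a b : dotp a b <= enorm a * enorm b.
Proof. exact: le_trans (ler_norm _) (cauchy_schwarz a b). Qed.

Lemma enormD a b : enorm (a + b) <= enorm a + enorm b.
Proof.
rewrite -ler_sqr ?nnegrE ?addr_ge0 ?enorm_ge0//.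
rewrite sqrrD !enorm_sqr !(dotpDl,dotpDr) (dotpC b a).
have := dotp_le a b; lra.
Qed.

Lemma enormB a b : enorm (a - b) <= enorm a + enorm b.
Proof. by rewrite -(enormN b) enormD. Qed.

Lemma enorm_dist a b c : enorm (a - c) <= enorm (a - b) + enorm (b - c).
Proof. by rewrite (le_trans _ (enormD _ _))// addrA subrK. Qed.

Lemma ler_enorm_sub a b : enorm a - enorm b <= enorm (a - b).
Proof. by rewrite lerBlDr (le_trans _ (enormD _ _))// subrK. Qed.

Lemma gram_ge0 a b : 0 <= enorm a ^+ 2 * enorm b ^+ 2 - dotp a b ^+ 2.
Proof.
rewrite subr_ge0 -exprMn -[dotp _ _ ^+ 2]real_normK ?num_real//.
by rewrite lerXn2r ?nnegrE ?mulr_ge0 ?enorm_ge0// cauchy_schwarz.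
Qed.

Lemma wedge_norm_ge0 a b : 0 <= wedge_norm a b.
Proof. exact: sqrtr_ge0. Qed.

Lemma wedge_norm_sqr a b :
  wedge_norm a b ^+ 2 = enorm a ^+ 2 * enorm b ^+ 2 - dotp a b ^+ 2.
Proof. by rewrite sqr_sqrtr ?gram_ge0. Qed.

Lemma wedge_normZ k l a b :
  wedge_norm (k *: a) (l *: b) = `|k| * `|l| * wedge_norm a b.
Proof.
rewrite /wedge_norm -normrM -(sqrtr_sqr (k * l)) -sqrtrM ?sqr_ge0//.
congr Num.sqrt; rewrite !enormZ dotpZl dotpZr !exprMn !real_normK ?num_real//.
ring.
Qed.

Lemma wedge_normC a b : wedge_norm a b = wedge_norm b a.
Proof. by rewrite /wedge_norm dotpC [X in X - _]mulrC. Qed.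

(** Both sides are twice the area of the triangle, which does not depend on the vertex taken as
    base. *)
Lemma wedge_norm_base x y z : wedge_norm (y - x) (z - x) = wedge_norm (x - y) (z - y).
Proof.
rewrite /wedge_norm; congr Num.sqrt; rewrite !enorm_sqr.
rewrite !(dotpBl,dotpBr) (dotpC y x) (dotpC z x) (dotpC z y); ring.
Qed.

(** With [a], the vectors [b] and [a - b] span parallelograms of equal area; algebraically, the
    difference of the squares is (|a|^2 - <a,b>)^2. *)
Lemma wedge_norm_le a b : wedge_norm a b <= enorm a * enorm (a - b).
Proof.
rewrite -ler_sqr ?nnegrE ?mulr_ge0 ?enorm_ge0 ?wedge_norm_ge0//.
rewrite wedge_norm_sqr exprMn !enorm_sqr.
rewrite !(dotpBl,dotpBr) (dotpC b a).
have := sqr_ge0 (dotp a a - dotp a b); lra.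
Qed.

(* For unit vectors at an angle of at most 90 degrees,
   |a - b|^2 = 2 (1 - <a,b>) <= 2 (1 - <a,b>) (1 + <a,b>). *)
Lemma unit_dist_le_wedge a b : enorm a = 1 -> enorm b = 1 -> 0 <= dotp a b ->
  enorm (a - b) <= 2 * wedge_norm a b.
Proof.
move=> a1 b1 ab.
rewrite -ler_sqr ?nnegrE ?mulr_ge0 ?enorm_ge0 ?wedge_norm_ge0//.
rewrite exprMn wedge_norm_sqr (enorm_sqr (a - b)).
rewrite !(dotpBl,dotpBr) (dotpC b a).
rewrite -!enorm_sqr a1 b1 !expr1n.
have : dotp a b <= 1 by rewrite (le_trans (dotp_le _ _))// a1 b1 mulr1.
nra.
Qed.

Lemma inv_Rpq_ge0 p q x y z : 0 <= inv_Rpq p q x y z.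
Proof. by rewrite divr_ge0// powR_ge0. Qed.

Lemma inv_RpqC23 p q x y z : inv_Rpq p q x y z = inv_Rpq p q x z y.
Proof.
by rewrite /inv_Rpq wedge_normC (enorm_sub y z) -!mulrA [enorm (y - x) * _]mulrC.
Qed.

Lemma inv_RpqC12 p q x y z : inv_Rpq p q x y z = inv_Rpq p q y x z.
Proof.
rewrite /inv_Rpq wedge_norm_base (enorm_sub y z) (enorm_sub z x) (enorm_sub y x).
by congr (_ / _ `^ _); ring.
Qed.

End EuclideanGeometry.

(** * Inequalities for real powers *)

Section Powers.
Set Implicit Arguments.
Unset Strict Implicit.
Context {R : realType}.

Lemma powR_add_le (q x y : R) : 0 <= q -> 0 <= x -> 0 <= y ->
  (x + y) `^ q <= 2 `^ q * (x `^ q + y `^ q).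
Proof.
move=> q0.
wlog xy : x y / x <= y => [hw x0 y0|x0 y0].
  by have [/hw|/ltW/hw h] := leP x y; [exact|rewrite addrC [_ `^ _ + _]addrC; exact: h].
rewrite (@le_trans _ _ ((2 * y) `^ q))//.
  by rewrite ge0_ler_powR// ?nnegrE; lra.
by rewrite powRM// ler_wpM2l ?powR_ge0// lerDr powR_ge0.
Qed.

(* A substitute for Jensen's inequality: integrated against a probability
   measure, with c half the mean of x, it bounds the mean by its q-th moment. *)
Lemma le_add_powR (q c x : R) : 1 <= q -> 0 < c -> 0 <= x ->
  x <= c + c `^ (1 - q) * x `^ q.
Proof.
move=> q1 c0 x0; have [xc|cx] := leP x c.
  by rewrite ler_wpDr// mulr_ge0 ?powR_ge0.
apply: ler_wpDl; first exact: ltW.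
have xp : 0 < x by exact: lt_trans cx.
rewrite [leLHS](_ : x = x `^ (1 - q) * x `^ q); last first.
  by rewrite -powRD ?subrK ?powRr1 ?(gt_eqF xp) ?implybT.
rewrite ler_wpM2r ?powR_ge0// -opprB !powRN.
by rewrite lef_pV2 ?posrE ?powR_gt0// ge0_ler_powR// ?nnegrE ?subr_ge0// ltW.
Qed.

End Powers.

(** * Monotonicity, Tonelli and affine changes of variables *)

Section Integration.
Set Implicit Arguments.
Unset Strict Implicit.
Context {R : realType}.
Notation mu := (@lebesgue_measure R).
Local Open Scope ereal_scope.

(** The integral of a nonnegative function is a supremum over the simple functions below it, and
    this supremum is monotone whether or not the integrands are measurable. It reduces the
    comparisons of integrals below to pointwise inequalities. *)
Lemma le_integral_nomeas d (T : measurableType d) (m : {measure set T -> \bar R})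
    (D : set T) (f g : T -> \bar R) :
  (forall x, D x -> 0 <= f x) -> (forall x, D x -> f x <= g x) ->
  \int[m]_(x in D) f x <= \int[m]_(x in D) g x.
Proof.
move=> f0 fg; have g0 x : D x -> 0 <= g x by move=> Dx; exact: le_trans (f0 _ Dx) (fg _ Dx).
rewrite !ge0_integralE//; apply: le_ereal_sup => _ [h hf <-]; exists h => // x.
apply: (le_trans (hf x)); rewrite !patchE; case: ifPn => // /set_mem; exact: fg.
Qed.

Lemma measurable_integral d (T : measurableType d) (E : set R)
    (f : T * R -> \bar R) : measurable E ->
  measurable_fun setT f -> (forall z, 0 <= f z) ->
  measurable_fun setT (fun x => \int[mu]_(y in E) f (x, y)).
Proof.
move=> mE mf f0.
pose g := f \_ (setT `*` E).
have mg : measurable_fun setT g.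
  by apply/(measurable_restrictT _ _).1; [exact: measurableX|exact: measurable_funTS].
have g0 z : 0 <= g z by rewrite /g patchE; case: ifPn.
apply: eq_measurable_fun (measurable_fun_fubini_tonelli_F (m2 := mu) g mg g0) => x _.
rewrite /fubini_F [RHS]integral_mkcond; apply: eq_integral => y _.
rewrite /g !patchE; congr (if _ then _ else _).
by apply/idP/idP; rewrite !inE /=; [case|split].
Qed.

Lemma tonelli (D E : set R) (f : R * R -> \bar R) : measurable D -> measurable E ->
  measurable_fun setT f -> (forall z, 0 <= f z) ->
  \int[mu]_(x in D) \int[mu]_(y in E) f (x, y) =
  \int[mu]_(y in E) \int[mu]_(x in D) f (x, y).
Proof.
move=> mD mE mf f0.
pose g := f \_ (D `*` E).
have mg : measurable_fun setT g.
  by apply/(measurable_restrictT _ _).1; [exact: measurableX|exact: measurable_funTS].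
have g0 z : 0 <= g z by rewrite /g patchE; case: ifPn.
transitivity (\int[mu]_x \int[mu]_y g (x, y)).
  rewrite integral_mkcond; apply: eq_integral => x _.
  rewrite patchE; case: ifPn => xD.
    rewrite integral_mkcond; apply: eq_integral => y _.
    rewrite /g !patchE; congr (if _ then _ else _).
    by rewrite inE in xD; apply/idP/idP; rewrite !inE /=; [split|case].
  rewrite integral0_eq// => y _; rewrite /g patchE ifN//.
  by apply: contra xD; rewrite !inE => -[].
rewrite (fubini_tonelli (m1 := mu) (m2 := mu) g mg g0).
rewrite [RHS]integral_mkcond; apply: eq_integral => y _.
rewrite patchE; case: ifPn => yE.
  rewrite [RHS]integral_mkcond; apply: eq_integral => x _.
  rewrite /g !patchE; congr (if _ then _ else _).
  by rewrite inE in yE; apply/idP/idP; rewrite !inE /=; [case|split].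
rewrite integral0_eq// => x _; rewrite /g patchE ifN//.
by apply: contra yE; rewrite !inE => -[].
Qed.

Let affine (k b : R) : measurableTypeR R -> measurableTypeR R := fun x : R => (k * x + b)%R.

Lemma measurable_affine (k b : R) : measurable_fun setT (fun x : R => (k * x + b)%R).
Proof. by apply: measurable_funD => //; exact: measurable_funM. Qed.

Let maff (k b : R) : measurable_fun setT (affine k b).
Proof. exact: measurable_affine. Qed.

(** By uniqueness of Lebesgue measure it suffices to test half-open intervals, whose preimages are
    intervals with lengths divided by [|k|]. A negative [k] exchanges the open and the closed end,
    hence the two cases. *)
Lemma pushforward_affine (k b : R) (A : set R) : k != 0%R -> measurable A ->
  `|k|%:E * pushforward mu (affine k b) A = mu A.
Proof.
move=> k0 mA.
have kp : (0 < `|k|)%R by rewrite normr_gt0.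
pose K := NngNum (ltW kp).
apply/esym.
pose nu : {measure set (measurableTypeR R) -> \bar R} :=
  measure_function_pushforward__canonical__measure_function_Measure mu (maff k b).
rewrite -[RHS]/(mscale K nu A).
apply: lebesgue_measure_unique => // _ [[x y]] _ <-.
rewrite -[RHS]/(`|k|%:E * mu (affine k b @^-1` `]x, y])).
have [kpos|kneg] := ltP 0%R k.
  rewrite (_ : _ @^-1` _ = `](x - b) / k, (y - b) / k]%classic)%R; last first.
    apply/seteqP; split => z /=; rewrite !in_itv/= ltr_pdivrMr// ler_pdivlMr// /affine [(z * k)%R]mulrC ltrBlDr lerBrDr//.
  rewrite !lebesgue_measure_itv/= !lte_fin ltr_pM2r ?invr_gt0// ltrD2r.
  case: ifPn => _; last by rewrite mule0.
  rewrite -!EFinB -EFinM; congr EFin; rewrite gtr0_norm//; field; lra.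
have {}kneg : (k < 0)%R by rewrite lt_def eq_sym k0.
rewrite (_ : _ @^-1` _ = `[(y - b) / k, (x - b) / k[%classic)%R; last first.
  apply/seteqP; split => z /=; rewrite !in_itv/= ltr_ndivlMr// ler_ndivrMr// /affine [(z * k)%R]mulrC ltrBlDr lerBrDr andbC//.
rewrite !lebesgue_measure_itv/= !lte_fin ltr_nM2r ?invr_lt0// ltrD2r.
case: ifPn => _; last by rewrite mule0.
rewrite -!EFinB -EFinM; congr EFin; rewrite ltr0_norm//; field; lra.
Qed.

Lemma integral_affine (k b : R) (D : set R) (f : R -> \bar R) : k != 0%R ->
  measurable D -> measurable_fun setT f -> (forall x, 0 <= f x) ->
  \int[mu]_(x in D) f x =
  `|k|%:E * \int[mu]_(x in (fun x => k * x + b)%R @^-1` D) f (k * x + b)%R.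
Proof.
move=> k0 mD mf f0.
have kp : (0 < `|k|)%R by rewrite normr_gt0.
pose K := NngNum (ltW kp).
pose nu : {measure set (measurableTypeR R) -> \bar R} :=
  measure_function_pushforward__canonical__measure_function_Measure mu (maff k b).
transitivity (K%:num%:E * \int[nu]_(x in D) f x).
  rewrite -(@ge0_integral_mscale _ (measurableTypeR R) R nu D mD K f)//; last exact: measurable_funTS.
  by apply: eq_measure_integral => A mA _; apply/esym; exact: pushforward_affine.
congr (_ * _); rewrite /nu.
rewrite -[RHS](@ge0_integral_pushforward _ _ _ _ R _ (maff k b) mu D f)//.
exact: measurable_funTS.
Qed.

End Integration.

(** * Intervals, periodic functions and power functions on the line *)

Section IntegrationOnTheLine.
Set Implicit Arguments.
Unset Strict Implicit.
Context {R : realType}.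
Notation mu := (@lebesgue_measure R).
Local Open Scope ereal_scope.
Implicit Types (f : R -> \bar R) (a b c k r : R).

Lemma integral_dilate k a b f : (0 < k)%R -> measurable_fun setT f -> (forall x, 0 <= f x) ->
  \int[mu]_(x in `]a, b[) f (k * x)%R = k^-1%:E * \int[mu]_(x in `](k * a)%R, (k * b)%R[) f x.
Proof.
move=> k0 mf f0.
rewrite (@integral_affine _ k 0%R `]k * a, k * b[%classic%R f) ?gt_eqF//.
rewrite gtr0_norm// muleA -EFinM mulVf ?gt_eqF// mul1e.
rewrite (_ : _ @^-1` _ = `]a, b[%classic).
  by apply: eq_integral => x _; rewrite addr0.
by apply/seteqP; split => x /=; rewrite !in_itv/= addr0 !ltr_pM2l.
Qed.

Lemma integral_translate c a b f : measurable_fun setT f -> (forall x, 0 <= f x) ->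
  \int[mu]_(x in `]a, b[) f (c + x)%R = \int[mu]_(x in `](c + a)%R, (c + b)%R[) f x.
Proof.
move=> mf f0.
rewrite (@integral_affine _ 1%R c `]c + a, c + b[%classic%R f) ?oner_eq0//.
rewrite normr1 mul1e (_ : _ @^-1` _ = `]a, b[%classic).
  by apply: eq_integral => x _; rewrite mul1r addrC.
by apply/seteqP; split => x /=; rewrite !in_itv/= mul1r (addrC x) !ltrD2l.
Qed.

Lemma integral_reflect c a b f : measurable_fun setT f -> (forall x, 0 <= f x) ->
  \int[mu]_(x in `]a, b[) f (c - x)%R = \int[mu]_(x in `](c - b)%R, (c - a)%R[) f x.
Proof.
move=> mf f0.
rewrite (@integral_affine _ (-1)%R c `]c - b, c - a[%classic%R f) ?oppr_eq0 ?oner_eq0//.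
rewrite normrN1 mul1e (_ : _ @^-1` _ = `]a, b[%classic).
  by apply: eq_integral => x _; rewrite mulN1r addrC.
by apply/seteqP; split => x /=; rewrite !in_itv/= mulN1r (addrC _ c) ltrD2l ltrN2 ltrD2l ltrN2 andbC.
Qed.

Lemma integral_itv_open a b f (b0 b1 : bool) : measurable_fun setT f ->
  \int[mu]_(z in [set` Interval (BSide b0 a) (BSide b1 b)]) f z = \int[mu]_(z in `]a, b[) f z.
Proof. by move=> mf; apply: integral_itv_bndoo; exact: measurable_funTS. Qed.

Lemma integral_itv_split b a c f : (a <= b)%R -> (b <= c)%R -> measurable_fun setT f ->
  (forall x, 0 <= f x) ->
  \int[mu]_(x in `]a, c[) f x = \int[mu]_(x in `]a, b[) f x + \int[mu]_(x in `]b, c[) f x.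
Proof.
move=> ab bc mf f0.
rewrite -(@integral_itv_open a c f true true)// -(@integral_itv_open a b f true true)//.
rewrite -(@integral_itv_open b c f true true)//.
rewrite (@itv_bndbnd_setU _ _ (BLeft a) (BLeft b) (BLeft c))//.
rewrite ge0_integral_setU//; first exact: measurable_funTS.
rewrite disj_set2E; apply/eqP/seteqP; split => x //= []; rewrite !in_itv/=; lra.
Qed.

Lemma integral_sub_itv a b c d f : (c <= a)%R -> (b <= d)%R -> measurable_fun setT f ->
  (forall x, 0 <= f x) ->
  \int[mu]_(x in `]a, b[) f x <= \int[mu]_(x in `]c, d[) f x.
Proof.
move=> ca bd mf f0; apply: ge0_subset_integral => //; first exact: measurable_funTS.
by move=> x /=; rewrite !in_itv/=; lra.
Qed.

Lemma periodic_int (T : Type) (f : R -> T) : (forall x, f (x + 1)%R = f x) ->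
  forall (x : R) (z : int), f (x + z%:~R)%R = f x.
Proof.
move=> fp.
have fn x (n : nat) : f (x + n%:R)%R = f x.
  by elim: n => [|n IH]; rewrite ?addr0// -natr1 addrA fp.
move=> x [n|n]; first exact: fn.
by rewrite NegzE -[in RHS](@subrK _ n.+1%:R%R x) fn mulrNz.
Qed.

(** With [a'] the representative of [a] in [0, 1], the period that starts at [a'] is cut at 1 and
    the overhang is translated back to [0, a']. *)
Lemma integral_period a f : (forall x, f (x + 1)%R = f x) -> measurable_fun setT f ->
  (forall x, 0 <= f x) ->
  \int[mu]_(x in `]a, (a + 1)%R[) f x = \int[mu]_(x in `]0%R, 1%R[) f x.
Proof.
move=> fp mf f0.
pose k := Num.floor a; pose a' := (a - k%:~R)%R.
have a0 : (0 <= a')%R by rewrite subr_ge0 floor_le.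
have a1 : (a' <= 1)%R by rewrite lerBlDl ltW// -intrD1 floorD1_gt.
transitivity (\int[mu]_(x in `]a', (a' + 1)%R[) f x).
  rewrite (_ : a = k%:~R + a')%R; last by rewrite /a' addrC subrK.
  rewrite -addrA -integral_translate//; apply: eq_integral => x _.
  by rewrite addrC periodic_int.
rewrite (@integral_itv_split 1%R)//; last by rewrite lerDr.
rewrite (@integral_itv_split a' 0%R 1%R)// addrC; congr (_ + _).
transitivity (\int[mu]_(x in `](1 + 0)%R, (1 + a')%R[) f x); first by rewrite addr0 addrC.
by rewrite -integral_translate//; apply: eq_integral => x _; rewrite addrC fp.
Qed.

Lemma integral_period_add a r f : (0 <= r <= 1)%R -> (forall x, f (x + 1)%R = f x) ->
  measurable_fun setT f -> (forall x, 0 <= f x) ->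
  \int[mu]_(x in `]0%R, r[) f (a + x)%R <= \int[mu]_(x in `]0%R, 1%R[) f x.
Proof.
move=> /andP[r0 r1] fp mf f0; rewrite integral_translate// addr0 -(integral_period a)//.
by apply: integral_sub_itv; rewrite ?lexx// lerD2l.
Qed.

Lemma integral_period_sub a r f : (0 <= r <= 1)%R -> (forall x, f (x + 1)%R = f x) ->
  measurable_fun setT f -> (forall x, 0 <= f x) ->
  \int[mu]_(x in `]0%R, r[) f (a - x)%R <= \int[mu]_(x in `]0%R, 1%R[) f x.
Proof.
move=> /andP[r0 r1] fp mf f0; rewrite integral_reflect// subr0 -(integral_period (a - 1))// subrK.
by apply: integral_sub_itv; rewrite ?lexx// lerD2l lerN2.
Qed.

Lemma integral_period_translate a f : (forall x, f (x + 1)%R = f x) ->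
  measurable_fun setT f -> (forall x, 0 <= f x) ->
  \int[mu]_(x in `]0%R, 1%R[) f (x + a)%R = \int[mu]_(x in `]0%R, 1%R[) f x.
Proof.
move=> fp mf f0; under eq_integral do rewrite addrC.
by rewrite integral_translate// addr0 integral_period.
Qed.

Lemma integral_fold a f : measurable_fun setT f -> (forall x, 0 <= f x) ->
  \int[mu]_(x in `](a - 2^-1)%R, (a + 2^-1)%R[) f x =
  \int[mu]_(v in `]0%R, 2^-1%R[) (f (a + v)%R + f (a - v)%R).
Proof.
move=> mf f0.
have mD : measurable_fun setT (fun v : R => f (a + v)%R).
  apply: measurableT_comp => //; exact: measurable_funD.
have mB : measurable_fun setT (fun v : R => f (a - v)%R).
  apply: measurableT_comp => //; exact: measurable_funB.
rewrite ge0_integralD//; [|exact: measurable_funTS|exact: measurable_funTS].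
rewrite integral_translate// integral_reflect// addr0 subr0 [RHS]addrC.
by apply: integral_itv_split => //; lra.
Qed.

Lemma integral_period_fold a f : (forall x, f (x + 1)%R = f x) ->
  measurable_fun setT f -> (forall x, 0 <= f x) ->
  \int[mu]_(x in `]0%R, 1%R[) f x =
  \int[mu]_(v in `]0%R, 2^-1%R[) (f (a + v)%R + f (a - v)%R).
Proof.
move=> fp mf f0; rewrite -integral_fold// -(integral_period (a - 2^-1))//.
by rewrite (_ : (a - 2^-1 + 1 = a + 2^-1)%R)//; lra.
Qed.

Lemma integral_is_derive (f F : R -> R) a b : (a < b)%R ->
  (forall x, x \in `[a, b] -> {for x, continuous f}) ->
  (forall x, x \in `[a, b] -> is_derive x 1%R F (f x)) ->
  \int[mu]_(x in `]a, b[) (f x)%:E = (F b - F a)%:E.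
Proof.
move=> ab cf dF.
have cF x : x \in `[a, b] -> {for x, continuous F}.
  by move=> /dF [dFx _]; apply: differentiable_continuous; apply/derivable1_diffP.
have inI x : x \in `]a, b[ -> x \in `[a, b] by exact: subset_itv_oo_cc.
have aI : a \in `[a, b] by rewrite in_itv/= lexx ltW.
have bI : b \in `[a, b] by rewrite in_itv/= lexx ltW.
have wf : {within `[a, b], continuous f}.
  by apply: continuous_in_subspaceT => x /set_mem; exact: cf.
rewrite EFinB -(continuous_FTC2 (f := f) ab)//.
- rewrite (@integral_itv_bndoo _ a b (EFin \o f) true false)//.
  apply/measurable_EFinP; apply: measurable_funS (subspace_continuous_measurable_fun _ wf) => //.
- split.
  + by move=> x /inI/dF[].
  + by apply: cvg_at_right_filter; exact: cF.
  + by apply: cvg_at_left_filter; exact: cF.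
- by move=> x /inI/dF dFx; rewrite derive1E derive_val.
Qed.

Lemma integral_powR k a b : k != (-1)%R -> (0 < a)%R -> (a < b)%R ->
  \int[mu]_(x in `]a, b[) (x `^ k)%:E = ((b `^ (k + 1) - a `^ (k + 1)) / (k + 1))%:E.
Proof.
move=> k1 a0 ab.
have kn0 : (k + 1 != 0)%R by rewrite addr_eq0.
have pos x : x \in `[a, b] -> (0 < x)%R by rewrite in_itv/= => /andP[ax _]; exact: lt_le_trans ax.
rewrite mulrBl; apply: (@integral_is_derive _ (fun x => x `^ (k + 1) / (k + 1))%R) => // x /pos x0.
  apply: differentiable_continuous; apply/derivable1_diffP.
  by apply: derivable_powR; rewrite in_itv/= x0.
have := is_derive1_powR (k + 1) x0.
rewrite addrK => h; under eq_fun do rewrite mulrC.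
have := is_deriveZ (k + 1)^-1%R h.
by rewrite /GRing.scale/= mulrA mulVf// mul1r.
Qed.

(** Monotone convergence along the intervals from b / (n + 2) to b; with n + 2 the left end lies
    strictly between 0 and b for every n. This handles powers that are singular at 0, where the
    fundamental theorem cannot be applied up to the endpoint. *)
Lemma integral_itv0_le b (C : \bar R) f : (0 < b)%R -> measurable_fun setT f ->
  (forall x, 0 <= f x) ->
  (forall a, (0 < a)%R -> (a < b)%R -> \int[mu]_(x in `]a, b[) f x <= C) ->
  \int[mu]_(x in `]0%R, b[) f x <= C.
Proof.
move=> b0 mf f0 fC.
pose F (n : nat) : set R := `](b / n.+2%:R)%R, b[%classic.
have -> : `]0%R, b[%classic = \bigcup_n F n.
  apply/seteqP; split => x /=.
    rewrite in_itv/= => /andP[x0 xb]; exists (Num.bound (b / x)) => //.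
    rewrite /F/= in_itv/= xb andbT ltr_pdivrMr// mulrC -ltr_pdivrMr//.
    by rewrite (lt_trans (archi_boundP _))// ?ltr_nat// divr_ge0// ltW.
  by move=> [n _]; rewrite /F/= !in_itv/= => /andP[bx ->]; rewrite andbT (lt_trans _ bx)// divr_gt0.
have ndF : nondecreasing_seq F.
  move=> n m nm; apply/subsetPset => x /=; rewrite /F/= !in_itv/= => /andP[bx ->].
  by rewrite andbT (le_lt_trans _ bx)// ler_pM2l// lef_pV2 ?posrE// ler_nat !ltnS.
have mF n : measurable (F n) by exact: measurable_itv.
have cv := @ge0_nondecreasing_set_cvg_integral _ (measurableTypeR R) R F f mu ndF mF
  (fun=> measurable_funTS mf) (fun _ x _ => f0 x).
rewrite -(cvg_lim _ cv)//; apply: lime_le; first exact: cvgP cv.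
near=> n; apply: fC; first by rewrite divr_gt0.
by rewrite ltr_pdivrMr// ltr_pMr// ltr1n.
Unshelve. all: by end_near. Qed.

Lemma integral_powR_le0 k b : (-1 < k)%R -> (0 < b)%R ->
  \int[mu]_(x in `]0%R, b[) (x `^ k)%:E <= (b `^ (k + 1) / (k + 1))%:E.
Proof.
move=> k1 b0; have kn0 : (0 < k + 1)%R by lra.
apply: integral_itv0_le => //.
- by apply/measurable_EFinP; exact: measurable_powR.
- by move=> x; rewrite lee_fin powR_ge0.
- move=> a a0 ab; rewrite integral_powR ?gt_eqF//.
  by rewrite lee_fin ler_pM2r ?invr_gt0// gerBl powR_ge0.
Qed.

Lemma integral_powR_leS k a b : (k < -1)%R -> (0 < a)%R ->
  \int[mu]_(x in `]a, b[) (x `^ k)%:E <= (a `^ (k + 1) / - (k + 1))%:E.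
Proof.
move=> k1 a0; have kn0 : (0 < - (k + 1))%R by lra.
have [ab|ba] := ltP a b; last first.
  rewrite set_itv_ge ?integral_set0 ?bnd_simp -?leNgt//.
  by rewrite lee_fin divr_ge0 ?powR_ge0// ltW.
rewrite integral_powR ?lt_eqF// lee_fin -[leLHS]mulrNN -invrN opprB.
by rewrite ler_pM2r ?invr_gt0// gerBl powR_ge0.
Qed.

End IntegrationOnTheLine.

(** * Telescoping along geometric sequences, averaged over the ratio *)

Section DyadicChain.
Set Implicit Arguments.
Unset Strict Implicit.
Context {R : realType}.
Notation mu := (@lebesgue_measure R).

(* [c > 1] provides the weights that turn the q-th power of a sum into a sum of
   q-th powers. *)
Lemma telescope_le (q c : R) (E : R -> R) (g : R -> R -> R) (d t v : R) :
  1 < q -> 1 < c -> 0 < t < 1 -> 0 < v < d ->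
  (forall x, 0 <= E x) -> (forall x y, 0 <= g x y) ->
  (forall x, 0 < x < d -> E x <= g x (t * x) `^ q^-1 + E (t * x)) ->
  (forall e, 0 < e -> exists2 eta, 0 < eta & forall x, 0 < x < eta -> E x <= e) ->
  ((E v `^ q)%:E <= (((1 - c `^ - q^-1) `^ - q)%:E *
     \sum_(0 <= j <oo) (c ^+ j * g (t ^+ j * v) (t * (t ^+ j * v)))%:E))%E.
Proof.
move=> q1 c1 /andP[t0 t1] /andP[v0 vd] E0 g0 Eg Ecvg.
have q0 : 0 < q by lra.
pose m := c `^ - q^-1.
have m0 : 0 < m by rewrite powR_gt0//; lra.
have m1 : m < 1.
  rewrite /m powRN invf_lt1 ?powR_gt0//; last by lra.
  rewrite [ltLHS](_ : 1 = 1 `^ q^-1); last by rewrite powR1.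
  apply: gt0_ltr_powR; rewrite ?nnegrE ?invr_gt0//; lra.
pose x j := t ^+ j * v.
have x0 j : 0 < x j by rewrite mulr_gt0 ?exprn_gt0.
have xS j : x j.+1 = t * x j by rewrite /x exprS mulrA.
have xd j : 0 < x j < d.
  rewrite x0 (le_lt_trans _ vd)// /x ler_piMl ?exprn_ile1 ?ltW//.
set S := (\sum_(0 <= j <oo) _)%E.
have tj0 j : (0 <= (c ^+ j * g (x j) (t * x j))%:E)%E.
  by rewrite lee_fin mulr_ge0// exprn_ge0//; lra.
have S0 : (0 <= S)%E by apply: nneseries_ge0 => j _ _; exact: tj0.
have C0 : 0 < (1 - m) `^ (- q) by rewrite powR_gt0// subr_gt0.
have [Sfin|Soo] := boolP (S \is a fin_num); last first.
  move: S0 Soo; case: S => [s| |] //= _ _.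
  by rewrite gt0_muley ?leey// lte_fin.
have Ss : S = (fine S)%:E by rewrite fineK.
pose s := fine S; rewrite Ss -/s.
have s0 : 0 <= s by exact: fine_ge0.
(* The sum [s] of the series dominates each of its terms, so the j-th increment is at most s^(1/q)
   m^j. Summing the geometric series in [m] then takes the place of Hölder's inequality. *)
have gj j : g (x j) (t * x j) `^ q^-1 <= s `^ q^-1 * m ^+ j.
  have : (c ^+ j * g (x j) (t * x j) <= s).
    rewrite -lee_fin -Ss; apply: (le_trans _ (nneseries_lim_ge j.+1 _)) => [|? _ _]; last exact: tj0.
    by rewrite big_nat_recr//= leeDr// sume_ge0// => i _; exact: tj0.
  rewrite mulrC -ler_pdivlMr ?exprn_gt0//; last by lra.
  move=> h; rewrite (le_trans (ge0_ler_powR _ _ _ h))// ?nnegrE ?invr_ge0 ?divr_ge0 ?exprn_ge0//; try lra.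
  rewrite powRM ?invr_ge0 ?exprn_ge0//; last by lra.
  rewrite ler_wpM2l ?powR_ge0//.
  rewrite -powR_invn; last by lra.
  rewrite -powRrM /m -powR_mulrn ?powR_ge0// -powRrM.
  by rewrite (_ : - j%:R * q^-1 = - q^-1 * j%:R)//; ring.
have chain N : E v <= s `^ q^-1 * (\sum_(0 <= j < N) m ^+ j) + E (x N).
  elim: N => [|N IH].
    by rewrite big_geq// mulr0 add0r /x expr0 mul1r.
  rewrite big_nat_recr//= (le_trans IH)// mulrDr -addrA lerD2l.
  by rewrite xS (le_trans (Eg _ (xd N)))// lerD2r.
have geo N : \sum_(0 <= j < N) m ^+ j <= (1 - m)^-1.
  rewrite big_mkord -[leRHS]mul1r ler_pdivlMr ?subr_gt0// mulrC -opprB mulNr -subrX1 opprB.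
  by rewrite gerBl exprn_ge0// ltW.
have Ev : E v <= s `^ q^-1 * (1 - m)^-1.
  apply/ler_addgt0Pr => e e0; have [eta eta0 Eeta] := Ecvg _ e0.
  have [N Neta] : exists N, x N < eta.
    have : (fun N => t ^+ N) @ \oo --> 0 by apply: cvg_expr; rewrite ger0_norm// ltW.
    move=> /cvgrPdist_lt /(_ (eta / v) (divr_gt0 eta0 v0)) [N _ /(_ N (leqnn _))].
    rewrite sub0r normrN ger0_norm ?exprn_ge0 ?ltW// ltr_pdivlMr// => h; by exists N.
  rewrite (le_trans (chain N))// lerD//; last by apply: Eeta; rewrite x0.
  by rewrite ler_wpM2l ?powR_ge0.
rewrite -EFinM lee_fin.
rewrite (le_trans (ge0_ler_powR _ _ _ Ev))// ?nnegrE ?mulr_ge0 ?powR_ge0 ?invr_ge0 ?subr_ge0 ?(ltW q0) ?(ltW m1)//.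
have m1' : 0 <= 1 - m by rewrite subr_ge0 ltW.
rewrite powRM ?powR_ge0 ?invr_ge0// -powRrM mulVf ?gt_eqF// powRr1//.
by rewrite -(powR_inv1 m1') -powRrM mulN1r mulrC.
Qed.

(** For fixed x > 0 the substitution y = t x has Jacobian x and maps the ratios between 1/4 and 1/2
    into the interval from 0 to d. The absolute value keeps the integrand nonnegative on the whole
    plane, as [tonelli] asks. *)
Lemma diagonal_integral_le (d : R) (G : R * R -> R) : 0 < d ->
  measurable_fun setT G -> (forall z, 0 <= G z) ->
  (\int[mu]_(t in `]4^-1%R, 2^-1%R[) \int[mu]_(x in `]0%R, d[) (`|x| * G (x, t * x))%:E <=
   \int[mu]_(x in `]0%R, d[) \int[mu]_(y in `]0%R, d[) (G (x, y))%:E)%E.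
Proof.
move=> d0 mG G0.
have mI : measurable (`]4^-1, 2^-1[%classic : set R) by exact: measurable_itv.
have mJ : measurable (`]0, d[%classic : set R) by exact: measurable_itv.
pose F (z : R * R) := (`|z.2| * G (z.2, z.1 * z.2))%:E.
have F0 z : (0 <= F z)%E by rewrite lee_fin mulr_ge0.
have mF : measurable_fun setT F.
  apply/measurable_EFinP; apply: measurable_funM; first exact: measurableT_comp.
  apply: measurableT_comp => //; apply: measurable_fun_pair => //.
  exact: measurable_funM.
have T := tonelli mI mJ mF F0; rewrite /F/= in T; rewrite {}T.
apply: le_integral_nomeas => x /=.
  by move=> _; apply: integral_ge0 => t _; exact: (F0 (t, x)).
rewrite in_itv/= => /andP[x0 xd].
have mGx : measurable_fun setT (fun y : R => (G (x, y))%:E).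
  by apply/measurable_EFinP; exact: (measurableT_comp mG (measurable_pair1 x)).
have Gx0 y : (0 <= (G (x, y))%:E)%E by rewrite lee_fin.
have mh : measurable_fun setT (fun t : R => (G (x, x * t))%:E).
  by apply: (measurableT_comp mGx); exact: measurable_funM.
have -> : (\int[mu]_(t in `]4^-1%R, 2^-1%R[) (`|x| * G (x, t * x))%:E =
    x%:E * \int[mu]_(t in `]4^-1%R, 2^-1%R[) (G (x, x * t))%:E)%E.
  rewrite -(ge0_integralZl_EFin mu mI (fun t _ => Gx0 (x * t)) (measurable_funTS mh) (ltW x0)).
  by apply: eq_integral => t _; rewrite gtr0_norm// (mulrC t) EFinM.
rewrite (integral_dilate _ _ x0 mGx Gx0) muleA -EFinM divff ?gt_eqF// mul1e.
by apply: integral_sub_itv => //; lra.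
Qed.

(* Averaging the telescoping over the ratio [t] turns the sum over the points
   (t^j v, t^(j+1) v) into an integral over pairs (x, y). *)
Lemma chain_integral_le (q a : R) : 1 < q -> 1 < a -> exists2 C : R, 0 < C &
  forall (d : R) (E : R -> R) (G : R * R -> R), 0 < d ->
  measurable_fun setT E -> measurable_fun setT G ->
  (forall x, 0 <= E x) -> (forall z, 0 <= G z) ->
  (forall x y, 0 < x < d -> x / 4 < y < x / 2 ->
     E x <= (x `^ (a + 1) * G (x, y)) `^ q^-1 + E y) ->
  (forall e, 0 < e -> exists2 eta, 0 < eta & forall x, 0 < x < eta -> E x <= e) ->
  (\int[mu]_(v in `]0%R, d[) (E v `^ q / v `^ a)%:E <=
   C%:E * \int[mu]_(x in `]0%R, d[) \int[mu]_(y in `]0%R, d[) (G (x, y))%:E)%E.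
Proof.
move=> q1 a1.
pose b := a - 1; have b0 : 0 < b by rewrite subr_gt0.
(* The j-th term carries the weight c^j, and the dilation by t^j gains (t^b)^j <= 2^(-bj). Taking c
   = 2^(b/2) spends half of this gain, which leaves both c > 1 and c 2^(-b) = k < 1. *)
pose c := 2 `^ (b / 2); pose k := 2 `^ (- (b / 2)).
have k0 : 0 < k by exact: powR_gt0.
have c1 : 1 < c.
  rewrite [ltLHS](_ : 1 = 1 `^ (b / 2)); last by rewrite powR1.
  by apply: gt0_ltr_powR; rewrite ?nnegrE ?divr_gt0// ltr1n.
have k1 : k < 1 by rewrite /k powRN invf_lt1// (lt_trans _ c1).
pose C1 := (1 - c `^ - q^-1) `^ - q.
have C10 : 0 <= C1 by exact: powR_ge0.
(* The factor 4 undoes the length 1/4 of the interval of ratios; the summand 1 makes the constant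
   positive. *)
exists (4 * (C1 * (1 - k)^-1) + 1).
  by rewrite ltr_wpDl// !mulr_ge0// invr_ge0 subr_ge0 ltW.
move=> d E G d0 mE mG E0 G0 EG Ecvg.
set I0 := (\int[mu]_(x in _) _)%E.
set W := (\int[mu]_(x in _) _)%E.
have W0 : (0 <= W)%E.
  by rewrite /W; apply: integral_ge0 => x _; apply: integral_ge0 => y _; rewrite lee_fin.
have I00 : (0 <= I0)%E.
  by rewrite /I0; apply: integral_ge0 => ? _; rewrite lee_fin divr_ge0 ?powR_ge0.
(* With x = t^j v, the quotient x^(a+1) / v^a equals (t^j)^a x. The factor x is the Jacobian that
   [diagonal_integral_le] consumes, and the dilation from v to x lowers the exponent of t^j from a
   to b = a - 1. *)
pose T (j : nat) (z : R * R) : R :=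
  c ^+ j * (z.1 ^+ j) `^ a * (`|z.1 ^+ j * z.2| * G (z.1 ^+ j * z.2, z.1 * (z.1 ^+ j * z.2))).
have T0 j z : 0 <= T j z.
  by rewrite /T !mulr_ge0 ?exprn_ge0 ?powR_ge0//; lra.
have mT j : measurable_fun setT (fun z => (T j z)%:E).
  have mt : measurable_fun setT (fun z : R * R => z.1 ^+ j).
    exact: (measurable_funX _ measurable_fst).
  have mtv : measurable_fun setT (fun z : R * R => z.1 ^+ j * z.2).
    by apply: measurable_funM => //; exact: measurable_snd.
  apply/measurable_EFinP; apply: measurable_funM.
    by apply: measurable_funM => //; exact: (measurableT_comp (measurable_powR a) mt).
  apply: measurable_funM; first exact: measurableT_comp.
  apply: measurableT_comp => //; apply: measurable_fun_pair => //.
  by apply: measurable_funM => //; exact: measurable_fst.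
have pointwise t v : 4^-1 < t < 2^-1 -> 0 < v < d ->
    ((E v `^ q / v `^ a)%:E <= C1%:E * \sum_(0 <= j <oo) (T j (t, v))%:E)%E.
  move=> /andP[t0 t1] /andP[v0 vd].
  have tp : 0 < t by lra.
  have := @telescope_le q c E (fun x y => `|x| `^ (a + 1) * G (x, y)) d t v.
  move=> /(_ q1 c1); rewrite v0 vd tp => h.
  rewrite mulrC EFinM.
  apply: (@le_trans _ _ ((v `^ a)^-1%:E * (C1%:E * \sum_(0 <= j <oo)
      (c ^+ j * (`|t ^+ j * v| `^ (a + 1) * G (t ^+ j * v, t * (t ^+ j * v))))%:E))%E).
    rewrite lee_pmul2l// ?lte_fin ?invr_gt0 ?powR_gt0//; apply: h => //.
    - by rewrite /=; lra.
    - by move=> x y; rewrite mulr_ge0 ?powR_ge0.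
    - move=> x /andP[x0 xd]; rewrite gtr0_norm//; apply: EG; first by rewrite x0.
      by apply/andP; split; nra.
  rewrite muleCA lee_pmul// ?lee_fin//.
    rewrite mule_ge0 ?lee_fin ?invr_ge0 ?powR_ge0//.
    by apply: nneseries_ge0 => j _ _; rewrite lee_fin !mulr_ge0 ?powR_ge0 ?exprn_ge0//; lra.
  rewrite -nneseriesZl; last first.
    by move=> j _; rewrite lee_fin !mulr_ge0 ?powR_ge0 ?exprn_ge0//; lra.
  rewrite le_eqVlt; apply/orP; left; apply/eqP; apply: eq_eseriesr => j _.
  rewrite -EFinM /T/=; congr EFin.
  have tj : 0 < t ^+ j by rewrite exprn_gt0.
  have -> : `|t ^+ j * v| = t ^+ j * v by rewrite gtr0_norm// mulr_gt0.
  have -> : (t ^+ j * v) `^ (a + 1) = t ^+ j * v * ((t ^+ j) `^ a * v `^ a).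
    rewrite -powRM ?ltW// -[X in _ = _ * _ `^ X](addrK 1 a) mulr_powRB1//; last by lra.
    by rewrite mulr_ge0 ?ltW.
  by field; rewrite gt_eqF ?powR_gt0.
have termle j : (\int[mu]_(t in `]4^-1%R, 2^-1%R[) \int[mu]_(v in `]0%R, d[) (T j (t, v))%:E
     <= (k ^+ j)%:E * W)%E.
  apply: (@le_trans _ _ (\int[mu]_(t in `]4^-1%R, 2^-1%R[)
     ((k ^+ j)%:E * \int[mu]_(x in `]0%R, d[) (`|x| * G (x, t * x))%:E))%E).
    apply: le_integral_nomeas => [t _|t /=].
      by apply: integral_ge0 => v _; rewrite lee_fin.
    rewrite in_itv/= => /andP[t0 t1].
    have tj : 0 < t ^+ j by rewrite exprn_gt0//; lra.
    have mh : measurable_fun setT (fun x : R => (`|x| * G (x, t * x))%:E).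
      apply/measurable_EFinP; apply: measurable_funM => //; apply: measurableT_comp => //.
      by apply: measurable_fun_pair => //; exact: measurable_funM.
    have h0 x : (0 <= (`|x| * G (x, t * x))%:E)%E by rewrite lee_fin mulr_ge0.
    rewrite /T/=; under eq_integral do rewrite EFinM.
    rewrite ge0_integralZl_EFin//; last 2 first.
    - apply: measurable_funTS; apply: (measurableT_comp mh); exact: measurable_funM.
    - by rewrite mulr_ge0 ?exprn_ge0 ?powR_ge0//; lra.
    rewrite (@integral_dilate _ (t ^+ j) _ _ (fun x => (`|x| * G (x, t * x))%:E))//.
    rewrite muleA -EFinM lee_pmul//.
    - by rewrite lee_fin !mulr_ge0 ?invr_ge0 ?exprn_ge0 ?powR_ge0//; lra.
    - exact: integral_ge0.
    - rewrite lee_fin -mulrA -powR_inv1 ?(ltW tj)// -powRD; last by rewrite (gt_eqF tj) implybT.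
      have -> : (t ^+ j) `^ (a + -1) = (t `^ b) ^+ j.
        by rewrite -!powR_mulrn ?powR_ge0 -?powRrM 1?mulrC//; lra.
      rewrite -exprMn.
      have ck : 0 <= c * t `^ b <= k.
        rewrite mulr_ge0 ?powR_ge0//=.
        rewrite (_ : k = c * 2^-1 `^ b); last first.
          rewrite -powR_inv1// -powRrM /c -powRD; last by rewrite pnatr_eq0 implybT.
          by congr (_ `^ _); lra.
        rewrite ler_wpM2l ?powR_ge0// ge0_ler_powR ?nnegrE//; lra.
      by move/andP: ck => [? ?]; rewrite lerXn2r ?nnegrE// (ltW k0).
    - apply: integral_sub_itv => //; first by rewrite mulr0.
      by rewrite ger_pMl// exprn_ile1//; lra.
  rewrite ge0_integralZl_EFin//; last 3 first.
  - by move=> t _; apply: integral_ge0 => x _; rewrite lee_fin mulr_ge0.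
  - apply: measurable_funTS.
    apply: (@measurable_integral R _ R `]0, d[%classic
      (fun z => (`|z.2| * G (z.2, z.1 * z.2))%:E)) => //.
      apply/measurable_EFinP; apply: measurable_funM; first exact: measurableT_comp.
      apply: measurableT_comp => //; apply: measurable_fun_pair => //.
      exact: measurable_funM.
    by move=> z; rewrite lee_fin mulr_ge0.
  - by rewrite exprn_ge0// ltW.
  rewrite lee_pmul ?lee_fin ?exprn_ge0 ?(ltW k0)//; last exact: diagonal_integral_le.
  by apply: integral_ge0 => t _; apply: integral_ge0 => x _; rewrite lee_fin mulr_ge0.
have termsum : (\sum_(0 <= j <oo) (k ^+ j)%:E * W <= (1 - k)^-1%:E * W)%E.
  apply: lime_le.
    by apply: is_cvg_nneseries => j _ _; rewrite mule_ge0// lee_fin exprn_ge0// ltW.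
  apply: nearW => N; rewrite -ge0_sume_distrl; last first.
    by move=> j _; rewrite lee_fin exprn_ge0// ltW.
  rewrite lee_wpmul2r// sumEFin lee_fin big_mkord.
  rewrite -[leRHS]mul1r ler_pdivlMr ?subr_gt0// mulrC -opprB mulNr -subrX1 opprB.
  by rewrite gerBl exprn_ge0// ltW.
have mTv t j : measurable_fun setT (fun v : R => (T j (t, v))%:E).
  exact: (measurableT_comp (mT j) (measurable_pair1 t)).
have mTi j : measurable_fun setT (fun t : R => \int[mu]_(v in `]0%R, d[) (T j (t, v))%:E)%E.
  apply: (@measurable_integral R _ R `]0, d[%classic (fun z => (T j z)%:E)) => //.
  by move=> z; rewrite lee_fin.
have tavg : ((4^-1)%:E * I0 <= C1%:E * ((1 - k)^-1%:E * W))%E.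
  rewrite (_ : (4^-1)%:E * I0 = \int[mu]_(t in `]4^-1%R, 2^-1%R[) cst I0 t)%E; last first.
    rewrite integral_cst//= lebesgue_measure_itv/= lte_fin ifT; last by lra.
    by rewrite muleC -EFinB; congr (_ * _%:E)%E; lra.
  apply: (@le_trans _ _ (\int[mu]_(t in `]4^-1%R, 2^-1%R[)
     (C1%:E * \sum_(0 <= j <oo) \int[mu]_(v in `]0%R, d[) (T j (t, v))%:E))%E).
    apply: le_integral_nomeas => [t _|t /=]; first exact: I00.
    rewrite in_itv/= => tI.
    rewrite -integral_nneseries//; last 2 first.
    - by move=> j; apply: measurable_funTS; exact: mTv.
    - by move=> j v _; rewrite lee_fin.
    rewrite -ge0_integralZl_EFin//; last 2 first.
    - by move=> v _; apply: nneseries_ge0 => j _ _; rewrite lee_fin.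
    - apply: measurable_funTS; apply: ge0_emeasurable_sum => [j v _ _|j _].
        by rewrite lee_fin.
      exact: mTv.
    apply: le_integral_nomeas => [v _|v /=]; first by rewrite lee_fin divr_ge0 ?powR_ge0.
    by rewrite in_itv/= => vI; exact: pointwise.
  rewrite ge0_integralZl_EFin//; last 2 first.
  - move=> t _; apply: nneseries_ge0 => j _ _; apply: integral_ge0 => v _.
    by rewrite lee_fin.
  - apply: measurable_funTS; apply: ge0_emeasurable_sum => [j t _ _|j _].
      by apply: integral_ge0 => v _; rewrite lee_fin.
    exact: mTi.
  rewrite lee_wpmul2l// integral_nneseries//; last 2 first.
  - by move=> j; apply: measurable_funTS; exact: mTi.
  - by move=> j t _; apply: integral_ge0 => v _; rewrite lee_fin.
  apply: le_trans termsum; apply: lee_nneseries => // j _ _.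
  by apply: integral_ge0 => t _; apply: integral_ge0 => v _; rewrite lee_fin.
rewrite -[leLHS]mul1e -(_ : (4 * 4^-1)%:E = 1%E)%E; last by congr EFin; lra.
rewrite EFinM -muleA.
apply: (@le_trans _ _ (4%:E * (C1%:E * ((1 - k)^-1%:E * W)))%E).
  by rewrite lee_wpmul2l// lee_fin.
rewrite !muleA -!EFinM lee_wpmul2r// lee_fin mulrA.
lra.
Qed.

End DyadicChain.

(** * A Morrey estimate for functions of one variable *)

Section Morrey.
Set Implicit Arguments.
Unset Strict Implicit.
Context {R : realType}.
Notation mu := (@lebesgue_measure R).

(** The formula through [powR] also has the right value at 0, where both sides vanish. *)
Lemma measurable_inv : measurable_fun setT (fun x : R => x^-1).
Proof.
rewrite (_ : (fun x : R => x^-1) = (fun x => x * (x ^+ 2) `^ (-1))); last first.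
  apply/funext => x; rewrite powR_inv1 ?sqr_ge0//.
  have [->|x0] := eqVneq x 0; first by rewrite invr0 mul0r.
  by field.
apply: measurable_funM => //.
exact: (measurableT_comp (measurable_powR (-1)) (measurable_funX 2 (@measurable_id _ _ setT))).
Qed.

Lemma measurable_div d (T : measurableType d) (f g : T -> R) :
  measurable_fun setT f -> measurable_fun setT g -> measurable_fun setT (fun x => f x / g x).
Proof. by move=> mf mg; apply: measurable_funM => //; exact: (measurableT_comp measurable_inv). Qed.

Lemma measurable_powR_comp d (T : measurableType d) (k : R) (f : T -> R) :
  measurable_fun setT f -> measurable_fun setT (fun x => f x `^ k).
Proof. by move=> mf; exact: (measurableT_comp (measurable_powR k)). Qed.

Lemma is_derive_continuous (f : R -> R) (x df : R) : is_derive x 1 f df -> {for x, continuous f}.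
Proof. by case=> dF _; apply: differentiable_continuous; apply/derivable1_diffP. Qed.

Lemma mean_value (f df : R -> R) (a b : R) : a < b -> (forall x : R, is_derive x 1 f (df x)) ->
  exists2 c, a < c < b & f b - f a = df c * (b - a).
Proof.
move=> ab dF; have [//|c] := @MVT R f df a b ab (fun x _ => dF x).
  by apply: continuous_subspaceT => x; exact: is_derive_continuous.
by rewrite in_itv/= => cab ->; exists c.
Qed.

Lemma is_derive_reflect (f : R -> R) (x c df : R) : is_derive (c - x) 1 f df ->
  is_derive x 1 (fun v => f (c - v)) (- df).
Proof.
move=> dF.
have dg : is_derive x 1 (fun v => c - v) (- 1 : R).
  by rewrite -[X in is_derive _ _ _ X]add0r; exact: is_deriveB.
by have := @is_derive1_comp _ f (fun v => c - v) x df (-1) dF dg; rewrite mulrN1.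
Qed.

(* Morrey estimate: the mean slope [m x = (psi x - psi 0) / x] has derivative
   [(f x - m x) / x], and [f x - m x] is the mean of [f x - f (x - v)]; [k] is
   the free parameter of [le_add_powR]. *)
Lemma mean_slope_le (q a k r L : R) (f psi : R -> R) :
  1 < q -> 2 < a -> 0 < r -> 0 < k -> continuous f ->
  (forall x : R, is_derive x 1 psi (f x)) ->
  (\int[mu]_(x in `]0%R, r[) \int[mu]_(v in `]0%R, r[)
     (`|f x - f (x - v)| `^ q / v `^ a)%:E <= L%:E)%E ->
  `|(psi r - psi 0) / r - f 0| <=
    k * (r `^ ((a - 2) / q) / ((a - 2) / q)) + k `^ (1 - q) * r `^ ((a - 2) / q) * L.
Proof.
move=> q1 a2 r0 k0 cf dpsi hL.
set al := (a - 2) / q.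
have al0 : 0 < al by rewrite divr_gt0//; lra.
have mf : measurable_fun setT f by exact: continuous_measurable_fun.
have cpsi : continuous psi by move=> x; exact: is_derive_continuous.
have mpsi : measurable_fun setT psi by exact: continuous_measurable_fun.
pose m x := (psi x - psi 0) / x.
pose m' x := (f x - m x) / x.
have mm' : measurable_fun setT m'.
  apply: measurable_div => //; apply: measurable_funB => //.
  by apply: measurable_div => //; apply: measurable_funB.
pose D x v := `|f x - f (x - v)|.
pose K x v := D x v `^ q / v `^ a.
have K0 x v : (0 <= (K x v)%:E)%E by rewrite lee_fin divr_ge0 ?powR_ge0.
have mD2 : measurable_fun setT (fun z : R * R => D z.1 z.2).
  apply: measurableT_comp => //; apply: measurable_funB.
    exact: (measurableT_comp mf measurable_fst).
  apply: (measurableT_comp mf); exact: measurable_funB.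
have mK2 : measurable_fun setT (fun z : R * R => (K z.1 z.2)%:E).
  apply/measurable_EFinP; apply: measurable_div.
    exact: measurable_powR_comp.
  exact: (measurable_powR_comp _ measurable_snd).
have mDx x : measurable_fun setT (D x) := measurableT_comp mD2 (measurable_pair1 x).
have mKx x : measurable_fun setT (fun v => (K x v)%:E) := measurableT_comp mK2 (measurable_pair1 x).
pose h x := (\int[mu]_(v in `]0%R, r[) (K x v)%:E)%E.
have h0 x : (0 <= h x)%E by exact: integral_ge0.
have mh : measurable_fun setT h by exact: (measurable_integral _ mK2).
have slope x : 0 < x < r ->
    ((`|m' x|)%:E <= (k * x `^ (al - 1))%:E + (k `^ (1 - q) * r `^ al)%:E * h x)%E.
  move=> /andP[x0 xr].
  (* This threshold balances the two terms of [le_add_powR]. After division by x, the first is k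
     x^(al-1), integrable at 0; since al q = a - 2, the coefficient of the second is c^(1-q) x^(a-2)
     = k^(1-q) x^al, at most its value at r. *)
  pose c := k * x `^ al.
  have c0 : 0 < c by rewrite mulr_gt0// powR_gt0.
  have incr : (x * (f x - m x))%:E = (\int[mu]_(v in `]0%R, x[) (f x - f (x - v))%:E)%E.
    have cfx (v : R) : {for v, continuous (fun v => f x - f (x - v))}.
      apply: cvgB; first exact: cvg_cst.
      apply: continuous_comp; last exact: cf.
      apply: cvgB; [exact: cvg_cst|exact: cvg_id].
    have dF (v : R) : is_derive v 1 (fun v => f x * v + psi (x - v)) (f x - f (x - v)).
      apply: is_deriveD; last exact: is_derive_reflect.
      by rewrite -[X in is_derive _ _ _ X]mulr1; exact: is_deriveZ.
    rewrite (integral_is_derive x0 (fun v _ => cfx v) (fun v _ => dF v)).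
    rewrite subrr subr0 mulr0 add0r /m; congr EFin; field; by rewrite gt_eqF.
  have step : ((x * `|f x - m x|)%:E <= (c * x)%:E + (c `^ (1 - q) * x `^ a)%:E * h x)%E.
    rewrite -{1}(gtr0_norm x0) -normrM -abse_EFin incr.
    apply: (le_trans (le_abse_integral _ _ _)) => //.
      apply: measurable_funTS; apply/measurable_EFinP; apply: measurable_funB => //.
      by apply: (measurableT_comp mf); exact: measurable_funB.
    apply: (@le_trans _ _ (\int[mu]_(v in `]0%R, x[)
        (c%:E + (c `^ (1 - q) * x `^ a)%:E * (K x v)%:E))%E).
      apply: le_integral_nomeas => [v _|v /=]; first exact: abse_ge0.
      rewrite in_itv/= => /andP[v0 vx].
      rewrite lee_fin (le_trans (le_add_powR (ltW q1) c0 (normr_ge0 _)))// lerD2l.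
      rewrite -mulrA ler_wpM2l ?powR_ge0// /K mulrCA ler_peMr ?powR_ge0//.
      rewrite ler_pdivlMr ?powR_gt0// mul1r ge0_ler_powR ?nnegrE ?(ltW v0) ?(ltW x0) ?(ltW vx)//.
      lra.
    rewrite ge0_integralD//; last 3 first.
    - by move=> v _; rewrite lee_fin ltW.
    - by move=> v _; rewrite mule_ge0// lee_fin mulr_ge0 ?powR_ge0.
    - by apply: measurable_funTS; apply: measurable_funeM; exact: mKx.
    rewrite integral_cst//= lebesgue_measure_itv/= lte_fin x0 sube0 -EFinM leeD2l//.
    rewrite ge0_integralZl_EFin//; last 2 first.
    - by apply: measurable_funTS; exact: mKx.
    - by rewrite mulr_ge0 ?powR_ge0.
    rewrite lee_wpmul2l ?lee_fin ?mulr_ge0 ?powR_ge0//.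
    by apply: integral_sub_itv => //; exact: ltW.
  have -> : `|m' x| = x ^- 2 * (x * `|f x - m x|).
    by rewrite /m' normrM normfV (gtr0_norm x0); field; rewrite gt_eqF.
  rewrite EFinM.
  apply: (@le_trans _ _ ((x ^- 2)%:E * ((c * x)%:E + (c `^ (1 - q) * x `^ a)%:E * h x))%E).
    by rewrite lee_wpmul2l// lee_fin invr_ge0 exprn_ge0// ltW.
  have xp : x != 0 by rewrite gt_eqF.
  have x2 : x ^- 2 = x `^ (- 2%:R) by rewrite powR_invn// ltW.
  rewrite ge0_muleDr ?mule_ge0 ?lee_fin ?mulr_ge0 ?powR_ge0 ?(ltW c0) ?(ltW x0)//.
  rewrite muleA -!EFinM; apply: leeD.
    rewrite lee_fin /c (_ : x ^- 2 * _ = k * (x `^ al / x)); last by field.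
    by rewrite -[X in _ / X]powRr1 ?(ltW x0)// -powRB ?xp ?implybT.
  rewrite lee_wpmul2r// lee_fin.
  rewrite [leLHS](_ : _ = k `^ (1 - q) * x `^ al).
    by rewrite ler_wpM2l ?powR_ge0// ge0_ler_powR ?nnegrE ?(ltW al0) ?(ltW x0) ?(ltW r0) ?(ltW xr).
  rewrite x2 /c powRM ?powR_ge0 ?(ltW k0)// -powRrM mulrCA -mulrA; congr (_ * _).
  rewrite -!powRD ?xp ?implybT//; congr (_ `^ _).
  rewrite /al; field; by rewrite gt_eqF//; lra.
  exact: ltW.
set B := (X in _ <= X).
have osc eta : 0 < eta -> eta < r -> `|m r - m eta| <= B.
  move=> e0 er.
  have dm (x : R) : x \in `[eta, r] -> is_derive x 1 m (m' x).
    rewrite in_itv/= => /andP[ex _]; have x0 : x != 0 by rewrite gt_eqF// (lt_le_trans e0).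
    have dV : is_derive x 1 (fun y : R => y^-1) (- x ^- 2) .
      by have := is_deriveV x0 (is_derive_id x 1); rewrite /GRing.scale/= mulr1.
    have dB : is_derive x 1 (fun y : R => psi y - psi 0) (f x).
      by rewrite -[X in is_derive _ _ _ X]subr0; exact: is_deriveB.
    apply: (is_derive_eq (is_deriveM dB dV)).
    by rewrite /GRing.scale/= /m' /m; field.
  have cm' (x : R) : x \in `[eta, r] -> {for x, continuous m'}.
    move=> xI; have cmx := is_derive_continuous (dm x xI).
    move: xI; rewrite in_itv/= => /andP[ex _]; have x0 : x != 0 by rewrite gt_eqF// (lt_le_trans e0).
    apply: cvgM; last exact: cvgV.
    by apply: cvgB => //; exact: cf.
  rewrite -lee_fin -abse_EFin -(integral_is_derive er cm' dm).
  apply: (le_trans (le_abse_integral _ _ _)) => //.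
    by apply: measurable_funTS; apply/measurable_EFinP.
  have mpow : measurable_fun setT (fun x : R => (k * x `^ (al - 1))%:E).
    by apply/measurable_EFinP; apply: measurable_funM => //; exact: measurable_powR.
  have c0 : 0 <= k `^ (1 - q) * r `^ al by rewrite mulr_ge0 ?powR_ge0.
  apply: (@le_trans _ _ (\int[mu]_(x in `]0%R, r[)
    ((k * x `^ (al - 1))%:E + (k `^ (1 - q) * r `^ al)%:E * h x))%E).
    apply: (@le_trans _ _ (\int[mu]_(x in `]eta, r[)
      ((k * x `^ (al - 1))%:E + (k `^ (1 - q) * r `^ al)%:E * h x))%E).
      apply: le_integral_nomeas => [x _|x /=]; first exact: abse_ge0.
      rewrite in_itv/= => /andP[ex xr]; apply: slope.
      by rewrite xr (lt_trans e0).
    apply: integral_sub_itv => //; first exact: ltW.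
      by apply: emeasurable_funD => //; exact: measurable_funeM.
    by move=> x; rewrite adde_ge0// ?mule_ge0 ?lee_fin ?mulr_ge0 ?powR_ge0 ?(ltW k0).
  rewrite ge0_integralD//; last 4 first.
  - by move=> x _; rewrite lee_fin mulr_ge0 ?powR_ge0 ?(ltW k0).
  - exact: measurable_funTS.
  - by move=> x _; rewrite mule_ge0.
  - by apply: measurable_funTS; exact: measurable_funeM.
  rewrite /B EFinD; apply: leeD.
    under eq_integral do rewrite EFinM.
    rewrite ge0_integralZl_EFin//; last 3 first.
    - by move=> x _; rewrite lee_fin powR_ge0.
    - by apply: measurable_funTS; apply/measurable_EFinP; exact: measurable_powR.
    - exact: ltW.
    rewrite EFinM lee_wpmul2l ?lee_fin ?(ltW k0)//.
    rewrite (le_trans (integral_powR_le0 _ _))//; first by lra.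
    by rewrite subrK.
  rewrite ge0_integralZl_EFin//; last exact: measurable_funTS.
  by rewrite [leRHS]EFinM lee_wpmul2l ?lee_fin.
apply/ler_addgt0Pr => e e0.
have /cvgrPdist_lt /(_ e e0) := cf 0.
move=> [/= d d0 dP].
pose eta := Num.min d r / 2.
have mn : 0 < Num.min d r by rewrite lt_min d0.
have eta0 : 0 < eta by rewrite divr_gt0.
have [mnd mnr] : Num.min d r <= d /\ Num.min d r <= r by rewrite !ge_min !lexx orbT.
have etar : eta < r by rewrite /eta; lra.
have etad : eta < d by rewrite /eta; lra.
(* The mean slope over a short interval is a value of [f] near 0, so continuity of [f] lets [eta]
   tend to 0. *)
have [c /andP[c0 ce] psie] := mean_value eta0 dpsi.
have me : m eta = f c by rewrite /m psie subr0 mulfK// gt_eqF.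
apply: (le_trans (ler_distD (m eta) _ _)).
apply: lerD; first exact: osc.
rewrite me distrC ltW//; apply: dP.
by rewrite /= sub0r normrN gtr0_norm// (lt_trans ce).
Qed.

End Morrey.

(** * Vector-valued curves: measurability and mean value inequalities *)

Section VectorCurves.
Set Implicit Arguments.
Unset Strict Implicit.
Context {R : realType} {n : nat}.
Notation mu := (@lebesgue_measure R).
Implicit Types (c dc : R -> 'rV[R]_n) (xi T : 'rV[R]_n).

Definition measurable_vec d (X : measurableType d) (f : X -> 'rV[R]_n) :=
  forall i, measurable_fun setT (fun x => f x ord0 i).

Section MeasurableVec.
Context d (X : measurableType d).
Implicit Types (f g : X -> 'rV[R]_n).

Lemma measurable_vec_cst T : measurable_vec (fun _ : X => T).
Proof. by move=> i; exact: measurable_cst. Qed.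

Lemma measurable_vecB f g : measurable_vec f -> measurable_vec g ->
  measurable_vec (fun x => f x - g x).
Proof.
move=> mf mg i; under eq_fun do rewrite !mxE; exact: (measurable_funB (mf i) (mg i)).
Qed.

Lemma measurable_vecZ (k : X -> R) f : measurable_fun setT k -> measurable_vec f ->
  measurable_vec (fun x => k x *: f x).
Proof.
by move=> mk mf i; under eq_fun do rewrite !mxE; exact: (measurable_funM mk (mf i)).
Qed.

Lemma measurable_dotp f g : measurable_vec f -> measurable_vec g ->
  measurable_fun setT (fun x => dotp (f x) (g x)).
Proof.
by move=> mf mg; apply: measurable_sum => i; exact: (measurable_funM (mf i) (mg i)).
Qed.

Lemma measurable_sqrt : measurable_fun setT (fun x : R => Num.sqrt x).
Proof. by apply: continuous_measurable_fun; exact: sqrt_continuous. Qed.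

Lemma measurable_enorm f : measurable_vec f -> measurable_fun setT (fun x => enorm (f x)).
Proof. by move=> mf; exact: (measurableT_comp measurable_sqrt (measurable_dotp mf mf)). Qed.

Lemma measurable_inv_Rpq p q f g h : measurable_vec f -> measurable_vec g -> measurable_vec h ->
  measurable_fun setT (fun x => inv_Rpq p q (f x) (g x) (h x)).
Proof.
move=> mf mg mh.
have mgf := measurable_vecB mg mf; have mhf := measurable_vecB mh mf.
have mgh := measurable_vecB mg mh.
apply: measurable_div; apply: measurable_powR_comp.
  apply: (measurableT_comp measurable_sqrt); apply: measurable_funB.
    apply: measurable_funM; apply: measurable_funX; exact: measurable_enorm.
  by apply: measurable_funX; exact: measurable_dotp.
apply: measurable_funM; last exact: measurable_enorm.
by apply: measurable_funM; exact: measurable_enorm.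
Qed.

End MeasurableVec.

Lemma measurable_vec_comp d d' (X : measurableType d) (Y : measurableType d')
    (f : Y -> 'rV[R]_n) (g : X -> Y) :
  measurable_vec f -> measurable_fun setT g -> measurable_vec (fun x => f (g x)).
Proof. by move=> mf mg i; exact: (measurableT_comp (mf i) mg). Qed.

(** The derivative is a separate argument, so that a reparametrized curve comes with an explicit
    formula for it. *)
Definition C1_curve c dc := forall i, continuous (fun x : R => dc x ord0 i) /\
  forall x : R, is_derive x 1 (fun y : R => c y ord0 i) (dc x ord0 i).

Lemma C1_curve_dotp c dc xi : C1_curve c dc ->
  continuous (fun x => dotp (dc x) xi) /\
  forall x : R, is_derive x 1 (fun y : R => dotp (c y) xi) (dotp (dc x) xi).
Proof.
move=> h; split.
  move=> x; rewrite /dotp; apply: cvg_big; first exact: add_continuous.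
  move=> i _; apply: cvgM; last exact: cvg_cst.
  exact: (h i).1.
move=> x; rewrite /dotp.
have hi i : is_derive x 1 (fun y : R => c y ord0 i * xi ord0 i) (dc x ord0 i * xi ord0 i).
  rewrite (_ : (fun y : R => _) = (fun y : R => xi ord0 i *: (c y ord0 i : R^o))).
    by rewrite mulrC; exact: (is_deriveZ (xi ord0 i) ((h i).2 x)).
  by apply/funext => y; rewrite mulrC.
have := @is_derive_sum _ _ _ n _ x 1 _ hi.
by rewrite fct_sumE.
Qed.

Lemma C1_curve_measurable c dc : C1_curve c dc -> measurable_vec c /\ measurable_vec dc.
Proof.
move=> h; split=> i; apply: continuous_measurable_fun; last exact: (h i).1.
by move=> x; exact: is_derive_continuous ((h i).2 x).
Qed.

(** Cauchy-Schwarz followed by cancelling one factor |w|. It turns a scalar identity tested against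
    [w] itself into a bound for |w|. *)
Lemma enorm_sub_le_dotp (w z : 'rV[R]_n) (k : R) : dotp w w <= dotp z w * k -> 0 <= k ->
  enorm w <= enorm z * k.
Proof.
move=> h k0; have [w0|w0] := eqVneq (enorm w) 0.
  by rewrite w0 mulr_ge0 ?enorm_ge0.
have wp : 0 < enorm w by rewrite lt_def w0 enorm_ge0.
rewrite -(ler_pM2r wp) -expr2 enorm_sqr (le_trans h)//.
rewrite mulrAC ler_wpM2r//; exact: dotp_le.
Qed.

(** The mean value theorem holds for scalar functions; taking the inner product with the very vector
    [w] to be estimated reduces to that case without any loss in the constant. *)
Lemma chord_tangent_le c dc T (a b e : R) : C1_curve c dc -> a <= b ->
  (forall x, a < x < b -> enorm (dc x - T) <= e) ->
  enorm (c b - c a - (b - a) *: T) <= e * (b - a).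
Proof.
move=> h; rewrite le_eqVlt => /predU1P[->|ab] he.
  by rewrite !subrr scale0r subr0 enorm0 mulr0.
set w := _ - _ *: T.
have [x xab hx] := mean_value ab (C1_curve_dotp w h).2.
apply: (@le_trans _ _ (enorm (dc x - T) * (b - a))); last first.
  by rewrite ler_wpM2r ?he// subr_ge0 ltW.
apply: enorm_sub_le_dotp; last by rewrite subr_ge0 ltW.
have -> : dotp w w = dotp (c b) w - dotp (c a) w - (b - a) * dotp T w.
  by rewrite -dotpZl -!dotpBl.
rewrite hx (dotpBl (dc x)); lra.
Qed.

(** The same test vector, now with the fundamental theorem of calculus. This integral form is the
    one that Hardy's inequality can use. *)
Lemma chord_tangent_integral_le c dc T (a b : R) : C1_curve c dc -> a < b ->
  ((enorm (c b - c a - (b - a) *: T))%:E <=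
     \int[mu]_(x in `]a, b[) (enorm (dc x - T))%:E)%E.
Proof.
move=> h ab; set w := _ - _ *: T.
have [w0|w0] := eqVneq (enorm w) 0.
  by rewrite w0; apply: integral_ge0 => x _; rewrite lee_fin enorm_ge0.
have wp : 0 < enorm w by rewrite lt_def w0 enorm_ge0.
have [cf dF] := C1_curve_dotp w h.
pose F x := dotp (c x) w - x * dotp T w.
have dF' (x : R) : is_derive x 1 F (dotp (dc x - T) w).
  rewrite dotpBl; apply: is_deriveB.
  rewrite (_ : (fun y : R => _) = (fun y : R => dotp T w *: (y : R^o))).
    by rewrite -[X in is_derive _ _ _ X]mulr1; exact: (is_deriveZ (dotp T w) (is_derive_id x 1)).
  by apply/funext => y; rewrite mulrC.
have cf' : continuous (fun x : R => dotp (dc x - T) w).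
  rewrite (_ : (fun x : R => _) = (fun x : R => dotp (dc x) w - dotp T w)).
    by move=> x; apply: cvgB; [exact: cf|exact: cvg_cst].
  by apply/funext => x; rewrite dotpBl.
have ww : (enorm w * enorm w)%:E = (\int[mu]_(x in `]a, b[) (dotp (dc x - T) w)%:E)%E.
  rewrite (integral_is_derive ab (fun x _ => cf' x) (fun x _ => dF' x)) -expr2 enorm_sqr.
  congr EFin; have -> : dotp w w = dotp (c b) w - dotp (c a) w - (b - a) * dotp T w.
    by rewrite -dotpZl -!dotpBl.
  by rewrite /F; ring.
have menorm : measurable_fun setT (fun x => (enorm (dc x - T))%:E).
  apply/measurable_EFinP; apply: measurable_enorm.
  by apply: measurable_vecB; [exact: (C1_curve_measurable h).2|exact: measurable_vec_cst].
rewrite -(@lee_pmul2l _ (enorm w)%:E) ?lte_fin// -EFinM ww.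
apply: (le_trans (lee_abs _)); apply: (le_trans (le_abse_integral _ _ _)) => //.
  by apply: measurable_funTS; apply/measurable_EFinP; exact: continuous_measurable_fun.
rewrite -ge0_integralZl_EFin//; last 3 first.
- by move=> x _; rewrite lee_fin enorm_ge0.
- exact: measurable_funTS.
- exact: enorm_ge0.
apply: le_integral_nomeas => x _; first exact: abse_ge0.
by rewrite lee_fin mulrC; exact: cauchy_schwarz.
Qed.

End VectorCurves.

(** * Chord directions seen from one vertex *)

Section ChordDirections.
Set Implicit Arguments.
Unset Strict Implicit.
Context {R : realType}.
Notation mu := (@lebesgue_measure R).

(** The base point is always the parameter 0; other base points and the reversed orientation enter
    through [C1_curve_affine]. *)
Definition chord_dir n (c : R -> 'rV[R]_n) (v : R) : 'rV[R]_n :=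
  (enorm (c v - c 0))^-1 *: (c v - c 0).

Section OneCurve.
Context {n : nat} (c dc : R -> 'rV[R]_n) (T : 'rV[R]_n) (d : R).
Context (hc : C1_curve c dc) (hT : enorm T = 1)
  (hdT : forall x, 0 < x < d -> enorm (dc x - T) <= 4^-1)
  (hdc : forall x, enorm (dc x) <= 1).
Notation e := (chord_dir c).

Lemma chord_le_arc x y : x <= y -> enorm (c y - c x) <= y - x.
Proof.
move=> xy; have := @chord_tangent_le _ _ c dc 0 x y 1 hc xy.
rewrite scaler0 subr0 mul1r; apply=> z _; by rewrite subr0.
Qed.

(** The chord differs from (y - x) T by at most a quarter of y - x, and T is a unit vector. *)
Lemma arc_le_chord x y : 0 <= x -> x <= y -> y < d -> 3 / 4 * (y - x) <= enorm (c y - c x).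
Proof.
move=> x0 xy yd.
have h : enorm (c y - c x - (y - x) *: T) <= 4^-1 * (y - x).
  apply: (chord_tangent_le hc xy) => z /andP[xz zy]; apply: hdT.
  by rewrite (le_lt_trans x0)//= (lt_trans zy).
have := ler_enorm_sub ((y - x) *: T) (c y - c x).
rewrite (enorm_sub (_ *: T)) enormZ hT mulr1 ger0_norm ?subr_ge0//; lra.
Qed.

Lemma chord_gt0 v : 0 < v < d -> 0 < enorm (c v - c 0).
Proof.
move=> /andP[v0 vd]; have := arc_le_chord (lexx 0) (ltW v0) vd; rewrite subr0; lra.
Qed.

Lemma enorm_chord_dir v : 0 < v < d -> enorm (e v) = 1.
Proof.
move=> /chord_gt0 h; rewrite enormZ gtr0_norm ?invr_gt0// mulVf// gt_eqF//.
Qed.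

(** The chords are v T + a and w T + b with |a| <= v/4 and |b| <= w/4, so their inner product is at
    least v w (1 - 1/4 - 1/4 - 1/16). Without this, [unit_dist_le_wedge] would fail for nearly
    opposite directions. *)
Lemma chord_dir_acute v w : 0 < v < d -> 0 < w < d -> 0 <= dotp (e v) (e w).
Proof.
move=> vI wI; rewrite dotpZl dotpZr !mulr_ge0 ?invr_ge0 ?enorm_ge0//.
have key x : 0 < x < d -> enorm (c x - c 0 - x *: T) <= 4^-1 * x.
  move=> /andP[x0 xd]; have := @chord_tangent_le _ _ c dc T 0 x 4^-1 hc (ltW x0).
  rewrite subr0; apply=> z /andP[z0 zx]; apply: hdT; by rewrite z0 (lt_trans zx).
have := key v vI; have := key w wI.
move: vI wI => /andP[v0 _] /andP[w0 _].
set a := c v - c 0 - v *: T; set b := c w - c 0 - w *: T => hb ha.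
have -> : c v - c 0 = v *: T + a by rewrite /a [RHS]addrC subrK.
have -> : c w - c 0 = w *: T + b by rewrite /b [RHS]addrC subrK.
clearbody a b.
rewrite !(dotpDl,dotpDr,dotpZl,dotpZr) -[dotp T T]enorm_sqr hT expr1n.
have h1 : - (4^-1 * w) <= dotp T b.
  by have := cauchy_schwarz T b; rewrite hT mul1r ler_norml => /andP[+ _]; lra.
have h2 : - (4^-1 * v) <= dotp a T.
  by have := cauchy_schwarz a T; rewrite hT mulr1 ler_norml => /andP[+ _]; lra.
have h3 : - (4^-1 * v * (4^-1 * w)) <= dotp a b.
  have := cauchy_schwarz a b; rewrite ler_norml => /andP[+ _].
  have : enorm a * enorm b <= 4^-1 * v * (4^-1 * w) by rewrite ler_pM ?enorm_ge0.
  lra.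
have : v * - (4^-1 * w) <= v * dotp T b by rewrite ler_wpM2l// ltW.
have : w * - (4^-1 * v) <= w * dotp a T by rewrite ler_wpM2l// ltW.
have : 0 < v * w by rewrite mulr_gt0.
lra.
Qed.

(** For these w the chords X and Y satisfy |X| |Y| >= (3/4 v)(3/16 v) = 9/64 v^2. Half of this, the
    2 coming from [unit_dist_le_wedge], still exceeds v^2 / 16, so the wedge is at least v^2 / 16
    times the distance of the directions. No side is longer than v, so the denominator of 1/R is at
    most v^(3p). *)
Lemma chord_dir_dist_le p q v w : 0 < p -> 0 < q -> 0 < v < d -> v / 4 < w < v / 2 ->
  enorm (e v - e w) `^ q <=
    v `^ (3 * p - 2 * q) * (16 `^ q * inv_Rpq p q (c 0) (c v) (c w)).
Proof.
move=> p0 q0 /andP[v0 vd] /andP[wl wu].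
have w0 : 0 < w by lra.
have wd : w < d by lra.
have vI : 0 < v < d by rewrite v0.
have wI : 0 < w < d by rewrite w0.
set X := c v - c 0; set Y := c w - c 0.
have Xl : enorm X <= v by have := chord_le_arc (ltW v0); rewrite subr0.
have Yl : enorm Y <= w by have := chord_le_arc (ltW w0); rewrite subr0.
have Xg : 3 / 4 * v <= enorm X by have := arc_le_chord (lexx 0) (ltW v0) vd; rewrite subr0.
have Yg : 3 / 4 * w <= enorm Y by have := arc_le_chord (lexx 0) (ltW w0) wd; rewrite subr0.
have wv : w <= v by lra.
have Zl : enorm (c v - c w) <= v - w by exact: chord_le_arc.
have Zg : 3 / 4 * (v - w) <= enorm (c v - c w) by apply: arc_le_chord => //; exact: ltW.
have X0 : 0 < enorm X by lra.
have Y0 : 0 < enorm Y by lra.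
have Z0 : 0 < enorm (c v - c w) by lra.
have W : v ^+ 2 / 16 * enorm (e v - e w) <= wedge_norm X Y.
  have h := unit_dist_le_wedge (enorm_chord_dir vI) (enorm_chord_dir wI) (chord_dir_acute vI wI).
  have -> : wedge_norm X Y = enorm X * enorm Y * wedge_norm (e v) (e w).
    rewrite wedge_normZ !gtr0_norm ?invr_gt0// -/X -/Y; field.
    by rewrite !gt_eqF.
  have h2 : 9 / 64 * v ^+ 2 <= enorm X * enorm Y.
    apply: (@le_trans _ _ (3 / 4 * v * (3 / 4 * (v / 4)))).
      by rewrite expr2; nra.
    by rewrite ler_pM//; lra.
  apply: (@le_trans _ _ (9 / 64 * v ^+ 2 * wedge_norm (e v) (e w))).
    rewrite (le_trans (ler_wpM2l _ h))//; first by rewrite mulr_ge0// sqr_ge0.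
    have : 0 <= v ^+ 2 * wedge_norm (e v) (e w) by rewrite mulr_ge0 ?sqr_ge0 ?wedge_norm_ge0.
    lra.
  by rewrite ler_wpM2r ?wedge_norm_ge0.
have D0 : 0 < enorm (c v - c w) * enorm X * enorm Y by rewrite !mulr_gt0.
have D1 : enorm (c v - c w) * enorm X * enorm Y <= v * v * v.
  by rewrite !ler_pM ?mulr_ge0 ?enorm_ge0//; lra.
have E0 := enorm_ge0 (e v - e w).
rewrite /inv_Rpq -/X -/Y.
apply: (@le_trans _ _ (v `^ (3 * p - 2 * q) * (16 `^ q *
     ((v ^+ 2 / 16 * enorm (e v - e w)) `^ q / (v * v * v) `^ p)))); last first.
  rewrite !ler_wpM2l ?powR_ge0// ler_pM ?powR_ge0 ?invr_ge0 ?powR_ge0//.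
    by rewrite ge0_ler_powR ?nnegrE ?mulr_ge0 ?sqr_ge0 ?wedge_norm_ge0 ?(ltW q0) ?(ltW v0).
  rewrite lef_pV2 ?posrE ?powR_gt0 ?mulr_gt0//.
  by rewrite ge0_ler_powR ?nnegrE ?(ltW D0) ?(ltW p0) ?mulr_ge0 ?(ltW v0).
have vn : v != 0 by rewrite gt_eqF.
have v2 : (v ^+ 2) `^ q = v `^ (2 * q).
  by rewrite -(powR_mulrn 2 (ltW v0)) -powRrM.
have v3 : (v * v * v) `^ p = v `^ (3 * p).
  by rewrite -expr2 -exprSr -(powR_mulrn 3 (ltW v0)) -powRrM.
have -> : (v ^+ 2 / 16 * enorm (e v - e w)) `^ q =
    v `^ (2 * q) * 16^-1 `^ q * enorm (e v - e w) `^ q.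
  by rewrite -v2 -!powRM ?mulr_ge0 ?sqr_ge0 ?invr_ge0 ?(ltW v0).
rewrite v3.
rewrite powRB ?vn ?implybT//.
rewrite -(powR_inv1 (_ : 0 <= 16))// -powRrM mulN1r powRN.
rewrite le_eqVlt; apply/orP; left; apply/eqP; field.
by rewrite !gt_eqF ?powR_gt0.
Qed.

(** This makes the remainder of the telescoping vanish. In v (e v - T) = (v - |c v - c 0|) e v + (c
    v - c 0 - v T) each summand has norm at most eps v. *)
Lemma chord_dir_cvg (eps : R) : 0 < eps -> dc 0 = T -> 0 < d ->
  (exists2 eta, 0 < eta & forall x, 0 < x < eta -> enorm (dc x - T) <= eps) ->
  exists2 eta, 0 < eta & forall x, 0 < x < eta -> enorm (e x - T) <= 2 * eps.
Proof.
move=> eps0 dT d0 [eta eta0 heta].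
exists (Num.min eta d); first by rewrite lt_min eta0.
move=> v /andP[v0]; rewrite lt_min => /andP[ve vd].
have vI : 0 < v < d by rewrite v0.
have h : enorm (c v - c 0 - v *: T) <= eps * v.
  have := @chord_tangent_le _ _ c dc T 0 v eps hc (ltW v0).
  rewrite subr0; apply=> z /andP[z0 zx]; apply: heta; by rewrite z0 (lt_trans zx).
have X0 := chord_gt0 vI.
rewrite -(ler_pM2l v0) -[X in X * _](gtr0_norm v0) -enormZ.
have -> : v *: (e v - T) = (v - enorm (c v - c 0)) *: e v + (c v - c 0 - v *: T).
  rewrite scalerBr scalerBl [enorm _ *: _]scalerA divff ?gt_eqF// scale1r.
  by rewrite addrA subrK.
rewrite (le_trans (enormD _ _))// enormZ enorm_chord_dir// mulr1.
suff : `|v - enorm (c v - c 0)| <= eps * v by lra.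
have vT : enorm (v *: T) = v by rewrite enormZ hT mulr1 gtr0_norm.
have := ler_enorm_sub (v *: T) (c v - c 0); have := ler_enorm_sub (c v - c 0) (v *: T).
rewrite vT (enorm_sub (v *: T)) => h1 h2.
by rewrite ler_norml; apply/andP; split; lra.
Qed.

End OneCurve.

Lemma chord_dir_integral_le (p q : R) : 1 < q -> 2 / 3 * q + 1 < p ->
  exists2 C : R, 0 < C & forall n (c dc : R -> 'rV[R]_n) (d : R), 0 < d ->
  C1_curve c dc -> (forall x, enorm (dc x) = 1) ->
  (forall x, 0 < x < d -> enorm (dc x - dc 0) <= 4^-1) ->
  (forall eps, 0 < eps ->
     exists2 eta, 0 < eta & forall x, 0 < x < eta -> enorm (dc x - dc 0) <= eps) ->
  (\int[mu]_(v in `]0%R, d[) (enorm (chord_dir c v - dc 0) `^ q / v `^ (3 * p - 2 * q - 1))%:E <=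
   C%:E * \int[mu]_(v in `]0%R, d[) \int[mu]_(w in `]0%R, d[) (inv_Rpq p q (c 0) (c v) (c w))%:E)%E.
Proof.
move=> q1 hp.
have a1 : 1 < 3 * p - 2 * q - 1 by lra.
have [C C0 hC] := chain_integral_le q1 a1.
exists (C * 16 `^ q); first by rewrite mulr_gt0// powR_gt0.
move=> n c dc d d0 hc hu hd hcv.
have [mc mdc] := C1_curve_measurable hc.
pose G (z : R * R) := 16 `^ q * inv_Rpq p q (c 0) (c z.1) (c z.2).
have mI : measurable_fun setT (fun z : R * R => inv_Rpq p q (c 0) (c z.1) (c z.2)).
  apply: measurable_inv_Rpq; first exact: measurable_vec_cst.
    exact: measurable_vec_comp.
  exact: measurable_vec_comp.
have mdir : measurable_vec (chord_dir c).
  apply: measurable_vecZ.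
    apply: (measurableT_comp measurable_inv); apply: measurable_enorm.
    by apply: measurable_vecB => //; exact: measurable_vec_cst.
  by apply: measurable_vecB => //; exact: measurable_vec_cst.
have mE : measurable_fun setT (fun v => enorm (chord_dir c v - dc 0)).
  by apply: measurable_enorm; apply: measurable_vecB => //; exact: measurable_vec_cst.
have mG : measurable_fun setT G by apply: measurable_funM.
have G0 z : 0 <= G z by rewrite mulr_ge0 ?powR_ge0 ?inv_Rpq_ge0.
apply: (le_trans (hC d _ G d0 mE mG (fun=> enorm_ge0 _) G0 _ _)).
- move=> v w vI wI.
  apply: (le_trans (enorm_dist _ (chord_dir c w) _)); rewrite lerD2r.
  have q0 : 0 < q by lra.
  have h : enorm (chord_dir c v - chord_dir c w) `^ q <= v `^ (3 * p - 2 * q - 1 + 1) * G (v, w).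
    rewrite subrK; apply: (chord_dir_dist_le hc (hu 0) hd) => //; last by lra.
    by move=> x; rewrite hu.
  rewrite [leLHS](_ : _ = (enorm (chord_dir c v - chord_dir c w) `^ q) `^ q^-1); last first.
    by rewrite -powRrM mulfV ?gt_eqF// powRr1 ?enorm_ge0.
  by rewrite ge0_ler_powR ?nnegrE ?powR_ge0 ?invr_ge0 ?(ltW q0)// mulr_ge0 ?powR_ge0 ?G0.
- move=> eps eps0.
  have e2 : 0 < eps / 2 by rewrite divr_gt0.
  have [eta eta0 heta] := @chord_dir_cvg _ c dc (dc 0) d hc (hu 0) hd (eps / 2) e2 erefl d0 (hcv _ e2).
  by exists eta => // x xI; rewrite (le_trans (heta _ xI))//; lra.
- rewrite EFinM -muleA lee_wpmul2l ?lee_fin ?(ltW C0)//.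
  have mIx v : measurable_fun setT (fun w : R => (inv_Rpq p q (c 0) (c v) (c w))%:E).
    by apply/measurable_EFinP; exact: (measurableT_comp mI (measurable_pair1 v)).
  rewrite le_eqVlt; apply/orP; left; apply/eqP.
  rewrite -ge0_integralZl_EFin//; last 2 first.
  - by move=> v _; apply: integral_ge0 => w _; rewrite lee_fin inv_Rpq_ge0.
  - apply: measurable_funTS.
    apply: (@measurable_integral R _ R `]0, d[%classic (fun z => (inv_Rpq p q (c 0) (c z.1) (c z.2))%:E)) => //.
      exact/measurable_EFinP.
    by move=> z; rewrite lee_fin inv_Rpq_ge0.
  apply: eq_integral => v _; rewrite -ge0_integralZl_EFin ?powR_ge0//.
  - by move=> w _; rewrite lee_fin inv_Rpq_ge0.
  - by apply: measurable_funTS; exact: mIx.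
Qed.

End ChordDirections.

(** * Closed curves of class C^1 *)

Section Circle.
Set Implicit Arguments.
Unset Strict Implicit.
Context {R : realType}.
Notation mu := (@lebesgue_measure R).

Lemma C1_curve_affine n (c dc : R -> 'rV[R]_n) u s : C1_curve c dc ->
  C1_curve (fun v => c (u + s * v)) (fun v => s *: dc (u + s * v)).
Proof.
move=> h i.
have dg (x : R) : is_derive x 1 (fun v : R => u + s * v) s.
  rewrite -[X in is_derive _ _ _ X]add0r; apply: is_deriveD.
  by rewrite -[X in is_derive _ _ _ X]mulr1; exact: is_deriveZ.
split=> x.
  rewrite (_ : (fun v : R => _) = (fun v : R => s * dc (u + s * v) ord0 i)).
    apply: cvgM; first exact: cvg_cst.
    apply: (@continuous_comp _ _ _ (fun v => u + s * v) (fun v => dc v ord0 i)); last exact: (h i).1.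
    exact: is_derive_continuous (dg x).
  by apply/funext => v; rewrite mxE.
rewrite mxE mulrC.
exact: (@is_derive1_comp _ (fun v => c v ord0 i) (fun v => u + s * v) x _ s ((h i).2 _) (dg x)).
Qed.

Lemma integral_period_signed (s a r : R) (f : R -> \bar R) : s = 1 \/ s = -1 -> 0 <= r <= 1 ->
  (forall x, f (x + 1) = f x) -> measurable_fun setT f -> (forall x, 0 <= f x)%E ->
  (\int[mu]_(x in `]0%R, r[) f (a + s * x)%R <= \int[mu]_(x in `]0%R, 1%R[) f x)%E.
Proof.
move=> [->|->] rI fp mf f0.
  under eq_integral do rewrite mul1r; exact: integral_period_add.
under eq_integral do rewrite mulN1r; exact: integral_period_sub.
Qed.

Section OneCurve.
Context {n : nat} (gamma : R -> 'rV[R]_n).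
Context (hC : C1_circle gamma) (hA : arclength_parametrized gamma).
Notation dg := (derive1 gamma).

Lemma C1_circle_curve : C1_curve gamma dg.
Proof.
case: hC => _ dgam cdg i; split=> x.
  apply: (@continuous_comp _ _ _ dg (fun m : 'rV[R]_n => m ord0 i)); first exact: cdg.
  exact: coord_continuous.
have := dgam x; rewrite derivable_mxP => /(_ ord0 i) h.
by rewrite derive1E derive_mx// mxE; exact: DeriveDef.
Qed.

Let hc := C1_circle_curve.

Lemma circle_periodic u : gamma (u + 1) = gamma u.
Proof. by case: hC => + _ _; exact. Qed.

Lemma derive1_periodic u : dg (u + 1) = dg u.
Proof.
have E : (fun h : R => h^-1 *: (gamma (h + (u + 1)) - gamma (u + 1))) =
         (fun h : R => h^-1 *: (gamma (h + u) - gamma u)).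
  by apply/funext => h; rewrite addrA !circle_periodic.
by rewrite /derive1 E.
Qed.

Lemma circle_measurable : measurable_vec gamma /\ measurable_vec dg.
Proof. exact: (C1_curve_measurable hc). Qed.

Lemma enorm_derive1_continuous x (e : R) : 0 < e ->
  exists2 r : R, 0 < r & forall y, `|x - y| < r -> enorm (dg y - dg x) <= e.
Proof.
move=> e0.
have ci i : continuous (fun y : R => (dg y - dg x) ord0 i).
  rewrite (_ : (fun y : R => _) = (fun y : R => dg y ord0 i - dg x ord0 i)).
    by move=> y; apply: cvgB; [exact: (hc i).1|exact: cvg_cst].
  by apply/funext => y; rewrite !mxE.
have cd : continuous (fun y : R => dotp (dg y - dg x) (dg y - dg x)).
  move=> y; rewrite /dotp; apply: cvg_big; first exact: add_continuous.
  by move=> i _; apply: cvgM; exact: ci.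
have cf : continuous (fun y : R => enorm (dg y - dg x)).
  move=> y; apply: (@continuous_comp _ _ _ (fun y : R => dotp (dg y - dg x) (dg y - dg x)) Num.sqrt).
    exact: cd.
  exact: sqrt_continuous.
have /cvgrPdist_lt/(_ e e0) [/= r r0 hr] := cf x.
exists r => // y xy; have h := hr y xy; apply: ltW.
have z : enorm (dg x - dg x) = 0 by rewrite (subrr (dg x)) enorm0.
by rewrite z sub0r normrN (ger0_norm (enorm_ge0 _)) in h.
Qed.

Lemma enorm_derive1_unif (e : R) : 0 < e ->
  exists2 d : R, 0 < d & forall x y, `|x - y| <= d -> enorm (dg x - dg y) <= e.
Proof.
move=> e0.
have e2 : 0 < e / 2 by rewrite divr_gt0.
(* Compactness of [0, 1] yields a radius that works for all [x] in [0, 1] and all real [y];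
   subtracting the floor of [x] from both points reaches the other [x]. *)
have := (compact_near_coveringP _).1 (@segment_compact R 0 1) R (0^'+)
   (fun d x => forall y, `|x - y| <= d -> enorm (dg x - dg y) <= e) _.
case.
  move=> x _; have [r r0 hr] := enorm_derive1_continuous x e2.
  exists ([set y | `|x - y| < r / 2], [set d | d < r / 2]) => /=.
    split; first by apply: nbhsx_ballx; rewrite divr_gt0.
    by apply: nbhs_right_lt; rewrite divr_gt0.
  move=> [y d]/= [xy dr] z yz.
  apply: (le_trans (enorm_dist _ (dg x) _)).
  rewrite [leRHS](splitr e); apply: lerD.
    by apply: hr; lra.
  rewrite enorm_sub; apply: hr.
  by rewrite (le_lt_trans (ler_distD y _ _))//; lra.
move=> d /= d0 hd.
have dp : 0 < d / 2 by rewrite divr_gt0.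
exists (d / 2) => // x y xy.
have := hd (d / 2); rewrite /= sub0r normrN gtr0_norm//.
move=> /(_ _ dp) h.
pose k := Num.floor x.
rewrite -(periodic_int derive1_periodic x (- k)) -(periodic_int derive1_periodic y (- k)).
apply: h; first by lra.
  rewrite /= in_itv/= mulrNz subr_ge0 floor_le/= lerBlDl ltW// -intrD1.
  by rewrite floorD1_gt.
by rewrite opprD addrACA subrr addr0.
Qed.

End OneCurve.

End Circle.

(** * Hardy's inequality and the kernel of the long triangles *)

Section Hardy.
Set Implicit Arguments.
Unset Strict Implicit.
Context {R : realType}.
Notation mu := (@lebesgue_measure R).

Lemma moment_le (q m v : R) (f : R -> R) : 1 < q -> 0 < v -> 0 <= m ->
  measurable_fun setT f -> (forall t, 0 <= f t) ->
  ((m * v)%:E <= \int[mu]_(t in `]0%R, v[) (f t)%:E)%E ->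
  ((m `^ q * v)%:E <= (2 `^ q)%:E * \int[mu]_(t in `]0%R, v[) (f t `^ q)%:E)%E.
Proof.
move=> q1 v0 m0 mf f0 hm.
have q0 : 0 < q by lra.
have mfq : measurable_fun setT (fun t => (f t `^ q)%:E).
  by apply/measurable_EFinP; exact: measurable_powR_comp.
set I := (\int[mu]_(t in _) (f t `^ q)%:E)%E.
have I0 : (0 <= I)%E by apply: integral_ge0 => t _; rewrite lee_fin powR_ge0.
have [->|mn] := eqVneq m 0.
  by rewrite powR0 ?gt_eqF// mul0r mule_ge0// lee_fin powR_ge0.
have mp : 0 < m by rewrite lt_def mn.
(* With this threshold the first term of [le_add_powR] accounts for half of m v and is absorbed.
   Multiplying what remains by c^(q-1) gives c^q v, that is m^q v / 2^q, on the left. *)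
pose c := m / 2; have c0 : 0 < c by rewrite divr_gt0.
have [Ifin|Ioo] := boolP (I \is a fin_num); last first.
  move: I0 Ioo; case: I => [s| |] //= _ _.
  by rewrite gt0_muley ?leey// lte_fin powR_gt0.
have EI : I = (fine I)%:E by rewrite fineK.
have h : m * v <= c * v + c `^ (1 - q) * fine I.
  rewrite -lee_fin EFinD [X in (_ <= _ + X)%E]EFinM -EI (le_trans hm)//.
  apply: (@le_trans _ _ (\int[mu]_(t in `]0%R, v[) (cst c%:E t + (c `^ (1 - q))%:E * (f t `^ q)%:E))%E).
    apply: le_integral_nomeas => t _; first by rewrite lee_fin.
    by rewrite /= -EFinM -EFinD lee_fin le_add_powR// ltW.
  rewrite ge0_integralD//; last 3 first.
  - by move=> t _; rewrite lee_fin ltW.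
  - by move=> t _; rewrite mule_ge0 ?lee_fin ?powR_ge0.
  - by apply: measurable_funTS; exact: measurable_funeM.
  rewrite integral_cst//= lebesgue_measure_itv/= lte_fin v0 sube0 -EFinM leeD2l//.
  rewrite ge0_integralZl_EFin ?powR_ge0//.
    by move=> t _; rewrite lee_fin powR_ge0.
  exact: measurable_funTS.
rewrite EI -EFinM lee_fin.
have cq : c `^ (q - 1) * c `^ (1 - q) = 1.
  rewrite -powRD; last by rewrite (gt_eqF c0) implybT.
  by rewrite subrKA subrr powRr0.
have cc : c `^ (q - 1) * c = c `^ q by rewrite mulrC mulr_powRB1// ltW.
have -> : m `^ q = 2 `^ q * c `^ q.
  by rewrite -powRM ?(ltW c0)//; congr (_ `^ _); rewrite /c; field.
rewrite -mulrA ler_wpM2l ?powR_ge0// -cc -mulrA.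
have : c * v <= c `^ (1 - q) * fine I by move: h; rewrite /c; lra.
move=> /(ler_wpM2l (powR_ge0 c (q - 1))).
by rewrite [X in _ <= X -> _]mulrA cq mul1r.
Qed.

(** By [moment_le] the quotient (m v)^q / v^a is at most 2^q v^(-a-1) times the integral of f^q from
    0 to v. Tonelli on the triangle t < v, which [F] encodes, leaves the integral of v^(-a-1) over v
    > t, at most t^(-a) / a. *)
Lemma hardy_le (q a b : R) (f m : R -> R) : 1 < q -> 0 < a -> 0 < b ->
  measurable_fun setT f -> (forall t, 0 <= f t) -> (forall v, 0 <= m v) ->
  (forall v, 0 < v < b -> ((m v * v)%:E <= \int[mu]_(t in `]0%R, v[) (f t)%:E)%E) ->
  (\int[mu]_(v in `]0%R, b[) (m v `^ q / v `^ a)%:E <=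
   (2 `^ q / a)%:E * \int[mu]_(t in `]0%R, b[) (f t `^ q / t `^ a)%:E)%E.
Proof.
move=> q1 a0 b0 mf f0 m0 hm.
pose F (z : R * R) := if z.2 < z.1 then z.1 `^ (- a - 1) * f z.2 `^ q else 0.
have F0 z : (0 <= (F z)%:E)%E.
  by rewrite lee_fin /F; case: ifP => // _; rewrite mulr_ge0 ?powR_ge0.
have mF : measurable_fun setT (fun z => (F z)%:E).
  apply/measurable_EFinP; apply: measurable_fun_ifT => //.
    by apply: measurable_fun_ltr; [exact: measurable_snd|exact: measurable_fst].
  apply: measurable_funM; first exact: (measurable_powR_comp _ measurable_fst).
  apply: measurable_powR_comp; exact: (measurableT_comp mf measurable_snd).
have mfq : measurable_fun setT (fun t => (f t `^ q)%:E).
  by apply/measurable_EFinP; exact: measurable_powR_comp.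
have mI : measurable (`]0, b[%classic : set R) by exact: measurable_itv.
have C0 : 0 <= 2 `^ q by exact: powR_ge0.
apply: (@le_trans _ _ ((2 `^ q)%:E * \int[mu]_(v in `]0%R, b[) \int[mu]_(t in `]0%R, b[) (F (v, t))%:E)%E).
  rewrite -(ge0_integralZl_EFin mu mI _ _ C0); last 2 first.
  - by move=> v _; apply: integral_ge0.
  - by apply: measurable_funTS; apply: (@measurable_integral R _ R _ (fun z => (F z)%:E)).
  apply: le_integral_nomeas => v /=; first by move=> _; rewrite lee_fin divr_ge0 ?powR_ge0.
  rewrite in_itv/= => /andP[v0 vb].
  have vI : 0 < v < b by rewrite v0.
  have h := moment_le q1 v0 (m0 v) mf f0 (hm v vI).
  have va : 0 < v `^ (- a - 1) by exact: powR_gt0.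
  have -> : m v `^ q / v `^ a = v `^ (- a - 1) * (m v `^ q * v).
    rewrite mulrCA; congr (_ * _); rewrite -powRN.
    by rewrite -[X in _ = _ * X](powRr1 (ltW v0)) -powRD ?(gt_eqF v0) ?implybT// subrK.
  rewrite EFinM.
  apply: (@le_trans _ _ ((v `^ (- a - 1))%:E * ((2 `^ q)%:E * \int[mu]_(t in `]0%R, v[) (f t `^ q)%:E))%E).
    by apply: lee_wpmul2l => //; rewrite lee_fin ltW.
  rewrite muleCA; apply: lee_wpmul2l; first by rewrite lee_fin.
  have mJ : measurable (`]0, v[%classic : set R) by exact: measurable_itv.
  rewrite -(ge0_integralZl_EFin mu mJ _ (measurable_funTS mfq) (ltW va)); last first.
    by move=> t _; rewrite lee_fin powR_ge0.
  apply: (@le_trans _ _ (\int[mu]_(t in `]0%R, v[) (F (v, t))%:E)%E).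
    apply: le_integral_nomeas => t /=; first by rewrite mule_ge0 ?lee_fin ?powR_ge0.
    by rewrite in_itv/= => /andP[t0 tv]; rewrite -EFinM /F/= tv.
  apply: integral_sub_itv; [exact: lexx|exact: ltW| |].
    exact: (measurableT_comp mF (measurable_pair1 v)).
  by move=> t; exact: F0.
rewrite EFinM -muleA; apply: lee_wpmul2l; first by rewrite lee_fin.
rewrite (tonelli mI mI mF F0).
have mta : measurable_fun setT (fun t => (f t `^ q / t `^ a)%:E).
  apply/measurable_EFinP; apply: measurable_div; first exact: measurable_powR_comp.
  exact: measurable_powR.
have ai : 0 <= a^-1 by rewrite invr_ge0 ltW.
rewrite -(ge0_integralZl_EFin mu mI _ (measurable_funTS mta) ai); last first.
  by move=> t _; rewrite lee_fin divr_ge0 ?powR_ge0.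
apply: le_integral_nomeas => t /=; first by move=> _; exact: integral_ge0.
rewrite in_itv/= => /andP[t0 tb].
have mFt : measurable_fun setT (fun v : R => (F (v, t))%:E).
  exact: (measurableT_comp mF (measurable_pair2 t)).
rewrite (integral_itv_split (ltW t0) (ltW tb) mFt (fun v => F0 (v, t))).
rewrite integral0_eq ?add0e; last first.
  by move=> v /=; rewrite in_itv/= /F/= => /andP[_ vt]; rewrite ltNge (ltW vt).
apply: (@le_trans _ _ (\int[mu]_(v in `]t, b[) ((f t `^ q)%:E * (v `^ (- a - 1))%:E))%E).
  apply: le_integral_nomeas => v /=; first by move=> _; exact: F0.
  by rewrite in_itv/= => /andP[tv _]; rewrite /F/= tv -EFinM mulrC.
rewrite ge0_integralZl_EFin ?powR_ge0//; last 2 first.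
- by move=> v _; rewrite lee_fin powR_ge0.
- by apply: measurable_funTS; apply/measurable_EFinP; exact: measurable_powR.
rewrite -EFinM mulrCA EFinM; apply: lee_wpmul2l; first by rewrite lee_fin powR_ge0.
apply: (le_trans (integral_powR_leS _ _ t0)); first by lra.
rewrite lee_fin subrK opprK powRN mulrC; exact: lexx.
Qed.

(** The integral is split at w = v. Below, (v + w)^(-p) <= v^(-p) leaves the power q - p > -1,
    integrable at 0; above, (v + w)^(-p) <= w^(-p) leaves q - 2p < -1, integrable at infinity. Both
    parts scale as v^(q-2p+1). *)
Lemma kernel_integral_le (p q b v : R) : p < q + 1 -> q + 1 < 2 * p -> 0 < p -> 0 < v -> v < b ->
  (\int[mu]_(w in `]0%R, b[) (w `^ (q - p) * (v + w) `^ (- p))%:E <=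
   (((q - p + 1)^-1 + (2 * p - q - 1)^-1) * v `^ (q - 2 * p + 1))%:E)%E.
Proof.
move=> hp1 hp2 p0 v0 vb.
have mk : measurable_fun setT (fun w : R => (w `^ (q - p) * (v + w) `^ (- p))%:E).
  apply/measurable_EFinP; apply: measurable_funM; first exact: measurable_powR.
  by apply: measurable_powR_comp; exact: measurable_funD.
have k0 w : (0 <= (w `^ (q - p) * (v + w) `^ (- p))%:E)%E by rewrite lee_fin mulr_ge0 ?powR_ge0.
have mpow r : measurable_fun setT (fun w : R => (w `^ r)%:E).
  by apply/measurable_EFinP; exact: measurable_powR.
have pN (x y : R) : 0 < x -> x <= y -> y `^ (- p) <= x `^ (- p).
  move=> x0 xy; have y0 : 0 < y by exact: lt_le_trans xy.
  by rewrite !powRN lef_pV2 ?posrE ?powR_gt0// ge0_ler_powR ?nnegrE ?(ltW p0) ?(ltW x0) ?(ltW y0).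
rewrite (integral_itv_split (ltW v0) (ltW vb) mk k0) mulrDl EFinD; apply: leeD.
  apply: (@le_trans _ _ (\int[mu]_(w in `]0%R, v[) ((v `^ (- p))%:E * (w `^ (q - p))%:E))%E).
    apply: le_integral_nomeas => w /=; first by move=> _; exact: k0.
    rewrite in_itv/= => /andP[w0 wv]; rewrite -EFinM lee_fin mulrC ler_wpM2r ?powR_ge0//.
    by apply: pN => //; rewrite lerDl ltW.
  rewrite ge0_integralZl_EFin ?powR_ge0//; last 2 first.
  - by move=> w _; rewrite lee_fin powR_ge0.
  - by apply: measurable_funTS; exact: mpow.
  apply: (@le_trans _ _ ((v `^ (- p))%:E * (v `^ (q - p + 1) / (q - p + 1))%:E)%E).
    apply: lee_wpmul2l; first by rewrite lee_fin powR_ge0.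
    by apply: integral_powR_le0 => //; lra.
  rewrite -EFinM lee_fin mulrA -powRD ?(gt_eqF v0) ?implybT// mulrC.
  by rewrite (_ : - p + (q - p + 1) = q - 2 * p + 1)//; ring.
apply: (@le_trans _ _ (\int[mu]_(w in `]v, b[) (w `^ (q - 2 * p))%:E)%E).
  apply: le_integral_nomeas => w /=; first by move=> _; exact: k0.
  rewrite in_itv/= => /andP[vw wb]; rewrite lee_fin.
  have w0 : 0 < w by exact: lt_trans vw.
  rewrite (_ : q - 2 * p = q - p + - p); last by ring.
  rewrite [leRHS]powRD ?(gt_eqF w0) ?implybT// ler_wpM2l ?powR_ge0//.
  by apply: pN => //; rewrite lerDr ltW.
apply: (le_trans (integral_powR_leS _ _ v0)); first by lra.
rewrite lee_fin mulrC (_ : - (q - 2 * p + 1) = 2 * p - q - 1); last by ring.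
exact: lexx.
Qed.

(** The kernel is symmetric, so by Tonelli the terms with [g v] and [g w] have equal integrals.
    Integrating w out of the first multiplies v^(q-p) by v^(q-2p+1), and the product of the two
    powers is v^(-a) with a = 3p - 2q - 1. *)
Lemma symmetric_kernel_integral_le (p q b : R) (g : R -> R) :
  p < q + 1 -> q + 1 < 2 * p -> 0 < p -> 0 < b ->
  measurable_fun setT g -> (forall v, 0 <= g v) ->
  (\int[mu]_(v in `]0%R, b[) \int[mu]_(w in `]0%R, b[)
     (v `^ (q - p) * (w `^ (q - p) * (v + w) `^ (- p)) * (g v + g w))%:E <=
   (2 * ((q - p + 1)^-1 + (2 * p - q - 1)^-1))%:E *
     \int[mu]_(v in `]0%R, b[) (g v / v `^ (3 * p - 2 * q - 1))%:E)%E.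
Proof.
move=> hp1 hp2 p0 b0 mg g0.
set K := _ + _^-1.
have K0 : 0 <= K by rewrite addr_ge0// invr_ge0; lra.
pose k (z : R * R) := z.1 `^ (q - p) * (z.2 `^ (q - p) * (z.1 + z.2) `^ (- p)).
have k0 z : 0 <= k z by rewrite !mulr_ge0 ?powR_ge0.
have ksym v w : k (v, w) = k (w, v).
  by rewrite /k/= mulrCA (addrC v).
have mk : measurable_fun setT k.
  apply: measurable_funM; first exact: (measurable_powR_comp _ measurable_fst).
  apply: measurable_funM; first exact: (measurable_powR_comp _ measurable_snd).
  apply: measurable_powR_comp; apply: measurable_funD; [exact: measurable_fst|exact: measurable_snd].
have mI : measurable (`]0, b[%classic : set R) by exact: measurable_itv.
have mg1 : measurable_fun setT (fun z : R * R => (k z * g z.1)%:E).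
  apply/measurable_EFinP; apply: measurable_funM => //; exact: (measurableT_comp mg measurable_fst).
have mg2 : measurable_fun setT (fun z : R * R => (k z * g z.2)%:E).
  apply/measurable_EFinP; apply: measurable_funM => //; exact: (measurableT_comp mg measurable_snd).
have h1 z : (0 <= (k z * g z.1)%:E)%E by rewrite lee_fin mulr_ge0.
have h2 z : (0 <= (k z * g z.2)%:E)%E by rewrite lee_fin mulr_ge0.
pose I1 v := (\int[mu]_(w in `]0%R, b[) (k (v, w) * g v)%:E)%E.
pose I2 v := (\int[mu]_(w in `]0%R, b[) (k (v, w) * g w)%:E)%E.
have mI1 : measurable_fun setT I1 by exact: (measurable_integral mI mg1 h1).
have mI2 : measurable_fun setT I2 by exact: (measurable_integral mI mg2 h2).
have I10 v : (0 <= I1 v)%E by apply: integral_ge0 => w _; exact: (h1 (v, w)).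
have I20 v : (0 <= I2 v)%E by apply: integral_ge0 => w _; exact: (h2 (v, w)).
have split : (\int[mu]_(v in `]0%R, b[) \int[mu]_(w in `]0%R, b[)
     (v `^ (q - p) * (w `^ (q - p) * (v + w) `^ (- p)) * (g v + g w))%:E =
     \int[mu]_(v in `]0%R, b[) I1 v + \int[mu]_(v in `]0%R, b[) I2 v)%E.
  etransitivity; last exact: (ge0_integralD mu mI (fun v _ => I10 v) (measurable_funTS mI1)
    (fun v _ => I20 v) (measurable_funTS mI2)).
  apply: eq_integral => v _.
  etransitivity; last exact: (ge0_integralD mu mI (fun w _ => h1 (v, w))
    (measurable_funTS (measurableT_comp mg1 (measurable_pair1 v)))
    (fun w _ => h2 (v, w)) (measurable_funTS (measurableT_comp mg2 (measurable_pair1 v)))).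
  by apply: eq_integral => w _; rewrite -EFinD -mulrDr.
have I12 : (\int[mu]_(v in `]0%R, b[) I2 v = \int[mu]_(v in `]0%R, b[) I1 v)%E.
  etransitivity; first exact: (tonelli mI mI mg2 h2).
  by apply: eq_integral => w _; apply: eq_integral => v _ /=; rewrite ksym.
rewrite split I12.
have mgv : measurable_fun setT (fun v => (g v / v `^ (3 * p - 2 * q - 1))%:E).
  apply/measurable_EFinP; apply: measurable_div => //; exact: measurable_powR.
have I1le : (\int[mu]_(v in `]0%R, b[) I1 v <=
    K%:E * \int[mu]_(v in `]0%R, b[) (g v / v `^ (3 * p - 2 * q - 1))%:E)%E.
  rewrite -(ge0_integralZl_EFin mu mI _ (measurable_funTS mgv) K0); last first.
    by move=> v _; rewrite lee_fin divr_ge0 ?powR_ge0.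
  apply: le_integral_nomeas => v /=; first by move=> _; exact: I10.
  rewrite in_itv/= => /andP[v0 vb].
  have c0 : 0 <= v `^ (q - p) * g v by rewrite mulr_ge0 ?powR_ge0.
  have mkv : measurable_fun setT (fun w : R => (w `^ (q - p) * (v + w) `^ (- p))%:E).
    apply/measurable_EFinP; apply: measurable_funM; first exact: measurable_powR.
    by apply: measurable_powR_comp; exact: measurable_funD.
  have -> : I1 v = ((v `^ (q - p) * g v)%:E *
      \int[mu]_(w in `]0%R, b[) (w `^ (q - p) * (v + w) `^ (- p))%:E)%E.
    rewrite -(ge0_integralZl_EFin mu mI _ (measurable_funTS mkv) c0); last first.
      by move=> w _; rewrite lee_fin mulr_ge0 ?powR_ge0.
    by apply: eq_integral => w _; rewrite -EFinM /k/=; congr EFin; ring.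
  apply: (@le_trans _ _ ((v `^ (q - p) * g v)%:E * (K * v `^ (q - 2 * p + 1))%:E)%E).
    apply: lee_wpmul2l; first by rewrite lee_fin.
    exact: kernel_integral_le.
  rewrite -!EFinM lee_fin -powRN.
  rewrite (_ : - (3 * p - 2 * q - 1) = (q - p) + (q - 2 * p + 1)); last by ring.
  rewrite [X in _ <= K * (g v * X)]powRD ?(gt_eqF v0) ?implybT//.
  by rewrite le_eqVlt; apply/orP; left; apply/eqP; ring.
rewrite (_ : (2 * K)%:E = K%:E + K%:E)%E; last by rewrite -EFinD; congr EFin; ring.
rewrite ge0_muleDl ?lee_fin//; exact: leeD.
Qed.

End Hardy.

(** * Arcs and chords of an injective curve *)

Section Bilipschitz.
Set Implicit Arguments.
Unset Strict Implicit.
Context {R : realType}.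
Notation mu := (@lebesgue_measure R).

Lemma half_sum_le (s t e : R) : s <= e -> t <= e -> (s + t) / 2 <= e.
Proof. lra. Qed.

Lemma continuous_enorm_rV n : continuous (fun x : 'rV[R]_n => enorm x).
Proof.
have cd : continuous (fun y : 'rV[R]_n => dotp y y).
  apply: continuous_big; first exact: add_continuous.
  move=> i _ x; have ci : {for x, continuous (fun y : 'rV[R]_n => y ord0 i)} by exact: coord_continuous.
  exact: (continuousM ci ci).
move=> x; apply: (@continuous_comp _ _ _ (fun y : 'rV[R]_n => dotp y y) Num.sqrt); first exact: cd.
exact: sqrt_continuous.
Qed.

(** For v at most the scale d of uniform continuity, the tangent at u controls the chord and gives
    the factor 3/4. For u in [0, 1] and v in [d, 1/2], a compact set, the chord length attains its
    minimum; were it 0, injectivity would make v an integer strictly between 0 and 1. *)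
Lemma bilipschitz n (gamma : R -> 'rV[R]_n) :
  C1_circle gamma -> injective_circle gamma -> arclength_parametrized gamma ->
  exists2 c0 : R, 0 < c0 & forall u v, 0 < v <= 2^-1 -> c0 * v <= enorm (gamma (u + v) - gamma u).
Proof.
move=> hC hI hA.
have hc := C1_circle_curve hC.
have e0 : (0 : R) < 4^-1 by rewrite invr_gt0.
have [d d0 hd] := enorm_derive1_unif hC e0.
have near u v : 0 < v -> v <= d -> 3 / 4 * v <= enorm (gamma (u + v) - gamma u).
  move=> v0 vd.
  have uv : u <= u + v by rewrite lerDl ltW.
  have h : enorm (gamma (u + v) - gamma u - (u + v - u) *: derive1 gamma u) <= 4^-1 * (u + v - u).
    apply: (chord_tangent_le hc uv) => z /andP[uz zv]; apply: hd.
    by rewrite gtr0_norm ?subr_gt0// lerBlDl (le_trans (ltW zv))// lerD2l.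
  have := ler_enorm_sub (v *: derive1 gamma u) (gamma (u + v) - gamma u).
  rewrite (enorm_sub (_ *: _)) enormZ hA mulr1 gtr0_norm//.
  by move: h; rewrite (addrC u) addrK; lra.
have [dh|hd2] := leP 2^-1 d.
  exists (3 / 4); first by lra.
  by move=> u v /andP[v0 v1]; apply: near => //; exact: le_trans dh.
pose A : set (R * R) := `[0, 1]%classic `*` `[d, 2^-1]%classic.
pose f (z : R * R) := enorm (gamma (z.1 + z.2) - gamma z.1).
have cg : continuous gamma.
  by move=> x; apply: differentiable_continuous; apply/derivable1_diffP; case: hC.
have cf : continuous f.
  move=> z; apply: (@continuous_comp _ _ _ (fun z : R * R => gamma (z.1 + z.2) - gamma z.1) (fun x => enorm x)).
    apply: cvgB.
      apply: (@continuous_comp _ _ _ (fun z : R * R => z.1 + z.2) gamma); last exact: cg.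
      by apply: cvgD; [exact: cvg_fst|exact: cvg_snd].
    by apply: (@continuous_comp _ _ _ (fun z : R * R => z.1) gamma); [exact: cvg_fst|exact: cg].
  exact: continuous_enorm_rV.
have cA : compact A by apply: compact_setX; exact: segment_compact.
have A0 : A !=set0 by exists (0, d); split; rewrite /= in_itv/= ?lexx ?ler01 ?(ltW hd2).
have [z0 z0A hz0] := compact_EVT_min A0 cA (continuous_subspaceT cf).
have f0 : 0 < f z0.
  rewrite lt_def enorm_ge0 andbT; apply/eqP => fz.
  move: z0A; rewrite inE => -[_]; rewrite /= in_itv/= => /andP[dz z2].
  have /hI [k] : gamma (z0.1 + z0.2) = gamma z0.1.
    by apply/eqP; rewrite -subr_eq0; apply/eqP; exact: enorm_eq0.
  rewrite addrAC subrr add0r => zk.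
  have : (0 < k%:~R :> R) by rewrite -zk (lt_le_trans d0).
  have : (k%:~R < 1 :> R) by rewrite -zk (le_lt_trans z2)// invf_lt1// ltr1n.
  by rewrite ltr0z -[X in _ < X](_ : 1%:~R = 1)// ltr_int; case: k {zk} => [[|k]|k].
exists (Num.min (3 / 4) (f z0)); first by rewrite lt_min f0 andbT; lra.
move=> u v /andP[v0 v1].
have [vd|dv] := leP v d.
  apply: (le_trans _ (near u v v0 vd)); rewrite ler_wpM2r ?(ltW v0)//.
  by rewrite ge_min lexx.
pose k := Num.floor u.
have -> : enorm (gamma (u + v) - gamma u) = f (u - k%:~R, v).
  rewrite /f/= -(periodic_int (circle_periodic hC) u (- k)).
  by rewrite -(periodic_int (circle_periodic hC) (u + v) (- k)) mulrNz addrAC.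
apply: (@le_trans _ _ (f z0)).
  rewrite (@le_trans _ _ (Num.min (3 / 4) (f z0)))//; last by rewrite ge_min lexx orbT.
  rewrite ler_piMr//; first by rewrite le_min (ltW f0) andbT; lra.
  by rewrite (le_trans v1)// invf_le1// ler1n.
apply: hz0; rewrite inE; split; rewrite /= in_itv/= ?v1 ?(ltW dv)//.
by rewrite subr_ge0 floor_le/= lerBlDl ltW// -intrD1 floorD1_gt.
Qed.

End Bilipschitz.

Local Opaque enorm.

(** * Triangles whose longest side is opposite to the first vertex *)

Section LongestSide.
Set Implicit Arguments.
Unset Strict Implicit.
Context {R : realType} {n : nat}.
Implicit Types x y z : 'rV[R]_n.

(* [1 / R^(p,q)] restricted to the triangles whose longest side is opposite to
   the first vertex. *)
Definition inv_R_long (p q : R) x y z : R :=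
  if (enorm (y - x) <= enorm (y - z)) && (enorm (z - x) <= enorm (y - z))
  then inv_Rpq p q x y z else 0.

Lemma inv_R_long_ge0 p q x y z : 0 <= inv_R_long p q x y z.
Proof. by rewrite /inv_R_long; case: ifP => // _; exact: inv_Rpq_ge0. Qed.

(** Some side is the longest, and the term of the vertex opposite to it is the full integrand, by
    the symmetry of 1/R; the other two terms are nonnegative. *)
Lemma inv_Rpq_le_long p q x y z : inv_Rpq p q x y z <=
  inv_R_long p q x y z + inv_R_long p q y x z + inv_R_long p q z x y.
Proof.
have h1 := inv_R_long_ge0 p q x y z; have h2 := inv_R_long_ge0 p q y x z.
have h3 := inv_R_long_ge0 p q z x y.
have F0 := inv_Rpq_ge0 p q x y z.
rewrite /inv_R_long in h1 h2 h3 *.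
rewrite (inv_RpqC12 p q y x z) (inv_RpqC12 p q z x y) (inv_RpqC23 p q x z y) in h2 h3 *.
rewrite (enorm_sub x y) (enorm_sub z y) (enorm_sub x z) in h2 h3 *.
move: (enorm (y - x)) (enorm (y - z)) (enorm (z - x)) (inv_Rpq p q x y z) F0 h1 h2 h3.
move=> a b c F F0.
case: ifP => [_|/negbT n1] h1; case: ifP => [_|/negbT n2] h2; case: ifP => [_|/negbT n3] h3; try lra.
Qed.

(** Numerator: X/k and Y/l deviate from T by gv and gw, and |X/k| <= 1, so [wedge_norm_le] gives |X
    ^ Y| <= v w (gv + gw). Denominator: the longest side is at least the mean of the other two,
    hence at least c0 (v + w) / 2. The signs of [k] and [l] record on which side of the base point
    each vertex lies. *)
Lemma inv_R_long_le p q c0 (x y z T : 'rV[R]_n) (k l v w : R) :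
  0 < p -> 0 < q -> 0 < c0 -> 0 < v -> 0 < w -> `|k| = v -> `|l| = w ->
  c0 * v <= enorm (y - x) -> enorm (y - x) <= v -> c0 * w <= enorm (z - x) ->
  inv_R_long p q x y z <=
   2 `^ q * (c0 ^+ 3 / 2) `^ (- p) * (v `^ (q - p) * (w `^ (q - p) * (v + w) `^ (- p)) *
    ((enorm (y - x - k *: T) / v) `^ q + (enorm (z - x - l *: T) / w) `^ q)).
Proof.
move=> p0 q0 c00 v0 w0 kv lw Xl Xu Yl.
have G0 (X : 'rV[R]_n) (r : R) : 0 < r -> 0 <= (enorm X / r) `^ q by move=> _; exact: powR_ge0.
have rhs0 : 0 <= 2 `^ q * (c0 ^+ 3 / 2) `^ (- p) * (v `^ (q - p) * (w `^ (q - p) * (v + w) `^ (- p)) *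
    ((enorm (y - x - k *: T) / v) `^ q + (enorm (z - x - l *: T) / w) `^ q)).
  by rewrite !mulr_ge0 ?powR_ge0// addr_ge0 ?powR_ge0.
rewrite /inv_R_long; case: ifPn => [/andP[h1 h2]|_]; last exact: rhs0.
have kn : k != 0 by rewrite -normr_gt0 kv.
have ln : l != 0 by rewrite -normr_gt0 lw.
set X := y - x in Xl Xu h1 *; set Y := z - x in Yl h2 *.
have c30 : 0 < c0 ^+ 3 / 2 by rewrite divr_gt0// exprn_gt0.
set gv := enorm (X - k *: T) / v; set gw := enorm (Y - l *: T) / w.
have gv0 : 0 <= gv by rewrite divr_ge0 ?enorm_ge0// ltW.
have gw0 : 0 <= gw by rewrite divr_ge0 ?enorm_ge0// ltW.
have W : wedge_norm X Y <= v * w * (gv + gw).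
  have -> : X = k *: (k^-1 *: X) by rewrite scalerA divff// scale1r.
  have -> : Y = l *: (l^-1 *: Y) by rewrite scalerA divff// scale1r.
  rewrite wedge_normZ kv lw; apply: ler_wpM2l; first by rewrite mulr_ge0// ltW.
  have A1 : enorm (k^-1 *: X) <= 1.
    by rewrite enormZ normfV kv mulrC ler_pdivrMr// mul1r.
  have AT : enorm (k^-1 *: X - T) = gv.
    rewrite /gv -kv mulrC -normfV -enormZ; congr enorm.
    by rewrite [RHS]scalerBr scalerA mulVf// scale1r.
  have BT : enorm (T - l^-1 *: Y) = gw.
    rewrite (enorm_sub T) /gw -lw mulrC -normfV -enormZ; congr enorm.
    by rewrite [RHS]scalerBr scalerA mulVf// scale1r.
  apply: (le_trans (wedge_norm_le _ _)).
  apply: (@le_trans _ _ (enorm (k^-1 *: X - l^-1 *: Y))).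
    by rewrite ler_piMl ?enorm_ge0.
  by rewrite -AT -BT; exact: enorm_dist.
have X0 : 0 < enorm X by rewrite (lt_le_trans _ Xl)// mulr_gt0.
have Y0 : 0 < enorm Y by rewrite (lt_le_trans _ Yl)// mulr_gt0.
have Z : c0 * (v + w) / 2 <= enorm (y - z).
  by rewrite mulrDr; exact: half_sum_le (le_trans Xl h1) (le_trans Yl h2).
have D : c0 ^+ 3 / 2 * (v * w * (v + w)) <= enorm (y - z) * enorm X * enorm Y.
  apply: (@le_trans _ _ (c0 * (v + w) / 2 * (c0 * v) * (c0 * w))).
    by rewrite le_eqVlt; apply/orP; left; apply/eqP; ring.
  have cv : 0 <= c0 * v by rewrite mulr_ge0// ltW.
  have cw : 0 <= c0 * w by rewrite mulr_ge0// ltW.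
  have cz : 0 <= c0 * (v + w) / 2 by rewrite divr_ge0// mulr_ge0 ?addr_ge0// ltW.
  exact: (ler_pM (mulr_ge0 cz cv) cw (ler_pM cz cv Z Xl) Yl).
have D0 : 0 < c0 ^+ 3 / 2 * (v * w * (v + w)) by rewrite mulr_gt0// !mulr_gt0// addr_gt0.
rewrite /inv_Rpq -/X -/Y.
apply: (@le_trans _ _ ((v * w * (gv + gw)) `^ q / (c0 ^+ 3 / 2 * (v * w * (v + w))) `^ p)).
  apply: ler_pM; rewrite ?powR_ge0 ?invr_ge0 ?powR_ge0//.
    apply: ge0_ler_powR; rewrite ?nnegrE ?wedge_norm_ge0 ?(ltW q0)//.
    by rewrite !mulr_ge0 ?addr_ge0// ltW.
  have D1 := lt_le_trans D0 D.
  rewrite lef_pV2 ?posrE ?powR_gt0//.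
  by apply: ge0_ler_powR; rewrite ?nnegrE ?(ltW p0) ?(ltW D0) ?(ltW D1).
have vw0 : 0 <= v * w by rewrite mulr_ge0// ltW.
have vpw : 0 <= v + w by rewrite addr_ge0// ltW.
have gvw : 0 <= gv + gw by rewrite addr_ge0.
have N : (v * w * (gv + gw)) `^ q = v `^ q * w `^ q * (gv + gw) `^ q.
  by rewrite (powRM _ vw0 gvw) (powRM _ (ltW v0) (ltW w0)).
have M : ((c0 ^+ 3 / 2 * (v * w * (v + w))) `^ p)^-1 =
    (c0 ^+ 3 / 2) `^ (- p) * (v `^ (- p) * w `^ (- p) * (v + w) `^ (- p)).
  rewrite -powRN (powRM _ (ltW c30) (mulr_ge0 vw0 vpw)).
  by rewrite (powRM _ vw0 vpw) (powRM _ (ltW v0) (ltW w0)).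
have Dv : v `^ (q - p) = v `^ q * v `^ (- p) by rewrite powRD// (gt_eqF v0) implybT.
have Dw : w `^ (q - p) = w `^ q * w `^ (- p) by rewrite powRD// (gt_eqF w0) implybT.
rewrite N M Dv Dw.
apply: (@le_trans _ _ (v `^ q * w `^ q * (2 `^ q * (gv `^ q + gw `^ q)) *
    ((c0 ^+ 3 / 2) `^ (- p) * (v `^ (- p) * w `^ (- p) * (v + w) `^ (- p))))).
  apply: ler_wpM2r; first by rewrite !mulr_ge0 ?powR_ge0.
  apply: ler_wpM2l; first by rewrite mulr_ge0 ?powR_ge0.
  exact: powR_add_le (ltW q0) gv0 gw0.
by rewrite le_eqVlt; apply/orP; left; apply/eqP; ring.
Qed.

End LongestSide.

Local Opaque inv_Rpq inv_R_long.

(** * The tangent energy and its bound by the curvature *)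

Section Energies.
Set Implicit Arguments.
Unset Strict Implicit.
Context {R : realType}.
Notation mu := (@lebesgue_measure R).

(** The distance [v] is meant to be positive, and the side of [u] is carried by the sign [s], which
    is 1 or -1 in the estimates. *)
Definition tangent_kernel n (q a : R) (gamma : R -> 'rV[R]_n) (s u v : R) : R :=
  enorm (derive1 gamma (u + s * v) - derive1 gamma u) `^ q / v `^ a.

Definition tangent_energy n (q a : R) (gamma : R -> 'rV[R]_n) (s d : R) : \bar R :=
  (\int[mu]_(u in `]0%R, 1%R[) \int[mu]_(v in `]0%R, d[) (tangent_kernel q a gamma s u v)%:E)%E.

Section OneCurve.
Context {n : nat} (gamma : R -> 'rV[R]_n).
Context (hC : C1_circle gamma) (hA : arclength_parametrized gamma).
Notation dg := (derive1 gamma).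

Lemma tangent_kernel_ge0 q a s u v : 0 <= tangent_kernel q a gamma s u v.
Proof. by rewrite divr_ge0 ?powR_ge0. Qed.

Lemma measurable_signed_add s : measurable_fun setT (fun z : R * R => z.1 + s * z.2).
Proof. by apply: measurable_funD => //; apply: measurable_funM => //; exact: measurable_snd. Qed.

Lemma measurable_tangent_kernel q a s :
  measurable_fun setT (fun z : R * R => (tangent_kernel q a gamma s z.1 z.2)%:E).
Proof.
have mdg := (circle_measurable hC).2.
apply/measurable_EFinP; apply: measurable_div; last exact: (measurable_powR_comp a measurable_snd).
apply: measurable_powR_comp; apply: measurable_enorm; apply: measurable_vecB.
  exact: (measurable_vec_comp mdg (measurable_signed_add s)).
exact: (measurable_vec_comp mdg measurable_fst).
Qed.

Lemma tangent_kernel_periodic q a s u v :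
  tangent_kernel q a gamma s (u + 1) v = tangent_kernel q a gamma s u v.
Proof. by rewrite /tangent_kernel addrAC !(derive1_periodic hC). Qed.

(** For fixed v, translating u by v turns the pair (u - v, u) into (u, u + v), and a periodic
    integrand is unaffected by the translation. *)
Lemma tangent_energy_sym q a d : tangent_energy q a gamma (-1) d = tangent_energy q a gamma 1 d.
Proof.
have mk s := measurable_tangent_kernel q a s.
have k0 s z : (0 <= (tangent_kernel q a gamma s z.1 z.2)%:E)%E.
  by rewrite lee_fin tangent_kernel_ge0.
have mI : measurable (`]0, 1[%classic : set R) by [].
have mJ : measurable (`]0, d[%classic : set R) by [].
have T s := tonelli mI mJ (mk s) (k0 s).
etransitivity; first exact: (T (-1)).
etransitivity; last exact: (esym (T 1)).
apply: eq_integral => v _ /=.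
have kp u : (tangent_kernel q a gamma (-1) (u + 1) v)%:E = (tangent_kernel q a gamma (-1) u v)%:E.
  by rewrite tangent_kernel_periodic.
have mkv := measurableT_comp (mk (-1)) (measurable_pair2 v).
etransitivity; first exact: (esym (integral_period_translate v kp mkv (fun u => k0 (-1) (u, v)))).
apply: eq_integral => u _; rewrite /tangent_kernel /= mulN1r addrK mul1r.
exact: (congr1 (fun x => (x `^ q / v `^ a)%:E) (enorm_sub (dg u) (dg (u + v)))).
Qed.

Lemma tangent_kernelE q a s u v :
  tangent_kernel q a gamma s u v = enorm (dg (u + s * v) - dg u) `^ q / v `^ a.
Proof. by []. Qed.

Section Menger.
Context (p q : R).

Definition menger2 u1 u2 : \bar R :=
  (\int[mu]_(u3 in `]0%R, 1%R[) (inv_Rpq p q (gamma u1) (gamma u2) (gamma u3))%:E)%E.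

Definition menger1 u1 : \bar R := (\int[mu]_(u2 in `]0%R, 1%R[) menger2 u1 u2)%E.

Lemma measurable_menger3 : measurable_fun setT (fun z : R * R * R =>
  (inv_Rpq p q (gamma z.1.1) (gamma z.1.2) (gamma z.2))%:E).
Proof.
have mg := (circle_measurable hC).1.
have m1 : measurable_fun setT (fun z : R * R * R => z.1.1).
  exact: (measurableT_comp measurable_fst measurable_fst).
have m2 : measurable_fun setT (fun z : R * R * R => z.1.2).
  exact: (measurableT_comp measurable_snd measurable_fst).
apply/measurable_EFinP; apply: measurable_inv_Rpq.
- exact: (measurable_vec_comp mg m1).
- exact: (measurable_vec_comp mg m2).
- exact: (measurable_vec_comp mg measurable_snd).
Qed.

Lemma menger2_ge0 u1 u2 : (0 <= menger2 u1 u2)%E.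
Proof. by apply: integral_ge0 => u3 _; rewrite lee_fin inv_Rpq_ge0. Qed.

Lemma menger1_ge0 u1 : (0 <= menger1 u1)%E.
Proof. by apply: integral_ge0 => u2 _; exact: menger2_ge0. Qed.

Lemma measurable_menger2 : measurable_fun setT (fun z : R * R => menger2 z.1 z.2).
Proof.
apply: (@measurable_integral R _ (R * R)%type `]0, 1[%classic
  (fun z => (inv_Rpq p q (gamma z.1.1) (gamma z.1.2) (gamma z.2))%:E)) => //.
  exact: measurable_menger3.
by move=> z; rewrite lee_fin inv_Rpq_ge0.
Qed.

Lemma measurable_menger1 : measurable_fun setT menger1.
Proof.
apply: (@measurable_integral R _ R `]0, 1[%classic (fun z => menger2 z.1 z.2)) => //.
  exact: measurable_menger2.
by move=> z; exact: menger2_ge0.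
Qed.

Lemma menger2_periodic u1 u2 : menger2 u1 (u2 + 1) = menger2 u1 u2.
Proof. by rewrite /menger2 (circle_periodic hC). Qed.

Lemma measurable_menger2r u1 : measurable_fun setT (menger2 u1).
Proof. exact: (measurableT_comp measurable_menger2 (measurable_pair1 u1)). Qed.

Lemma measurable_menger3r u1 u2 :
  measurable_fun setT (fun u3 : R => (inv_Rpq p q (gamma u1) (gamma u2) (gamma u3))%:E).
Proof. exact: (measurableT_comp measurable_menger3 (measurable_pair1 (u1, u2))). Qed.

Lemma intM_menger : intM p q gamma = (\int[mu]_(u1 in `]0%R, 1%R[) menger1 u1)%E.
Proof.
have E1 : intM p q gamma = (\int[mu]_(u1 in `[0%R, 1%R]) menger1 u1)%E.
  apply: eq_integral => u1 _.
  transitivity (\int[mu]_(u2 in `[0%R, 1%R]) menger2 u1 u2)%E.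
    apply: eq_integral => u2 _.
    under eq_integral do rewrite !hA !mul1r.
    by apply: integral_itv_open; exact: measurable_menger3r.
  by apply: integral_itv_open; exact: measurable_menger2r.
etransitivity; first exact: E1.
by apply: integral_itv_open; exact: measurable_menger1.
Qed.

Lemma local_menger_le s u d : s = 1 \/ s = -1 -> 0 <= d <= 1 ->
  (\int[mu]_(v in `]0%R, d[) \int[mu]_(w in `]0%R, d[)
     (inv_Rpq p q (gamma u) (gamma (u + s * v)) (gamma (u + s * w)))%:E <= menger1 u)%E.
Proof.
move=> hs hd.
apply: (@le_trans _ _ (\int[mu]_(v in `]0%R, d[) menger2 u (u + s * v))%E).
  apply: le_integral_nomeas => v _.
    by apply: integral_ge0 => w _; rewrite lee_fin inv_Rpq_ge0.
  have per w : (inv_Rpq p q (gamma u) (gamma (u + s * v)) (gamma (w + 1)))%:E =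
      (inv_Rpq p q (gamma u) (gamma (u + s * v)) (gamma w))%:E.
    by rewrite (circle_periodic hC).
  have ge0 w : (0 <= (inv_Rpq p q (gamma u) (gamma (u + s * v)) (gamma w))%:E)%E.
    by rewrite lee_fin inv_Rpq_ge0.
  exact: (integral_period_signed u hs hd per (measurable_menger3r u (u + s * v)) ge0).
exact: (integral_period_signed u hs hd (menger2_periodic u) (measurable_menger2r u) (menger2_ge0 u)).
Qed.

End Menger.

End OneCurve.

Local Opaque tangent_kernel.

(* The deviation of the chord direction seen from the base point [u] is
   controlled by the triangles with vertex [u]; comparing the two ends of a
   chord gives the difference of tangents. *)
Lemma tangent_energy_le_intM (p q : R) : 1 < q -> 2 / 3 * q + 1 < p ->
  exists2 C : R, 0 < C & forall n (gamma : R -> 'rV[R]_n) (d : R),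
  C1_circle gamma -> arclength_parametrized gamma -> 0 < d -> d <= 1 ->
  (forall x y, `|x - y| <= d -> enorm (derive1 gamma x - derive1 gamma y) <= 4^-1) ->
  (tangent_energy q (3 * p - 2 * q - 1) gamma 1 d <= C%:E * intM p q gamma)%E.
Proof.
move=> q1 hp; have [C C0 hCc] := chord_dir_integral_le q1 hp.
set a := 3 * p - 2 * q - 1.
exists (2 `^ q * (C + C)); first by rewrite mulr_gt0 ?powR_gt0 ?addr_gt0.
move=> n gamma d hC hA d0 d1 hd.
have hc := C1_circle_curve hC.
have [mg mdg] := circle_measurable hC.
pose c s u v := gamma (u + s * v).
(* The term [s * 0] is kept because the tangent occurs here as the derivative at 0 of the
   reparametrized curve [c s u], the form in which [hCc] speaks of it. *)
pose E s u v := enorm (chord_dir (c s u) v - s *: derive1 gamma (u + s * 0)) `^ q / v `^ a.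
have E0 s u v : (0 <= (E s u v)%:E)%E by rewrite lee_fin divr_ge0 ?powR_ge0.
have mE s : measurable_fun setT (fun z : R * R => (E s z.1 z.2)%:E).
  have msa := measurable_signed_add s.
  have msa0 : measurable_fun setT (fun z : R * R => z.1 + s * 0).
    by apply: measurable_funD.
  have mX : measurable_vec (fun z : R * R => c s z.1 z.2 - c s z.1 0).
    apply: measurable_vecB; first exact: (measurable_vec_comp mg msa).
    exact: (measurable_vec_comp mg msa0).
  apply/measurable_EFinP; apply: measurable_div; last exact: (measurable_powR_comp a measurable_snd).
  apply: measurable_powR_comp; apply: measurable_enorm; apply: measurable_vecB.
    apply: measurable_vecZ => //.
    by apply: (measurableT_comp measurable_inv); exact: measurable_enorm.
  apply: measurable_vecZ => //; exact: (measurable_vec_comp mdg msa0).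
have mEi s : measurable_fun setT (fun u : R => \int[mu]_(v in `]0%R, d[) (E s u v)%:E)%E.
  exact: (@measurable_integral R _ R `]0, d[%classic (fun z => (E s z.1 z.2)%:E)).
have Eint s : s = 1 \/ s = -1 ->
    (\int[mu]_(u in `]0%R, 1%R[) \int[mu]_(v in `]0%R, d[) (E s u v)%:E <= C%:E * intM p q gamma)%E.
  move=> hs; have ns : `|s| = 1 by case: hs => ->; rewrite ?normrN normr1.
  rewrite (intM_menger hC hA) -ge0_integralZl_EFin//; last 3 first.
  - by move=> u _; exact: menger1_ge0.
  - by apply: measurable_funTS; exact: measurable_menger1.
  - exact: ltW.
  apply: le_integral_nomeas => [u _|u _]; first exact: integral_ge0.
  apply: (@le_trans _ _ (C%:E * (\int[mu]_(v in `]0%R, d[) \int[mu]_(w in `]0%R, d[)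
     (inv_Rpq p q (c s u 0) (c s u v) (c s u w))%:E))%E).
    apply: (hCc n (c s u) (fun v => s *: derive1 gamma (u + s * v)) d d0).
    - exact: C1_curve_affine.
    - by move=> x; rewrite enormZ ns mul1r hA.
    - move=> x /andP[x0 xd]; rewrite -scalerBr enormZ ns mul1r; apply: hd.
      by rewrite mulr0 addr0 addrC addKr normrM ns mul1r gtr0_norm// ltW.
    - move=> eps e0; have [r r0 hr] := enorm_derive1_continuous hC (u + s * 0) e0.
      exists r => // x /andP[x0 xr]; rewrite -scalerBr enormZ ns mul1r; apply: hr.
      by rewrite mulr0 addr0 opprD addrA subrr sub0r normrN normrM ns mul1r gtr0_norm.
  apply: lee_wpmul2l; first by rewrite lee_fin ltW.
  have c0 : c s u 0 = gamma u by rewrite /c mulr0 addr0.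
  have dI : 0 <= d <= 1 by rewrite (ltW d0).
  rewrite c0; exact: (local_menger_le hC p q u hs dI).
have Ep s u v : E s (u + 1) v = E s u v.
  rewrite /E /chord_dir /c !(addrAC u 1) !(circle_periodic hC) !(derive1_periodic hC).
  by [].
have mEs : measurable_fun setT (fun z : R * R => (E (-1) (z.1 + z.2) z.2)%:E).
  have mz : measurable_fun setT (fun z : R * R => (z.1 + z.2, z.2)).
    apply: measurable_fun_pair; last exact: measurable_snd.
    by apply: measurable_funD; [exact: measurable_fst|exact: measurable_snd].
  exact: (measurableT_comp (mE (-1)) mz).
have shift : (\int[mu]_(u in `]0%R, 1%R[) \int[mu]_(v in `]0%R, d[) (E (-1) (u + v) v)%:E =
    \int[mu]_(u in `]0%R, 1%R[) \int[mu]_(v in `]0%R, d[) (E (-1) u v)%:E)%E.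
  have mI : measurable (`]0, 1[%classic : set R) by [].
  have mJ : measurable (`]0, d[%classic : set R) by [].
  etransitivity; first exact: (tonelli mI mJ mEs (fun z => E0 (-1) (z.1 + z.2) z.2)).
  etransitivity; last exact: (esym (tonelli mI mJ (mE (-1)) (fun z => E0 (-1) z.1 z.2))).
  apply: eq_integral => v _ /=.
  have Epv u : (E (-1) (u + 1) v)%:E = (E (-1) u v)%:E by rewrite Ep.
  exact: (integral_period_translate v Epv (measurableT_comp (mE (-1)) (measurable_pair2 v))
    (fun u => E0 (-1) u v)).
have mEsi : measurable_fun setT (fun u : R => \int[mu]_(v in `]0%R, d[) (E (-1) (u + v) v)%:E)%E.
  exact: (@measurable_integral R _ R `]0, d[%classic (fun z => (E (-1) (z.1 + z.2) z.2)%:E)).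
have q0 : 0 < q by lra.
pose s1 u v := chord_dir (c 1 u) v; pose s2 u v := chord_dir (c (-1) (u + v)) v.
have pointwise u v : 0 < v < d ->
    tangent_kernel q a gamma 1 u v <= 2 `^ q * (E 1 u v + E (-1) (u + v) v).
  move=> /andP[v0 vd]; rewrite tangent_kernelE /E -mulrDl mulrA.
  apply: ler_wpM2r; first by rewrite invr_ge0 powR_ge0.
  apply: le_trans (powR_add_le (ltW q0) (enorm_ge0 _) (enorm_ge0 _)).
  apply: ge0_ler_powR; rewrite ?nnegrE; [exact: ltW|exact: enorm_ge0| |].
    by apply: addr_ge0; exact: enorm_ge0.
  (* Seen from its far end u + v and with reversed orientation, the same chord has the opposite
     direction. The reversed tangent also changes sign, so both tangents are compared with one and
     the same unit vector. *)
  have e1 : s1 u v = - s2 u v.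
    rewrite /s1 /s2 /chord_dir /c !mulr0 !mul1r !addr0 mulN1r addrK.
    by rewrite (enorm_sub (gamma u)) -scalerN opprB.
  rewrite -/(s1 u v) -/(s2 u v) mulr0 addr0 scale1r mulr0 addr0 scaleN1r opprK mul1r e1.
  apply: (le_trans (enorm_dist _ (- s2 u v) _)).
  by rewrite addrC lerD2l enorm_sub -opprD enormN.
clear s1 s2; clearbody E.
have E1le := Eint 1 (or_introl erefl).
have E2le := Eint (-1) (or_intror erefl).
rewrite /tangent_energy.
apply: (@le_trans _ _ (\int[mu]_(u in `]0%R, 1%R[) ((2 `^ q)%:E *
   (\int[mu]_(v in `]0%R, d[) (E 1 u v)%:E + \int[mu]_(v in `]0%R, d[) (E (-1) (u + v) v)%:E)))%E).
  apply: le_integral_nomeas => u _.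
    by apply: integral_ge0 => v _; rewrite lee_fin tangent_kernel_ge0.
  have m1 : measurable_fun `]0, d[ (fun v : R => (E 1 u v)%:E).
    apply: measurable_funTS; exact: (measurableT_comp (mE 1) (measurable_pair1 u)).
  have m2 : measurable_fun `]0, d[ (fun v : R => (E (-1) (u + v) v)%:E).
    apply: measurable_funTS; exact: (measurableT_comp mEs (measurable_pair1 u)).
  rewrite -ge0_integralD// -ge0_integralZl_EFin ?powR_ge0//; last 2 first.
  - by move=> v _; rewrite adde_ge0.
  - exact: emeasurable_funD.
  apply: le_integral_nomeas => v; first by rewrite lee_fin tangent_kernel_ge0.
  by rewrite /= in_itv/= => vI; rewrite -EFinD -EFinM lee_fin; exact: pointwise.
rewrite ge0_integralZl_EFin ?powR_ge0//; last 2 first.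
- by move=> u _; rewrite adde_ge0// integral_ge0.
- by apply: measurable_funTS; apply: emeasurable_funD; [exact: mEi|exact: mEsi].
rewrite ge0_integralD//; last 4 first.
- by move=> u _; apply: integral_ge0 => v _; exact: E0.
- by apply: measurable_funTS; exact: mEi.
- by move=> u _; apply: integral_ge0 => v _; exact: E0.
- by apply: measurable_funTS; exact: mEsi.
rewrite EFinM -muleA lee_wpmul2l ?lee_fin ?powR_ge0//.
have M0 : (0 <= intM p q gamma)%E.
  by rewrite (intM_menger hC hA); apply: integral_ge0 => u _; exact: menger1_ge0.
rewrite EFinD ge0_muleDl ?lee_fin ?(ltW C0)// shift.
exact: leeD.
Qed.

End Energies.

(** * The scale on which the tangent turns *)

Section TangentScale.
Set Implicit Arguments.
Unset Strict Implicit.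
Context {R : realType}.
Notation mu := (@lebesgue_measure R).

Lemma dotp_sub_unit_le n (x y z : 'rV[R]_n) : enorm z = 1 -> `|dotp (x - y) z| <= enorm (y - x).
Proof. by move=> z1; rewrite enorm_sub; exact: dotp_unit_le. Qed.

Section OneCurve.
Context {n : nat} (gamma : R -> 'rV[R]_n).
Context (hC : C1_circle gamma) (hA : arclength_parametrized gamma).
Notation dg := (derive1 gamma).

Lemma tangent_energy_signed q a s d : s = 1 \/ s = -1 ->
  tangent_energy q a gamma s d = tangent_energy q a gamma 1 d.
Proof. case=> ->; [reflexivity|exact: tangent_energy_sym]. Qed.

(** This is [mean_slope_le] for the component along [xi] of the tangent, the curve being run from
    [x0] in the direction [s]. There f x is compared with the earlier value f (x - v), so the kernel
    has the sign [- s]; the symmetry of the energy brings it back to 1. *)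
Lemma mean_slope_circle_le (q a k L r d s x0 : R) (xi : 'rV[R]_n) :
  1 < q -> 2 < a -> 0 < k -> 0 < r -> r <= d -> d <= 1 -> s = 1 \/ s = -1 -> enorm xi = 1 ->
  (tangent_energy q a gamma 1 d <= L%:E)%E ->
  `|dotp (gamma (x0 + s * r) - gamma x0) xi / r - s * dotp (dg x0) xi| <=
    k * (r `^ ((a - 2) / q) / ((a - 2) / q)) + k `^ (1 - q) * r `^ ((a - 2) / q) * L.
Proof.
move=> q1 a2 k0 r0 rd d1 hs xi1 hL.
have ns : `|s| = 1 by case: hs => ->; rewrite ?normrN normr1.
have [cf dpsi] := C1_curve_dotp xi (C1_curve_affine x0 s (C1_circle_curve hC)).
pose f x := dotp (s *: dg (x0 + s * x)) xi.
have mk := measurable_tangent_kernel hC q a (- s).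
have k00 z : (0 <= (tangent_kernel q a gamma (- s) z.1 z.2)%:E)%E.
  by rewrite lee_fin tangent_kernel_ge0.
have q0 : 0 < q by lra.
have fk x v : `|f x - f (x - v)| `^ q / v `^ a <= tangent_kernel q a gamma (- s) (x0 + s * x) v.
  rewrite tangent_kernelE; apply: ler_wpM2r; first by rewrite invr_ge0 powR_ge0.
  apply: ge0_ler_powR; rewrite ?nnegrE; [exact: ltW|exact: normr_ge0|exact: enorm_ge0|].
  rewrite /f -dotpBl -scalerBr dotpZl normrM ns mul1r.
  have -> : x0 + s * (x - v) = x0 + s * x + - s * v by ring.
  exact: dotp_sub_unit_le.
pose h u := (\int[mu]_(v in `]0%R, d[) (tangent_kernel q a gamma (- s) u v)%:E)%E.
have mh : measurable_fun setT h.
  exact: (@measurable_integral R _ R `]0, d[%classic (fun z => (tangent_kernel q a gamma (- s) z.1 z.2)%:E)).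
have h0 u : (0 <= h u)%E by apply: integral_ge0 => v _; exact: (k00 (u, v)).
have hp u : h (u + 1) = h u.
  by apply: eq_integral => v _; rewrite tangent_kernel_periodic.
have rI : 0 <= r <= 1 by rewrite (ltW r0) (le_trans rd).
have hL' : (\int[mu]_(x in `]0%R, r[) \int[mu]_(v in `]0%R, r[)
     (`|f x - f (x - v)| `^ q / v `^ a)%:E <= L%:E)%E.
  apply: (@le_trans _ _ (\int[mu]_(x in `]0%R, r[) h (x0 + s * x)%R)%E).
    apply: le_integral_nomeas => x _.
      by apply: integral_ge0 => v _; rewrite lee_fin divr_ge0 ?powR_ge0.
    apply: (@le_trans _ _ (\int[mu]_(v in `]0%R, r[) (tangent_kernel q a gamma (- s) (x0 + s * x) v)%:E)%E).
      apply: le_integral_nomeas => v _; first by rewrite lee_fin divr_ge0 ?powR_ge0.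
      by rewrite lee_fin; exact: fk.
    apply: integral_sub_itv; [exact: lexx|exact: rd| |].
      exact: (measurableT_comp mk (measurable_pair1 (x0 + s * x))).
    by move=> v; exact: (k00 (x0 + s * x, v)).
  apply: (le_trans (integral_period_signed x0 hs rI hp mh h0)).
  apply: le_trans hL; rewrite -(@tangent_energy_signed q a (- s) d); first exact: lexx.
  by case: hs => ->; [right|left]; rewrite ?opprK.
have := mean_slope_le q1 a2 r0 k0 cf dpsi hL'.
by rewrite /f !mulr0 !addr0 dotpZl -dotpBl.
Qed.

(** The tangent of a closed curve has mean 0. Distance 1/2 from the point 0 covers the whole circle,
    so otherwise the tangent would stay within 1/4 of one unit vector, and its mean could not
    vanish. *)
Lemma tangent_turns : ~ (forall x y, `|x - y| <= 2^-1 -> enorm (dg x - dg y) <= 4^-1).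
Proof.
move=> h.
have := @chord_tangent_le _ _ gamma dg (dg 0) 0 1 4^-1 (C1_circle_curve hC) ler01.
rewrite -[X in gamma X]add0r (circle_periodic hC) subrr sub0r enormN subr0 scale1r hA => hh.
suff : (1 <= 4^-1 * 1 :> R) by lra.
apply: hh => x /andP[x0 x1].
have [xl|xr] := leP x 2^-1; first by apply: h; rewrite subr0 gtr0_norm.
by rewrite -(derive1_periodic hC 0) add0r; apply: h; rewrite ltr0_norm; lra.
Qed.

(** Starting from a scale given by uniform continuity, d is doubled until the next doubling fails;
    by [tangent_turns] this happens, with d <= 1/2. Failure at 2d gives two points at most 2d apart
    whose tangents differ by more than 1/4, and on one side of their midpoint more than 1/8 remains
    over a distance at most d. *)
Lemma tangent_scale : exists d : R, [/\ 0 < d, d <= 1,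
  (forall x y, `|x - y| <= d -> enorm (dg x - dg y) <= 4^-1) &
  exists x r, [/\ 0 < r, r <= d & 8^-1 < enorm (dg x - dg (x + r))]].
Proof.
pose S (d : R) := forall x y, `|x - y| <= d -> enorm (dg x - dg y) <= 4^-1.
have Smono d d' : d <= d' -> S d' -> S d.
  by move=> dd h x y xy; apply: h; rewrite (le_trans xy).
have [d0 d00 Sd0] : exists2 d : R, 0 < d & S d.
  by apply: (enorm_derive1_unif hC); rewrite invr_gt0.
pose P (k : nat) := ~~ `[< S (d0 * 2 ^+ k) >].
have exP : exists k, P k.
  exists (Num.bound (2^-1 / d0)); apply/asboolPn => h; apply: tangent_turns.
  apply: (Smono _ _ _ h).
  rewrite mulrC -ler_pdivrMr//.
  rewrite (le_trans (ltW (archi_boundP _)))// ?divr_ge0 ?invr_ge0 ?(ltW d00)//.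
  by rewrite -natrX ler_nat ltnW// ltn_expl.
case: (ex_minnP exP) => -[|k] /asboolPn Pk kmin.
  by case: Pk; rewrite expr0 mulr1.
set d := d0 * 2 ^+ k.
have dp : 0 < d by rewrite mulr_gt0// exprn_gt0.
have Sd : S d.
  by apply/asboolP; apply: contraT => /kmin; rewrite ltnn.
have d2 : d <= 2^-1.
  rewrite leNgt; apply/negP => h; apply: tangent_turns; exact: Smono (ltW h) Sd.
exists d; split => //; first by lra.
have [x [y [xy hxy]]] : exists x y, x < y <= x + 2 * d /\ 4^-1 < enorm (dg x - dg y).
  apply: contrapT => hn; apply: Pk => x y xy.
  rewrite exprS mulrCA -/d in xy.
  rewrite leNgt; apply/negP => h; apply: hn.
  have [xly|yx|xey] := ltgtP x y.
  - exists x, y; split => //; move: xy; rewrite xly ltr0_norm ?subr_lt0//=; lra.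
  - exists y, x; split; last by rewrite enorm_sub.
    move: xy; rewrite yx gtr0_norm ?subr_gt0//=; lra.
  - by move: h; rewrite xey subrr enorm0; lra.
pose m := (x + y) / 2.
have xm : x + (m - x) = m by rewrite addrC subrK.
have my : m + (y - m) = y by rewrite addrC subrK.
have [m0 m1] : 0 < m - x /\ m - x <= d by rewrite /m; split; lra.
have [y0 y1] : 0 < y - m /\ y - m <= d by rewrite /m; split; lra.
have tot (b c : R) : b < c \/ c <= b by have [?|?] := ltP b c; [left|right].
have [h|h] := tot 8^-1 (enorm (dg x - dg m)).
  by exists x, (m - x); rewrite xm; split.
exists m, (y - m); rewrite my; split; [exact: y0|exact: y1|].
have aux (A B C : R) : 4^-1 < A -> B <= 8^-1 -> A <= B + C -> 8^-1 < C by clear; lra.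
exact: aux hxy h (enorm_dist (dg x) (dg m) (dg y)).
Qed.

End OneCurve.

(** The mean slope of the arc from x to x + r is compared with the tangents at both of its ends, in
    the direction [xi] of their difference. The slope itself cancels, so the turn is at most twice
    the Morrey bound [B]. *)
Lemma tangent_scale_lower (q a : R) : 1 < q -> 2 < a -> exists2 K : R, 0 < K &
  forall n (gamma : R -> 'rV[R]_n) (d L x r : R), C1_circle gamma ->
  arclength_parametrized gamma -> 0 < r -> r <= d -> d <= 1 ->
  8^-1 < enorm (derive1 gamma x - derive1 gamma (x + r)) ->
  (tangent_energy q a gamma 1 d <= L%:E)%E ->
  d `^ (- ((a - 2) / q)) <= K * L.
Proof.
move=> q1 a2.
set al := (a - 2) / q.
have al0 : 0 < al by rewrite divr_gt0//; lra.
(* This makes the first term of [B] at most 1/32. Since 1/8 < 2 B, the second term then exceeds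
   1/32, and this is the lower bound sought. *)
pose k := al / 32.
have k0 : 0 < k by rewrite divr_gt0.
exists (32 * k `^ (1 - q)); first by rewrite mulr_gt0// powR_gt0.
move=> n gamma d L x r hC hA r0 rd d1 hx hL.
have d0 : 0 < d by exact: lt_le_trans rd.
set D := derive1 gamma x - derive1 gamma (x + r).
have D0 : 0 < enorm D by apply: lt_trans hx.
pose xi := (enorm D)^-1 *: D.
have xi1 : enorm xi = 1 by rewrite enormZ gtr0_norm ?invr_gt0// mulVf// gt_eqF.
have Dxi : dotp D xi = enorm D.
  by rewrite dotpZr -enorm_sqr expr2 mulrA mulVf ?gt_eqF// mul1r.
have h1 := @mean_slope_circle_le n gamma hC q a k L r d 1 x xi q1 a2 k0 r0 rd d1 (or_introl erefl) xi1 hL.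
have h2 := @mean_slope_circle_le n gamma hC q a k L r d (-1) (x + r) xi q1 a2 k0 r0 rd d1 (or_intror erefl) xi1 hL.
pose B := k * (r `^ al / al) + k `^ (1 - q) * r `^ al * L.
pose m := dotp (gamma (x + r) - gamma x) xi / r.
move: h1 h2; rewrite -/al !mul1r !mulN1r addrK -/B -/m.
have -> : dotp (gamma x - gamma (x + r)) xi / r = - m.
  by rewrite /m -mulNr -dotpNl opprB.
rewrite !ler_norml => /andP[h1 _] /andP[h2 _].
have hD : enorm D <= 2 * B.
  have aux (m' u v b : R) : - b <= m' - u -> - b <= - m' - - v -> u - v <= 2 * b by clear; lra.
  have DD : dotp D xi = dotp (derive1 gamma x) xi - dotp (derive1 gamma (x + r)) xi by rewrite -dotpBl.
  rewrite -Dxi DD; exact: aux h1 h2.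
have L0 : 0 <= L.
  rewrite -lee_fin (le_trans _ hL)//; apply: integral_ge0 => u _; apply: integral_ge0 => v _.
  by rewrite lee_fin tangent_kernel_ge0.
have ral : r `^ al <= d `^ al by rewrite ge0_ler_powR ?nnegrE ?(ltW al0) ?(ltW r0) ?(ltW d0).
have dal : d `^ al <= 1.
  have := @ge0_ler_powR R al (ltW al0) d 1.
  by rewrite powR1 !nnegrE; apply; rewrite ?(ltW d0).
have B1 : k * (r `^ al / al) <= 32^-1.
  rewrite /k (_ : al / 32 * _ = r `^ al / 32); last by field; rewrite gt_eqF.
  move: ral dal; clear; lra.
have B2 : k `^ (1 - q) * r `^ al * L <= k `^ (1 - q) * d `^ al * L.
  by rewrite ler_wpM2r// ler_wpM2l ?powR_ge0.
have key : 32^-1 < k `^ (1 - q) * d `^ al * L.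
  have aux (A b1 b2 b3 : R) : 8^-1 < A -> A <= 2 * (b1 + b2) -> b1 <= 32^-1 -> b2 <= b3 -> 32^-1 < b3.
    by clear; lra.
  exact: aux hx hD B1 B2.
rewrite powRN -[leLHS]mul1r ler_pdivrMr ?powR_gt0//.
move: key; clear; lra.
Qed.

End TangentScale.

(** * From the curvature to the seminorm *)

Section Forward.
Set Implicit Arguments.
Unset Strict Implicit.
Context {R : realType}.
Notation mu := (@lebesgue_measure R).

Lemma le_poweR (x y : \bar R) (r : R) : 0 < r -> (0 <= x)%E -> (x <= y)%E ->
  (x `^ r <= y `^ r)%E.
Proof.
move=> r0 x0 xy; apply: gt0_ler_poweR => //; [exact: ltW|rewrite in_itv/= x0 leey//|rewrite in_itv/=].
by rewrite (le_trans x0 xy) leey.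
Qed.

Lemma enorm_unit_sub_le n (x y : 'rV[R]_n) : enorm x = 1 -> enorm y = 1 -> enorm (x - y) <= 2.
Proof. by move=> x1 y1; rewrite (le_trans (enormB _ _))// x1 y1. Qed.

Section OneCurve.
Context {n : nat} (gamma : R -> 'rV[R]_n).
Context (hC : C1_circle gamma) (hA : arclength_parametrized gamma).
Notation dg := (derive1 gamma).

Lemma tangent_energy_ge0 q a s d : (0 <= tangent_energy q a gamma s d)%E.
Proof.
by apply: integral_ge0 => u _; apply: integral_ge0 => v _; rewrite lee_fin tangent_kernel_ge0.
Qed.

Lemma slobodeckij_tangent_energy q s :
  slobodeckij s q gamma = ((tangent_energy q (1 + q * s) gamma 1 2^-1 +
    tangent_energy q (1 + q * s) gamma 1 2^-1) `^ q^-1)%E.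
Proof.
set a := 1 + q * s.
pose g u w := enorm (dg (u + w) - dg u) `^ q / `|w| `^ a.
have g0 u w : (0 <= (g u w)%:E)%E by rewrite lee_fin divr_ge0 ?powR_ge0.
have mdg := (circle_measurable hC).2.
have mg : measurable_fun setT (fun z : R * R => (g z.1 z.2)%:E).
  apply/measurable_EFinP; apply: measurable_div.
    apply: measurable_powR_comp; apply: measurable_enorm; apply: measurable_vecB.
      apply: (measurable_vec_comp mdg).
      by apply: measurable_funD; [exact: measurable_fst|exact: measurable_snd].
    exact: (measurable_vec_comp mdg measurable_fst).
  apply: measurable_powR_comp; exact: (measurableT_comp (@normr_measurable _ setT) measurable_snd).
have mgu u : measurable_fun setT (fun w : R => (g u w)%:E) := measurableT_comp mg (measurable_pair1 u).
have mgi : measurable_fun setT (fun u : R => \int[mu]_(w in `[(- 2^-1)%R, 2^-1%R]) (g u w)%:E)%E.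
  exact: (@measurable_integral R _ R `[(- 2^-1), 2^-1]%classic (fun z => (g z.1 z.2)%:E)).
have mk i : measurable_fun setT (fun z : R * R => (tangent_kernel q a gamma i z.1 z.2)%:E).
  exact: measurable_tangent_kernel.
have mki i : measurable_fun setT (fun u : R => \int[mu]_(v in `]0%R, 2^-1%R[) (tangent_kernel q a gamma i u v)%:E)%E.
  apply: (@measurable_integral R _ R `]0, 2^-1[%classic (fun z => (tangent_kernel q a gamma i z.1 z.2)%:E)) => //.
  by move=> z; rewrite lee_fin tangent_kernel_ge0.
have k0 i u v : (0 <= (tangent_kernel q a gamma i u v)%:E)%E by rewrite lee_fin tangent_kernel_ge0.
have inner u : (\int[mu]_(w in `[(- 2^-1)%R, 2^-1%R]) (g u w)%:E =
    \int[mu]_(v in `]0%R, 2^-1%R[) (tangent_kernel q a gamma 1 u v)%:E +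
    \int[mu]_(v in `]0%R, 2^-1%R[) (tangent_kernel q a gamma (-1) u v)%:E)%E.
  etransitivity; first exact: (integral_itv_open _ _ _ _ (mgu u)).
  have := integral_fold 0 (mgu u) (g0 u); rewrite sub0r add0r => ->.
  have mJ : measurable (`]0, 2^-1[%classic : set R) by exact: measurable_itv.
  have mku i : measurable_fun setT (fun v : R => (tangent_kernel q a gamma i u v)%:E).
    exact: (measurableT_comp (mk i) (measurable_pair1 u)).
  etransitivity; last exact: (ge0_integralD mu mJ (fun v _ => k0 1 u v) (measurable_funTS (mku 1))
    (fun v _ => k0 (-1) u v) (measurable_funTS (mku (-1)))).
  apply: eq_integral => v; rewrite inE/= in_itv/= => /andP[v0 _].
  by rewrite /g !tangent_kernelE add0r sub0r normrN (gtr0_norm v0) mul1r mulN1r.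
rewrite /slobodeckij; congr (_ `^ _)%E.
transitivity (\int[mu]_(u in `]0%R, 1%R[) \int[mu]_(w in `[(- 2^-1)%R, 2^-1%R]) (g u w)%:E)%E.
  exact: (integral_itv_open _ _ _ _ mgi).
have k0i i u : (0 <= \int[mu]_(v in `]0%R, 2^-1%R[) (tangent_kernel q a gamma i u v)%:E)%E.
  by apply: integral_ge0 => v _; exact: k0.
have mI : measurable (`]0, 1[%classic : set R) by exact: measurable_itv.
transitivity (tangent_energy q a gamma 1 2^-1 + tangent_energy q a gamma (-1) 2^-1)%E; last first.
  by rewrite (tangent_energy_sym hC).
etransitivity; last exact: (ge0_integralD mu mI (fun u _ => k0i 1 u) (measurable_funTS (mki 1))
    (fun u _ => k0i (-1) u) (measurable_funTS (mki (-1)))).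
by apply: eq_integral => u _; exact: inner.
Qed.

(** Unit tangents differ by at most 2, so for v >= d the kernel is at most 2^q d^(-a), on a range of
    length at most 1. *)
Lemma tangent_energy_half_le q a d : 0 < q -> 0 <= a -> 0 < d -> d <= 1 ->
  (tangent_energy q a gamma 1 2^-1 <=
   tangent_energy q a gamma 1 d + (2 `^ q * d `^ (- a))%:E)%E.
Proof.
move=> q0 a0 d0 d1.
have mk := measurable_tangent_kernel hC q a 1.
have k0 u v : (0 <= (tangent_kernel q a gamma 1 u v)%:E)%E by rewrite lee_fin tangent_kernel_ge0.
have mki : measurable_fun setT (fun u : R => \int[mu]_(v in `]0%R, d[) (tangent_kernel q a gamma 1 u v)%:E)%E.
  exact: (@measurable_integral R _ R `]0, d[%classic (fun z => (tangent_kernel q a gamma 1 z.1 z.2)%:E)).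
set c := 2 `^ q * d `^ (- a).
have c0 : 0 <= c by rewrite mulr_ge0 ?powR_ge0.
apply: (@le_trans _ _ (\int[mu]_(u in `]0%R, 1%R[)
  (\int[mu]_(v in `]0%R, d[) (tangent_kernel q a gamma 1 u v)%:E + c%:E))%E).
  apply: le_integral_nomeas => u _; first exact: integral_ge0.
  have mku : measurable_fun setT (fun v : R => (tangent_kernel q a gamma 1 u v)%:E).
    exact: (measurableT_comp mk (measurable_pair1 u)).
  (* Extending the range to 1 makes it possible to split at d even when d exceeds 1/2. *)
  apply: (@le_trans _ _ (\int[mu]_(v in `]0%R, 1%R[) (tangent_kernel q a gamma 1 u v)%:E)%E).
    by apply: integral_sub_itv => //; rewrite invf_le1// ler1n.
  rewrite (integral_itv_split (ltW d0) d1 mku (k0 u)); apply: leeD; first exact: lexx.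
  apply: (@le_trans _ _ (\int[mu]_(v in `]d, 1%R[) (cst c%:E v))%E).
    apply: le_integral_nomeas => v /=; first by move=> _; exact: k0.
    rewrite in_itv/= => /andP[dv _]; rewrite lee_fin tangent_kernelE.
    rewrite /c powRN; apply: ler_pM; rewrite ?powR_ge0 ?invr_ge0 ?powR_ge0//.
      apply: ge0_ler_powR; rewrite ?nnegrE; [exact: ltW|exact: enorm_ge0|by []|].
      exact: enorm_unit_sub_le.
    rewrite lef_pV2 ?posrE ?powR_gt0//; last exact: lt_trans dv.
    by apply: ge0_ler_powR; rewrite ?nnegrE ?(ltW d0) ?(ltW dv) ?(ltW (lt_trans d0 dv)).
  rewrite integral_cst//= lebesgue_measure_itv/= lte_fin.
  case: ifPn => _; last by rewrite mule0 lee_fin.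
  by rewrite -EFinB -EFinM lee_fin ler_piMr// gerBl ltW.
have mI : measurable (`]0, 1[%classic : set R) by exact: measurable_itv.
have k0i u : (0 <= \int[mu]_(v in `]0%R, d[) (tangent_kernel q a gamma 1 u v)%:E)%E.
  by apply: integral_ge0 => v _; exact: k0.
have cE0 (u : R) : (0 <= cst c%:E u)%E by rewrite lee_fin.
rewrite (ge0_integralD mu mI (fun u _ => k0i u) (measurable_funTS mki)
  (fun u _ => cE0 u) (measurable_cst _)).
apply: leeD; first exact: lexx.
rewrite integral_cst//= lebesgue_measure_itv/= lte_fin ltr01 sube0 mule1.
exact: lexx.
Qed.

Lemma enorm_gamma_sub_le u u0 : 0 <= u <= 1 -> enorm (gamma u - gamma u0) <= 1.
Proof.
move=> /andP[u0' u1].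
have lip x y : x <= y -> enorm (gamma y - gamma x) <= y - x.
  by apply: (chord_le_arc (C1_circle_curve hC)) => z; rewrite hA.
pose k := Num.floor u0.
rewrite -(periodic_int (circle_periodic hC) u0 (- k)) mulrNz.
have v0 : 0 <= u0 - k%:~R by rewrite subr_ge0 floor_le.
have v1 : u0 - k%:~R <= 1 by rewrite lerBlDl ltW// -intrD1 floorD1_gt.
have [uv|vu] := leP u (u0 - k%:~R).
  by rewrite enorm_sub (le_trans (lip _ _ uv))// lerBlDr (le_trans v1)// lerDl.
by rewrite (le_trans (lip _ _ (ltW vu)))// lerBlDr (le_trans u1)// lerDl.
Qed.

End OneCurve.

Lemma Lp_norm_le n (f : R -> 'rV[R]_n) q B : 0 < q -> 0 <= B ->
  (forall u, 0 <= u <= 1 -> enorm (f u) <= B) -> (Lp_norm q f <= B%:E)%E.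
Proof.
move=> q0 B0 fB.
have -> : B%:E = ((B `^ q)%:E `^ q^-1)%E.
  by rewrite poweR_EFin -powRrM divff ?gt_eqF// powRr1.
apply: le_poweR; first by rewrite invr_gt0.
  by apply: integral_ge0 => u _; rewrite lee_fin powR_ge0.
apply: (@le_trans _ _ (\int[mu]_(u in `[0%R, 1%R]) (cst (B `^ q)%:E u))%E).
  apply: le_integral_nomeas => u /=; first by rewrite lee_fin powR_ge0.
  rewrite in_itv/= => uI; rewrite lee_fin.
  by apply: ge0_ler_powR; rewrite ?nnegrE ?(ltW q0) ?enorm_ge0 ?fB.
rewrite integral_cst//= lebesgue_measure_itv/= lte_fin ltr01 sube0 mule1.
exact: lexx.
Qed.

(** The summands 1 + 1 stand for the two L^q norms in the full norm. Additive constants can be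
    absorbed because no curve has small curvature: d <= 1 and the lower bound for d give K C1 intM
    >= 1. *)
Lemma slobodeckij_le_intM (p q : R) : 1 < q -> 2 / 3 * q + 1 < p ->
  exists C beta : R, [/\ 0 < C, 0 < beta & forall n (gamma : R -> 'rV[R]_n),
  C1_circle gamma -> arclength_parametrized gamma -> (intM p q gamma < +oo)%E ->
  (1 + 1 + slobodeckij ((3 * p - 2 * q - 2) / q) q gamma <=
    C%:E * (intM p q gamma + intM p q gamma `^ beta))%E].
Proof.
move=> q1 hp.
have q0 : 0 < q by move: q1; clear; lra.
set a := 3 * p - 2 * q - 1.
have a2 : 2 < a by rewrite /a; move: hp; clear; lra.
have [C1 C10 hC1] := tangent_energy_le_intM q1 hp.
have [K K0 hK] := tangent_scale_lower q1 a2.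
set al := (a - 2) / q.
have al0 : 0 < al by rewrite divr_gt0// subr_gt0.
pose beta := a / al.
have beta0 : 0 < beta by rewrite divr_gt0// (lt_trans _ a2).
pose D := 2 `^ q * (K * C1) `^ beta.
have D0 : 0 <= D by rewrite mulr_ge0 ?powR_ge0.
(* The first summand pays for the additive constant 3, as 1 <= K C1 m; the other two pay for 2 Z,
   with Z = C1 m + D m^beta the bound for the energy up to 1/2. *)
exists (3 * (K * C1) + 2 * C1 + 2 * D), beta; split => //.
  have KC : 0 < K * C1 by rewrite mulr_gt0.
  by move: KC C10 D0; clear; lra.
move=> n gamma hC hA Mfin.
have M0 : (0 <= intM p q gamma)%E.
  by rewrite (intM_menger hC hA); apply: integral_ge0 => u _; exact: menger1_ge0.
have Mf : intM p q gamma \is a fin_num by rewrite ge0_fin_numE.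
pose m := fine (intM p q gamma).
have Mm : intM p q gamma = m%:E by rewrite fineK.
have m0 : 0 <= m by exact: fine_ge0.
have [d [d0 d1 hd [x [r [r0 rd hxr]]]]] := tangent_scale hC hA.
have hE := hC1 n gamma d hC hA d0 d1 hd.
rewrite Mm -EFinM in hE.
have hX := hK n gamma d (C1 * m) x r hC hA r0 rd d1 hxr hE.
rewrite -/al mulrA in hX.
have X1 : 1 <= d `^ (- al).
  rewrite powRN invf_ge1 ?powR_gt0//.
  have := @ge0_ler_powR R al (ltW al0) d 1.
  by rewrite powR1 !nnegrE; apply; rewrite ?(ltW d0).
have KCm1 : 1 <= K * C1 * m by exact: le_trans hX.
have da : 2 `^ q * d `^ (- a) <= D * m `^ beta.
  rewrite /D -mulrA; apply: ler_wpM2l; first exact: powR_ge0.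
  rewrite -powRM ?mulr_ge0 ?(ltW K0) ?(ltW C10)//.
  have -> : d `^ (- a) = (d `^ (- al)) `^ beta.
    rewrite -powRrM /beta; congr (_ `^ _); field; by rewrite gt_eqF.
  by apply: ge0_ler_powR; rewrite ?nnegrE ?powR_ge0 ?(ltW beta0)// mulr_ge0// mulr_ge0 ?ltW.
pose Z := C1 * m + D * m `^ beta.
have Z0 : 0 <= Z by rewrite addr_ge0// mulr_ge0 ?powR_ge0 ?(ltW C10).
have half : (tangent_energy q a gamma 1 2^-1 <= Z%:E)%E.
  have a0 : 0 <= a by exact: (ltW (lt_trans _ a2)).
  apply: (le_trans (tangent_energy_half_le hC hA q0 a0 d0 d1)).
  by rewrite /Z EFinD; apply: leeD; [exact: hE|rewrite lee_fin].
have slob : (slobodeckij ((3 * p - 2 * q - 2) / q) q gamma <= (1 + (Z + Z))%:E)%E.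
  rewrite (slobodeckij_tangent_energy hC).
  have -> : 1 + q * ((3 * p - 2 * q - 2) / q) = a.
    by rewrite /a; field; rewrite gt_eqF.
  apply: (@le_trans _ _ ((Z + Z)%:E `^ q^-1)%E).
    apply: le_poweR; first by rewrite invr_gt0.
      by apply: adde_ge0; exact: tangent_energy_ge0.
    by rewrite EFinD; exact: leeD.
  rewrite poweR_EFin lee_fin.
  (* Since 1/q < 1, a nonnegative number y satisfies y^(1/q) <= 1 + y, whichever side of 1 it lies
     on. This removes the root. *)
  have [Z1|Z1] := leP (Z + Z) 1.
    rewrite (@le_trans _ _ (1 `^ q^-1))//; last by rewrite powR1 lerDl addr_ge0.
    apply: ge0_ler_powR; rewrite ?nnegrE; [|exact: addr_ge0|exact: ler01|exact: Z1].
    by rewrite invr_ge0 ltW.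
  apply: (@le_trans _ _ (Z + Z)); last by rewrite lerDr.
  by rewrite ler1_powR ?(ltW Z1)// invf_le1// ltW.
apply: (@le_trans _ _ (3 + (Z + Z))%:E).
  rewrite (_ : (3 + (Z + Z))%:E = 1%:E + 1%:E + (1 + (Z + Z))%:E)%E; last first.
    by rewrite -!EFinD; congr EFin; ring.
  by apply: leeD.
rewrite Mm poweR_EFin -EFinD -EFinM lee_fin /Z.
have mb : 0 <= m `^ beta by exact: powR_ge0.
have KC : 0 <= K * C1 * m `^ beta by rewrite !mulr_ge0 ?(ltW K0) ?(ltW C10).
have CB : 0 <= C1 * m `^ beta by rewrite mulr_ge0 ?(ltW C10).
have DM : 0 <= D * m by rewrite mulr_ge0.
move: KCm1 KC CB DM; clear.
move: (m `^ beta) => b; move: (K * C1) => k; lra.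
Qed.

End Forward.

(** * Permuting the variables of a triple integral *)

Section TripleIntegral.
Set Implicit Arguments.
Unset Strict Implicit.
Context {R : realType}.
Notation mu := (@lebesgue_measure R).
Variable D : set R.
Hypothesis mD : measurable D.
Implicit Types f g h : R -> R -> R -> \bar R.

Definition measurable3 f := measurable_fun setT (fun z : R * R * R => f z.1.1 z.1.2 z.2).

Definition integral3 f : \bar R :=
  (\int[mu]_(x in D) \int[mu]_(y in D) \int[mu]_(z in D) f x y z)%E.

Lemma measurable3_inner f : measurable3 f -> (forall x y z, 0 <= f x y z)%E ->
  measurable_fun setT (fun w : R * R => \int[mu]_(z in D) f w.1 w.2 z)%E.
Proof.
move=> mf f0.
exact: (@measurable_integral R _ (R * R)%type D (fun z => f z.1.1 z.1.2 z.2) mD mf).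
Qed.

Lemma measurable3_middle f : measurable3 f -> (forall x y z, 0 <= f x y z)%E ->
  measurable_fun setT (fun x : R => \int[mu]_(y in D) \int[mu]_(z in D) f x y z)%E.
Proof.
move=> mf f0.
apply: (@measurable_integral R _ R D (fun w => \int[mu]_(z in D) f w.1 w.2 z)%E mD).
  exact: measurable3_inner.
by move=> w; exact: integral_ge0.
Qed.

Lemma integral3D f g : measurable3 f -> measurable3 g ->
  (forall x y z, 0 <= f x y z)%E -> (forall x y z, 0 <= g x y z)%E ->
  integral3 (fun x y z => f x y z + g x y z)%E = (integral3 f + integral3 g)%E.
Proof.
move=> mf mg f0 g0.
have i20 h x y : (forall x y z, 0 <= h x y z)%E -> (0 <= \int[mu]_(z in D) h x y z)%E.
  by move=> h0; exact: integral_ge0.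
have i10 h x : (forall x y z, 0 <= h x y z)%E -> (0 <= \int[mu]_(y in D) \int[mu]_(z in D) h x y z)%E.
  by move=> h0; apply: integral_ge0 => y _; exact: i20.
etransitivity; last exact: (ge0_integralD mu mD (fun x _ => i10 f x f0)
  (measurable_funTS (measurable3_middle mf f0)) (fun x _ => i10 g x g0)
  (measurable_funTS (measurable3_middle mg g0))).
apply: eq_integral => x _.
etransitivity; last exact: (ge0_integralD mu mD (fun y _ => i20 f x y f0)
  (measurable_funTS (measurableT_comp (measurable3_inner mf f0) (measurable_pair1 x)))
  (fun y _ => i20 g x y g0)
  (measurable_funTS (measurableT_comp (measurable3_inner mg g0) (measurable_pair1 x)))).
apply: eq_integral => y _.
exact: (ge0_integralD mu mD (fun z _ => f0 x y z)
  (measurable_funTS (measurableT_comp mf (measurable_pair1 (x, y))))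
  (fun z _ => g0 x y z)
  (measurable_funTS (measurableT_comp mg (measurable_pair1 (x, y))))).
Qed.

Lemma integral3_swap f : measurable3 f -> (forall x y z, 0 <= f x y z)%E ->
  integral3 (fun x y z => f y x z) = integral3 f.
Proof.
move=> mf f0.
have i0 (w : R * R) : (0 <= \int[mu]_(z in D) f w.1 w.2 z)%E by exact: integral_ge0.
exact: (esym (tonelli mD mD (measurable3_inner mf f0) i0)).
Qed.

Lemma measurable3_swap f : measurable3 f -> measurable3 (fun x y z => f y x z).
Proof.
move=> mf.
have mp : measurable_fun setT (fun z : R * R * R => (z.1.2, z.1.1, z.2)).
  apply: measurable_fun_pair; last exact: measurable_snd.
  apply: measurable_fun_pair; apply: (measurableT_comp _ measurable_fst).
    exact: measurable_snd.
  exact: measurable_fst.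
exact: (measurableT_comp mf mp).
Qed.

Lemma measurable3_rotate f : measurable3 f -> measurable3 (fun x y z => f z x y).
Proof.
move=> mf.
have mp : measurable_fun setT (fun z : R * R * R => (z.2, z.1.1, z.1.2)).
  apply: measurable_fun_pair; last exact: (measurableT_comp measurable_snd measurable_fst).
  apply: measurable_fun_pair; first exact: measurable_snd.
  exact: (measurableT_comp measurable_fst measurable_fst).
exact: (measurableT_comp mf mp).
Qed.

Lemma integral3_rotate f : measurable3 f -> (forall x y z, 0 <= f x y z)%E ->
  integral3 (fun x y z => f z x y) = integral3 f.
Proof.
move=> mf f0.
etransitivity; last exact: (integral3_swap mf f0).
apply: eq_integral => x _.
have mp : measurable_fun setT (fun w : R * R => (w.2, x, w.1)).
  apply: measurable_fun_pair; last exact: measurable_fst.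
  by apply: measurable_fun_pair; [exact: measurable_snd|exact: measurable_cst].
exact: (tonelli mD mD (measurableT_comp mf mp) (fun w => f0 w.2 x w.1)).
Qed.

End TripleIntegral.

(** * From the seminorm to finite curvature *)

Section LongTriangles.
Set Implicit Arguments.
Unset Strict Implicit.
Context {R : realType}.
Notation mu := (@lebesgue_measure R).
Context {n : nat} (gamma : R -> 'rV[R]_n).
Context (hC : C1_circle gamma) (hA : arclength_parametrized gamma).
Variables p q : R.
Notation dg := (derive1 gamma).

Definition menger_long (x y z : R) : \bar R :=
  (inv_R_long p q (gamma x) (gamma y) (gamma z))%:E.

Lemma menger_long_ge0 x y z : (0 <= menger_long x y z)%E.
Proof. by rewrite lee_fin inv_R_long_ge0. Qed.

Lemma measurable_menger_long : measurable3 menger_long.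
Proof.
have mg := (circle_measurable hC).1.
have m1 : measurable_fun setT (fun z : R * R * R => z.1.1).
  exact: (measurableT_comp measurable_fst measurable_fst).
have m2 : measurable_fun setT (fun z : R * R * R => z.1.2).
  exact: (measurableT_comp measurable_snd measurable_fst).
have g1 := measurable_vec_comp mg m1.
have g2 := measurable_vec_comp mg m2.
have g3 : measurable_vec (fun z : R * R * R => gamma z.2).
  exact: (measurable_vec_comp mg measurable_snd).
apply/measurable_EFinP; apply: measurable_fun_ifT.
- apply: measurable_and; apply: measurable_fun_ler; apply: measurable_enorm; exact: measurable_vecB.
- exact: measurable_inv_Rpq.
- exact: measurable_cst.
Qed.

(** The three cases for the longest side differ by a permutation of the variables, under which the
    triple integral is invariant. *)
Lemma intM_le_long : (intM p q gamma <= integral3 `]0%R, 1%R[ menger_long +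
  integral3 `]0%R, 1%R[ menger_long + integral3 `]0%R, 1%R[ menger_long)%E.
Proof.
have mI : measurable (`]0, 1[%classic : set R) by exact: measurable_itv.
have m := measurable_menger_long.
have h0 := menger_long_ge0.
rewrite (intM_menger hC hA).
rewrite -[X in (_ <= _ + X)%E](integral3_rotate mI m h0) -[X in (_ <= _ + X + _)%E](integral3_swap mI m h0).
rewrite -(integral3D mI m (measurable3_swap m) h0 (fun x y z => h0 y x z)).
rewrite -(integral3D mI (emeasurable_funD m (measurable3_swap m)) (measurable3_rotate m)); last 2 first.
- by move=> x y z; exact: (adde_ge0 (h0 x y z) (h0 y x z)).
- by move=> x y z; exact: h0.
apply: le_integral_nomeas => x _; first exact: menger1_ge0.
apply: le_integral_nomeas => y _; first exact: menger2_ge0.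
apply: le_integral_nomeas => z _; first by rewrite lee_fin inv_Rpq_ge0.
by rewrite -!EFinD lee_fin; exact: inv_Rpq_le_long.
Qed.

End LongTriangles.

Section DoublePeriodFold.
Set Implicit Arguments.
Unset Strict Implicit.
Context {R : realType}.
Notation mu := (@lebesgue_measure R).

(** Folding each variable about u gives four sign patterns for each pair of distances (v, w), all
    with the same bound [B v w]. *)
Lemma integral2_period_fold_le (u : R) (h : R * R -> \bar R) (B : R -> R -> R) :
  measurable_fun setT h -> (forall z, 0 <= h z)%E ->
  (forall x y, h (x + 1, y) = h (x, y)) -> (forall x y, h (x, y + 1) = h (x, y)) ->
  (forall s t v w : R, s = 1 \/ s = -1 -> t = 1 \/ t = -1 -> 0 < v < 2^-1 -> 0 < w < 2^-1 ->
    (h ((u + s * v)%R, (u + t * w)%R) <= (B v w)%:E)%E) ->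
  (\int[mu]_(x in `]0%R, 1%R[) \int[mu]_(y in `]0%R, 1%R[) h (x, y) <=
   \int[mu]_(v in `]0%R, 2^-1%R[) \int[mu]_(w in `]0%R, 2^-1%R[) (4 * B v w)%:E)%E.
Proof.
move=> mh h0 hx hy hB.
have mI : measurable (`]0, 1[%classic : set R) by exact: measurable_itv.
have mJ : measurable (`]0, 2^-1[%classic : set R) by exact: measurable_itv.
pose P x := (\int[mu]_(y in `]0%R, 1%R[) h (x, y))%E.
have mP : measurable_fun setT P by exact: (measurable_integral mI mh h0).
have P0 x : (0 <= P x)%E by apply: integral_ge0 => y _; exact: h0.
have Pp x : P (x + 1) = P x by apply: eq_integral => y _; exact: hx.
have mhr x : measurable_fun setT (fun y : R => h (x, y)).
  exact: (measurableT_comp mh (measurable_pair1 x)).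
have mD : measurable_fun setT (fun w : R => u + w) by exact: measurable_funD.
have mN : measurable_fun setT (fun w : R => u - w) by exact: measurable_funB.
have PE x : P x = (\int[mu]_(w in `]0%R, 2^-1%R[) (h (x, (u + w)%R) + h (x, (u - w)%R)))%E.
  exact: (integral_period_fold u (hy x) (mhr x) (fun y => h0 (x, y))).
have mhw x : measurable_fun setT (fun w : R => (h (x, (u + w)%R) + h (x, (u - w)%R))%E).
  apply: emeasurable_funD; first exact: (measurableT_comp (mhr x) mD).
  exact: (measurableT_comp (mhr x) mN).
have h00 x (w : R) : (0 <= h (x, (u + w)%R) + h (x, (u - w)%R))%E.
  exact: (adde_ge0 (h0 (x, _)) (h0 (x, _))).
have E := integral_period_fold u Pp mP P0.
apply: (@le_trans _ _ (\int[mu]_(v in `]0%R, 2^-1%R[) (P (u + v)%R + P (u - v)%R))%E).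
  by rewrite -E lexx.
apply: le_integral_nomeas => v /=; first by move=> _; exact: (adde_ge0 (P0 _) (P0 _)).
rewrite in_itv/= => vI.
rewrite !PE -(ge0_integralD mu mJ (fun w _ => h00 _ w) (measurable_funTS (mhw _))
  (fun w _ => h00 _ w) (measurable_funTS (mhw _))).
apply: le_integral_nomeas => w /=; first by move=> _; exact: (adde_ge0 (h00 _ _) (h00 _ _)).
rewrite in_itv/= => wI.
have p1 : (1 : R) = 1 \/ (1 : R) = -1 by left.
have n1 : (-1 : R) = 1 \/ (-1 : R) = -1 by right.
rewrite (_ : 4 * B v w = (B v w + B v w) + (B v w + B v w)); last by ring.
have b1 := hB 1 1 v w p1 p1 vI wI; have b2 := hB 1 (-1) v w p1 n1 vI wI.
have b3 := hB (-1) 1 v w n1 p1 vI wI; have b4 := hB (-1) (-1) v w n1 n1 vI wI.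
rewrite !mul1r !mulN1r in b1 b2 b3 b4.
rewrite EFinD [in leRHS]EFinD; exact: (leeD (leeD b1 b2) (leeD b3 b4)).
Qed.

End DoublePeriodFold.

Section LongTrianglesBound.
Set Implicit Arguments.
Unset Strict Implicit.
Context {R : realType}.
Notation mu := (@lebesgue_measure R).
Context {n : nat} (gamma : R -> 'rV[R]_n).
Context (hC : C1_circle gamma) (hA : arclength_parametrized gamma).
Notation dg := (derive1 gamma).

Definition chord_gap (s u v : R) : R :=
  enorm (gamma (u + s * v) - gamma u - (s * v) *: dg u) / v.

Lemma measurable_chord_gap s u : measurable_fun setT (chord_gap s u).
Proof.
have msv : measurable_fun setT (fun v : R => s * v) by exact: measurable_funM.
have mu' : measurable_fun setT (fun v : R => u + s * v) by exact: measurable_funD.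
apply: measurable_div; last exact: measurable_id.
apply: measurable_enorm; apply: measurable_vecB.
  apply: measurable_vecB; last exact: measurable_vec_cst.
  exact: (measurable_vec_comp (circle_measurable hC).1 mu').
by apply: measurable_vecZ => //; exact: measurable_vec_cst.
Qed.

Lemma chord_gap_hardy q a s u : 1 < q -> 0 < a -> s = 1 \/ s = -1 ->
  (\int[mu]_(v in `]0%R, 2^-1%R[) (chord_gap s u v `^ q / v `^ a)%:E <=
   (2 `^ q / a)%:E * \int[mu]_(v in `]0%R, 2^-1%R[) (tangent_kernel q a gamma s u v)%:E)%E.
Proof.
move=> q1 a0 hs.
have ns : `|s| = 1 by case: hs => ->; rewrite ?normrN normr1.
have hc := C1_curve_affine u s (C1_circle_curve hC).
have mdg := (C1_curve_measurable hc).2.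
pose f v := enorm (s *: dg (u + s * v) - s *: dg u).
have fE v : f v = enorm (dg (u + s * v) - dg u).
  by rewrite /f -scalerBr enormZ ns mul1r.
have mf : measurable_fun setT f.
  exact: (measurable_enorm (measurable_vecB mdg (measurable_vec_cst (s *: dg u)))).
(* [hardy_le] wants a function that is nonnegative on the whole line, whereas [chord_gap] divides by
   v and is not positive for v < 0. *)
pose m v := if 0 <= v then chord_gap s u v else 0.
have m0 v : 0 <= m v.
  by rewrite /m; case: ifP => // v0; rewrite divr_ge0 ?enorm_ge0.
have h2 : (0 : R) < 2^-1 by rewrite invr_gt0.
have hm v : 0 < v < 2^-1 -> ((m v * v)%:E <= \int[mu]_(t in `]0%R, v[) (f t)%:E)%E.
  move=> /andP[v0 _]; rewrite /m (ltW v0) /chord_gap divfK ?gt_eqF//.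
  have := @chord_tangent_integral_le R n _ _ (s *: dg u) 0 v hc v0.
  by rewrite mulr0 addr0 subr0 scalerA (mulrC v).
have H := hardy_le q1 a0 h2 mf (fun v => enorm_ge0 _) m0 hm.
have E1 : (\int[mu]_(v in `]0%R, 2^-1%R[) (chord_gap s u v `^ q / v `^ a)%:E =
    \int[mu]_(v in `]0%R, 2^-1%R[) (m v `^ q / v `^ a)%:E)%E.
  apply: eq_integral => v; rewrite inE /= in_itv/= => /andP[v0 _].
  by rewrite /m (ltW v0).
have E2 : (\int[mu]_(v in `]0%R, 2^-1%R[) (tangent_kernel q a gamma s u v)%:E =
    \int[mu]_(t in `]0%R, 2^-1%R[) (f t `^ q / t `^ a)%:E)%E.
  by apply: eq_integral => v _; rewrite tangent_kernelE fE.
rewrite E1 E2; exact: H.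
Qed.

Lemma long_triangle_le p q c0 s t u v w : 0 < p -> 0 < q -> 0 < c0 ->
  s = 1 \/ s = -1 -> t = 1 \/ t = -1 -> 0 < v < 2^-1 -> 0 < w < 2^-1 ->
  (forall u v, 0 < v <= 2^-1 -> c0 * v <= enorm (gamma (u + v) - gamma u)) ->
  inv_R_long p q (gamma u) (gamma (u + s * v)) (gamma (u + t * w)) <=
   2 `^ q * (c0 ^+ 3 / 2) `^ (- p) * (v `^ (q - p) * (w `^ (q - p) * (v + w) `^ (- p)) *
    (chord_gap s u v `^ q + chord_gap t u w `^ q)).
Proof.
move=> p0 q0 c00 hs ht /andP[v0 v1] /andP[w0 w1] hb.
have lip x y : x <= y -> enorm (gamma y - gamma x) <= y - x.
  by apply: (chord_le_arc (C1_circle_curve hC)) => z; rewrite hA.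
have lower (e x : R) : e = 1 \/ e = -1 -> 0 < x -> x < 2^-1 ->
    c0 * x <= enorm (gamma (u + e * x) - gamma u).
  move=> [->|->] x0 x1; first by rewrite mul1r; apply: hb; rewrite x0 ltW.
  rewrite mulN1r enorm_sub -[X in gamma X - _](subrK x u); apply: hb.
  by rewrite x0 ltW.
have norm (e x : R) : e = 1 \/ e = -1 -> 0 < x -> `|e * x| = x.
  by move=> he x0; rewrite normrM (gtr0_norm x0); case: he => ->; rewrite ?normrN normr1 mul1r.
have upper : enorm (gamma (u + s * v) - gamma u) <= v.
  have up : u <= u + v by rewrite lerDl ltW.
  have dn : u - v <= u by rewrite gerBl ltW.
  have h1 := lip _ _ up; have h2 := lip _ _ dn.
  case: hs => ->; first by move: h1; rewrite addrAC subrr add0r mul1r.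
  by move: h2; rewrite subKr mulN1r enorm_sub.
exact: (inv_R_long_le (dg u) p0 q0 c00 v0 w0 (norm s v hs v0) (norm t w ht w0)
  (lower s v hs v0 v1) upper (lower t w ht w0 w1)).
Qed.

Lemma menger_long_integral_le p q c0 : 1 < q -> 2 / 3 * q + 1 < p -> p < q + 2 / 3 -> 0 < c0 ->
  (forall u v, 0 < v <= 2^-1 -> c0 * v <= enorm (gamma (u + v) - gamma u)) ->
  exists2 C : R, 0 <= C & forall u,
  (\int[mu]_(x in `]0%R, 1%R[) \int[mu]_(y in `]0%R, 1%R[) menger_long gamma p q u x y <=
   C%:E *
   (\int[mu]_(v in `]0%R, 2^-1%R[) (tangent_kernel q (3 * p - 2 * q - 1) gamma 1 u v)%:E +
    \int[mu]_(v in `]0%R, 2^-1%R[) (tangent_kernel q (3 * p - 2 * q - 1) gamma (-1) u v)%:E))%E.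
Proof.
move=> q1 hp1 hp2 c00 hb.
have [q0 p0 hq1 hq2] : [/\ 0 < q, 0 < p, p < q + 1 & q + 1 < 2 * p] by split; lra.
have a0 : 0 < 3 * p - 2 * q - 1 by lra.
set a := 3 * p - 2 * q - 1.
pose K := 2 `^ q * (c0 ^+ 3 / 2) `^ (- p).
pose L := 2 * ((q - p + 1)^-1 + (2 * p - q - 1)^-1).
have K0 : 0 <= 4 * K by rewrite mulr_ge0// mulr_ge0 ?powR_ge0.
have L0 : 0 <= L by rewrite mulr_ge0// addr_ge0// invr_ge0; lra.
have h2 : (0 : R) < 2^-1 by rewrite invr_gt0.
exists (L * (4 * K * (2 `^ q / a))).
  exact: mulr_ge0 L0 (mulr_ge0 K0 (divr_ge0 (powR_ge0 _ _) (ltW a0))).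
move=> u.
have aux (c k x y : R) : 4 * (c * (k * (x + y))) = k * (4 * c * x + 4 * c * y) by ring.
have aux2 (c x y z : R) : c * (x + y) * z = c * (x * z + y * z) by ring.
pose g s v := chord_gap s u v `^ q.
have g0 s v : 0 <= g s v by exact: powR_ge0.
have mg s : measurable_fun setT (g s).
  exact: (measurable_powR_comp q (measurable_chord_gap s u)).
(* Adding both signs gives a bound that is the same on either side of u, as the folding requires;
   the 4 counts the sign patterns. *)
pose G v := 4 * K * (g 1 v + g (-1) v).
have G0 v : 0 <= G v by rewrite mulr_ge0// addr_ge0.
have mG : measurable_fun setT G.
  apply: measurable_funM; first exact: measurable_cst.
  by apply: measurable_funD; exact: mg.
have gG s v : s = 1 \/ s = -1 -> g s v <= g 1 v + g (-1) v.
  by move=> [->|->]; [rewrite lerDl|rewrite lerDr]; exact: g0.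
pose B v w := K * (v `^ (q - p) * (w `^ (q - p) * (v + w) `^ (- p)) *
  ((g 1 v + g (-1) v) + (g 1 w + g (-1) w))).
have mm : measurable_fun setT (fun z : R * R => menger_long gamma p q u z.1 z.2).
  have mp : measurable_fun setT (fun z : R * R => (u, z.1, z.2)).
    apply: measurable_fun_pair; last exact: measurable_snd.
    by apply: measurable_fun_pair; [exact: measurable_cst|exact: measurable_fst].
  exact: (measurableT_comp (measurable_menger_long hC p q) mp).
have perx x y : menger_long gamma p q u (x + 1) y = menger_long gamma p q u x y.
  by rewrite /menger_long (circle_periodic hC).
have pery x y : menger_long gamma p q u x (y + 1) = menger_long gamma p q u x y.
  by rewrite /menger_long (circle_periodic hC).
have hB s t v w : s = 1 \/ s = -1 -> t = 1 \/ t = -1 -> 0 < v < 2^-1 -> 0 < w < 2^-1 ->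
    (menger_long gamma p q u (u + s * v)%R (u + t * w)%R <= (B v w)%:E)%E.
  move=> hs ht vI wI; rewrite lee_fin.
  apply: (le_trans (long_triangle_le u p0 q0 c00 hs ht vI wI hb)).
  apply: ler_wpM2l; first by rewrite mulr_ge0 ?powR_ge0.
  apply: ler_wpM2l; first by rewrite !mulr_ge0 ?powR_ge0.
  exact: lerD (gG s v hs) (gG t w ht).
have H := @integral2_period_fold_le R u _ B mm (fun z => menger_long_ge0 gamma p q u z.1 z.2) perx pery hB.
apply: (le_trans H).
have -> : (\int[mu]_(v in `]0%R, 2^-1%R[) \int[mu]_(w in `]0%R, 2^-1%R[) (4 * B v w)%:E =
    \int[mu]_(v in `]0%R, 2^-1%R[) \int[mu]_(w in `]0%R, 2^-1%R[)
     (v `^ (q - p) * (w `^ (q - p) * (v + w) `^ (- p)) * (G v + G w))%:E)%E.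
  apply: eq_integral => v _; apply: eq_integral => w _; congr EFin.
  exact: aux.
apply: (le_trans (symmetric_kernel_integral_le hq1 hq2 p0 h2 mG G0)).
rewrite -/a (EFinM L) -muleA; apply: lee_wpmul2l; first by rewrite lee_fin.
have mJ : measurable (`]0, 2^-1[%classic : set R) by exact: measurable_itv.
have gv0 s v : (0 <= (g s v / v `^ a)%:E)%E by rewrite lee_fin divr_ge0 ?powR_ge0.
have mgv s : measurable_fun (`]0, 2^-1[%classic : set R) (fun v : R => (g s v / v `^ a)%:E).
  apply: measurable_funTS; apply/measurable_EFinP.
  apply: measurable_div; first exact: mg.
  exact: measurable_powR.
have -> : (\int[mu]_(v in `]0%R, 2^-1%R[) (G v / v `^ a)%:E =
   (4 * K)%:E * (\int[mu]_(v in `]0%R, 2^-1%R[) (g 1 v / v `^ a)%:E +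
     \int[mu]_(v in `]0%R, 2^-1%R[) (g (-1) v / v `^ a)%:E))%E.
  rewrite -(ge0_integralD mu mJ (fun v _ => gv0 1 v) (mgv 1) (fun v _ => gv0 (-1) v) (mgv (-1))).
  rewrite -(ge0_integralZl_EFin mu mJ (fun v _ => adde_ge0 (gv0 1 v) (gv0 (-1) v))
    (emeasurable_funD (mgv 1) (mgv (-1))) K0).
  apply: eq_integral => v _; rewrite -EFinD -EFinM; congr EFin.
  exact: aux2.
rewrite (EFinM (4 * K)) -muleA; apply: lee_wpmul2l; first by rewrite lee_fin.
have T0 s : (0 <= \int[mu]_(v in `]0%R, 2^-1%R[) (tangent_kernel q a gamma s u v)%:E)%E.
  by apply: integral_ge0 => v _; rewrite lee_fin tangent_kernel_ge0.
rewrite (ge0_muleDr _ (T0 1) (T0 (-1))).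
have p1 : (1 : R) = 1 \/ (1 : R) = -1 by left.
have n1 : (-1 : R) = 1 \/ (-1 : R) = -1 by right.
exact: (leeD (chord_gap_hardy u q1 a0 p1) (chord_gap_hardy u q1 a0 n1)).
Qed.

Lemma intM_lty p q : 1 < q -> 2 / 3 * q + 1 < p -> p < q + 2 / 3 -> injective_circle gamma ->
  (tangent_energy q (3 * p - 2 * q - 1) gamma 1 2^-1 < +oo)%E -> (intM p q gamma < +oo)%E.
Proof.
move=> q1 hp1 hp2 hI hE.
have [c0 c00 hb] := bilipschitz hC hI hA.
have [C C0 H] := menger_long_integral_le q1 hp1 hp2 c00 hb.
set a := 3 * p - 2 * q - 1 in hE H.
suff J : (integral3 `]0%R, 1%R[%classic (menger_long gamma p q) < +oo)%E.
  apply: (le_lt_trans (intM_le_long hC hA p q)).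
  by rewrite lte_add_pinfty// lte_add_pinfty.
have mI : measurable (`]0, 1[%classic : set R) by exact: measurable_itv.
have mJ : measurable (`]0, 2^-1[%classic : set R) by exact: measurable_itv.
pose T (s u : R) : \bar R := (\int[mu]_(v in `]0%R, 2^-1%R[) (tangent_kernel q a gamma s u v)%:E)%E.
have k0 s (z : R * R) : (0 <= (tangent_kernel q a gamma s z.1 z.2)%:E)%E.
  by rewrite lee_fin tangent_kernel_ge0.
have mT s : measurable_fun setT (T s).
  exact: (measurable_integral mJ (measurable_tangent_kernel hC q a s) (k0 s)).
have T0 s u : (0 <= T s u)%E by apply: integral_ge0 => v _; exact: (k0 s (u, v)).
apply: (@le_lt_trans _ _ (\int[mu]_(u in `]0%R, 1%R[) (C%:E * (T 1%R u + T (-1)%R u)))%E).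
  apply: le_integral_nomeas => u _; last exact: H.
  by apply: integral_ge0 => x _; apply: integral_ge0 => y _; exact: menger_long_ge0.
rewrite (ge0_integralZl_EFin mu mI (fun u _ => adde_ge0 (T0 1 u) (T0 (-1) u))
    (measurable_funTS (emeasurable_funD (mT 1) (mT (-1)))) C0).
rewrite (ge0_integralD mu mI (fun u _ => T0 1 u) (measurable_funTS (mT 1))
  (fun u _ => T0 (-1) u) (measurable_funTS (mT (-1)))).
have hE' : (tangent_energy q a gamma (-1) 2^-1 < +oo)%E.
  by rewrite (tangent_energy_sym hC); exact: hE.
have h := lte_add_pinfty hE hE'.
have C0' : (0 <= C%:E)%E by rewrite lee_fin.
have Cf : C%:E \is a fin_num by [].
exact: (lte_mul_pinfty C0' Cf h).
Qed.

End LongTrianglesBound.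

(** * The Sobolev norm of an arc-length curve *)

Section SobolevNorm.
Set Implicit Arguments.
Unset Strict Implicit.
Context {R : realType}.
Variables p q : R.
Hypotheses (q1 : 1 < q) (hp1 : 2 / 3 * q + 1 < p) (hp2 : p < q + 2 / 3).
Let q0 : 0 < q := lt_trans ltr01 q1.
Notation sigma := ((3 * p - 2) / q - 1).

(** The two bounds on p amount to 1 + 1/q < sigma < 2, so that just the first derivative enters the
    norm. *)
Lemma truncn_sobolev_order : Num.truncn sigma = 1%N.
Proof.
apply: truncn_def; rewrite lerBrDr ltrBlDr ler_pdivlMr// ltr_pdivrMr//.
by move: q1 hp1 hp2 => h1 h2 h3; apply/andP; split; lra.
Qed.

Lemma sobolev_order_frac : sigma - 1%:R = (3 * p - 2 * q - 2) / q.
Proof. by field; rewrite gt_eqF. Qed.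

Lemma W_int_norm1 n (f : R -> 'rV[R]_n) :
  W_int_norm 1 q f = (Lp_norm q f + Lp_norm q (derive1 f))%E.
Proof. by rewrite /W_int_norm big_ord_recr big_ord1. Qed.

Lemma W_frac_normE n (f : R -> 'rV[R]_n) : W_frac_norm sigma q f =
  (Lp_norm q f + Lp_norm q (derive1 f) + slobodeckij ((3 * p - 2 * q - 2) / q) q f)%E.
Proof.
by rewrite /W_frac_norm truncn_sobolev_order W_int_norm1 sobolev_order_frac.
Qed.

Section OneCurve.
Context {n : nat} (gamma : R -> 'rV[R]_n).
Context (hC : C1_circle gamma) (hA : arclength_parametrized gamma).

Lemma derive1_subr_cst (c : 'rV[R]_n) : derive1 (fun u => gamma u - c) = derive1 gamma.
Proof.
apply/funext => u.
have E : (fun h : R => h^-1 *: (gamma (h + u) - c - (gamma u - c))) =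
         (fun h : R => h^-1 *: (gamma (h + u) - gamma u)).
  by apply/funext => h; rewrite opprB addrA subrK.
by rewrite /derive1 E.
Qed.

Lemma Lp_norm_derive1_le : (Lp_norm q (derive1 gamma) <= 1%:E)%E.
Proof. by apply: Lp_norm_le => // u _; rewrite hA. Qed.

Lemma slobodeckij_subr_cst s (c : 'rV[R]_n) :
  slobodeckij s q (fun u => gamma u - c) = slobodeckij s q gamma.
Proof. by rewrite /slobodeckij derive1_subr_cst. Qed.

(** The curvature is invariant under translations and the L^q norm of the curve is not, so the curve
    is first moved to pass through the origin. A closed curve of length 1 then stays within distance
    1 of it. *)
Lemma W_frac_norm_subr_le u0 : (W_frac_norm sigma%R q (fun u => gamma u - gamma u0)%R <=
  1 + 1 + slobodeckij ((3 * p - 2 * q - 2) / q) q gamma)%E.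
Proof.
rewrite W_frac_normE slobodeckij_subr_cst derive1_subr_cst.
apply: (leeD (leeD _ Lp_norm_derive1_le) (lexx _)).
by apply: Lp_norm_le => // u uI; exact: enorm_gamma_sub_le.
Qed.

(** Arc length makes the curve 1-Lipschitz, which gives absolute continuity with d = e. Hence
    membership in the fractional space is decided by the seminorm alone. *)
Lemma C1_circle_W_int : W_int 1 q gamma.
Proof.
have lip x y : x <= y -> enorm (gamma y - gamma x) <= y - x.
  by apply: (chord_le_arc (C1_circle_curve hC)) => z; rewrite hA.
split.
- by case: hC.
- move=> j; rewrite ltnS leqn0 => /eqP -> e e0; exists e => // m a b hab _ hs.
  apply: le_lt_trans hs; apply: ler_sum => i _; apply: lip.
  by case: (hab i) => _ [].
- by move=> i; rewrite derive1n1; exact: (circle_measurable hC).2.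
- rewrite W_int_norm1.
  have h1 : (Lp_norm q gamma <= (enorm (gamma 0) + 1)%:E)%E.
    apply: Lp_norm_le => //; first by rewrite addr_ge0 ?enorm_ge0.
    move=> u uI; rewrite -[gamma u](subrK (gamma 0)) addrC (le_trans (enormD _ _))// lerD2l.
    exact: enorm_gamma_sub_le.
  exact: (lte_add_pinfty (le_lt_trans h1 (ltry _)) (le_lt_trans Lp_norm_derive1_le (ltry _))).
Qed.

Lemma Lp_norm_ge0 (f : R -> 'rV[R]_n) : (0 <= Lp_norm q f)%E.
Proof. exact: poweR_ge0. Qed.

Lemma W_fracE : W_frac sigma q gamma <-> (slobodeckij ((3 * p - 2 * q - 2) / q) q gamma < +oo)%E.
Proof.
have W := C1_circle_W_int.
rewrite /W_frac truncn_sobolev_order W_frac_normE; split=> [[_]|h].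
  apply: le_lt_trans; apply: leeDr.
  by rewrite adde_ge0 ?Lp_norm_ge0.
split => //; apply: lte_add_pinfty => //.
by rewrite -W_int_norm1; case: W.
Qed.

End OneCurve.

End SobolevNorm.

Theorem theorem1 (R : realType) (p q : R)
    (hq : 1 < q) (hp1 : 2 / 3 * q + 1 < p) (hp2 : p < q + 2 / 3) :
  (forall (n : nat) (gamma : R -> 'rV[R]_n),
     C1_circle gamma -> injective_circle gamma ->
     arclength_parametrized gamma ->
     ((intM p q gamma < +oo)%E <-> W_frac ((3 * p - 2) / q - 1) q gamma)) /\
  (exists C beta : R, 0 < C /\ 0 < beta /\
     forall (n : nat) (gamma : R -> 'rV[R]_n),
       C1_circle gamma -> injective_circle gamma ->
       arclength_parametrized gamma ->
       (intM p q gamma < +oo)%E ->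
       forall u0 : R,
       (W_frac_norm ((3 * p - 2) / q - 1)%R q
          (fun u => gamma u - gamma u0)%R
        <= C%:E * (intM p q gamma + intM p q gamma `^ beta))%E).
Proof.
have [C [beta [C0 b0 H]]] := slobodeckij_le_intM hq hp1.
split; last first.
  exists C, beta; split=> //; split=> // n gamma hC _ hA hM u0.
  exact: le_trans (W_frac_norm_subr_le hq hp1 hp2 hC hA u0) (H n gamma hC hA hM).
have q0 : 0 < q by lra.
move=> n gamma hC hI hA; rewrite (W_fracE hq hp1 hp2 hC hA); split=> [hM|hS].
  have h : (C%:E * (intM p q gamma + intM p q gamma `^ beta) < +oo)%E.
    by rewrite lte_mul_pinfty ?lee_fin ?(ltW C0)// lte_add_pinfty// poweR_lty.
  apply: le_lt_trans (le_lt_trans (H n gamma hC hA hM) h).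
  by apply: leeDr; rewrite adde_ge0// lee_fin.
apply: (intM_lty hC hA hq hp1 hp2 hI).
move: hS; rewrite (slobodeckij_tangent_energy hC).
have -> : 1 + q * ((3 * p - 2 * q - 2) / q) = 3 * p - 2 * q - 1.
  by rewrite mulrCA divff ?gt_eqF// mulr1; ring.
have := tangent_energy_ge0 gamma q (3 * p - 2 * q - 1) 1 2^-1.
case: (tangent_energy _ _ _ _ _) => [r| |] // _; first by move=> _; rewrite ltry.
(* In the remaining case the energy is infinite; as 1/q is not 0, its power, the seminorm, is
   infinite as well, contrary to the assumption. *)
have qi : q^-1 != 0 by rewrite invr_eq0 gt_eqF.
by rewrite addye// poweRyr.
Qed.
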